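(* Let $g(z)$ be a non-constant meromorphic function of one complex variable $z=x+iy\in\mathbb{C}$ ($x,y\in\mathbb{R}$), let $u$ and $v$ be the real and imaginary parts of $g$, and let $f(x,y)=u(x,y)^2+v(x,y)^2$. Assume that the constant $\alpha>0$ in the definition of New Q-Newton's method (see the context) does not belong to the set $\{(n-3)/(n-1):\ n=2,3,4,\ldots\}$. Let $\{(x_n,y_n)\}$ be a sequence constructed by New Q-Newton's method Backtracking (defined in the context) applied to $f$ from an arbitrary initial point $(x_0,y_0)$ which is not a pole of $f$. Then either $\lim_{n\to\infty}(x_n^2+y_n^2)=\infty$, or the sequence $\{(x_n,y_n)\}$ converges to a point $(x^*,y^* )$ which is a critical point of $f$.
   Context: The poles of $f$ are the points $(x,y)\in\mathbb{R}^2$ such that $x+iy$ is a pole of $g$; $f$ is real analytic on the complement of its poles, and one puts $f=+\infty$ at the poles. New Q-Newton's method Backtracking (in $\mathbb{R}^m$; here $m=2$). Fix $\alpha>0$, pairwise distinct real numbers $\delta_0,\ldots,\delta_m$, and a backtracking factor $\beta\in(0,1)$. Put $\kappa=\frac12\min_{i\neq i'}|\delta_i-\delta_{i'}|$. Given the current point $z_k$: if $\nabla f(z_k)=0$, put $z_{k+1}=z_k$. Otherwise: (i) let $j$ be the smallest index in $\{0,\ldots,m\}$ such that all eigenvalues of $A_k:=\nabla^2 f(z_k)+\delta_j\|\nabla f(z_k)\|^{1+\alpha}\mathrm{Id}$ have absolute value $\geq\kappa\|\nabla f(z_k)\|^{1+\alpha}$ (such $j$ always exists); (ii) put $v_k=A_k^{-1}\nabla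 f(z_k)$ and $w_k=pr_{A_k,+}(v_k)-pr_{A_k,-}(v_k)$, where $pr_{A_k,+}$ and $pr_{A_k,-}$ are the orthogonal projections onto the span of the eigenvectors of $A_k$ with positive, respectively negative, eigenvalues; (iii) (line search) let $\beta_k$ be the largest number in $\{1,\beta,\beta^2,\ldots\}$ satisfying Armijo's condition $f(z_k)-f(z_k-\beta_k w_k)\geq\frac12\beta_k\langle w_k,\nabla f(z_k)\rangle$, and put $z_{k+1}=z_k-\beta_k w_k$. With $z_0$ not a pole, the values $f(z_k)$ are non-increasing, so the sequence never lands on a pole. *)

(* Defs.v *)
From Stdlib Require Import Reals ClassicalEpsilon.
From Coquelicot Require Import Coquelicot.
Open Scope R_scope.

(** ** Meromorphic functions on the plane *)

Definition holomorphic_at (g : C -> C) (z : C) : Prop :=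
  locally z (fun w => ex_derive g w).

(* The value of [g] at a pole is irrelevant: only punctured neighbourhoods
   are involved. *)
Definition is_pole (g : C -> C) (z : C) : Prop :=
  locally' z (fun w => ex_derive g w) /\
  filterlim (fun w => Cmod (g w)) (locally' z) (Rbar_locally p_infty).

(* The two alternatives are mutually exclusive; poles are isolated because [g]
   is complex differentiable on a punctured neighbourhood of each of them. *)
Definition meromorphic (g : C -> C) : Prop :=
  forall z : C, holomorphic_at g z \/ is_pole g z.

Definition constant_off_poles (g : C -> C) : Prop :=
  exists c : C, forall z : C, ~ is_pole g z -> g z = c.

(* [C] is by definition [R * R], and the pair [(x, y)] is [x + i y]; hence a
   point of the real plane can be fed directly to [g]. *)
Definition sq_modulus (g : C -> C) (p : R * R) : Rbar :=
  if excluded_middle_informative (is_pole g p) then p_infty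
  else Finite (Re (g p) ^ 2 + Im (g p) ^ 2).

(** ** Differential calculus and linear algebra in the plane *)

Definition dot (u v : R * R) : R := fst u * fst v + snd u * snd v.

Definition partial1 (h : R * R -> R) (p : R * R) : R :=
  Derive (fun x => h (x, snd p)) (fst p).
Definition partial2 (h : R * R -> R) (p : R * R) : R :=
  Derive (fun y => h (fst p, y)) (snd p).

(* For [F : R * R -> Rbar] the derivatives are those of the real-valued
   function [fun p => real (F p)]; they are meaningful where [F] is finite in a
   neighbourhood of [p]. *)
Definition grad (F : R * R -> Rbar) (p : R * R) : R * R :=
  let h := fun q => real (F q) in (partial1 h p, partial2 h p).

(* A 2x2 matrix is the pair of its rows. *)
Definition mat2 : Type := ((R * R) * (R * R))%type.

Definition mat_id : mat2 := ((1, 0), (0, 1)).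

Definition mat_app (A : mat2) (v : R * R) : R * R :=
  (dot (fst A) v, dot (snd A) v).

Definition hessian (F : R * R -> Rbar) (p : R * R) : mat2 :=
  let h := fun q => real (F q) in
  ((partial1 (partial1 h) p, partial1 (partial2 h) p),
   (partial2 (partial1 h) p, partial2 (partial2 h) p)).

Definition eigenvector (A : mat2) (l : R) (v : R * R) : Prop :=
  v <> zero /\ mat_app A v = scal l v.

Definition eigenvalue (A : mat2) (l : R) : Prop :=
  exists v, eigenvector A l v.

Inductive span (S : R * R -> Prop) : R * R -> Prop :=
| span_zero : span S zero
| span_add (a : R) (v w : R * R) :
    S v -> span S w -> span S (plus (scal a v) w).

Definition orth_proj (V : R * R -> Prop) (v p : R * R) : Prop :=
  V p /\ forall u, V u -> dot u (minus v p) = 0.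

Definition positive_space (A : mat2) : R * R -> Prop :=
  span (fun e => exists l, 0 < l /\ eigenvector A l e).
Definition negative_space (A : mat2) : R * R -> Prop :=
  span (fun e => exists l, l < 0 /\ eigenvector A l e).

(** ** New Q-Newton's method Backtracking in dimension 2 *)

(* Only the values of [delta] at the indices 0, 1, 2 are used. *)
Definition pairwise_distinct (delta : nat -> R) : Prop :=
  forall i i' : nat,
    (i <= 2)%nat -> (i' <= 2)%nat -> i <> i' -> delta i <> delta i'.

Definition kappa (delta : nat -> R) : R :=
  / 2 * Rmin (Rabs (delta 0%nat - delta 1%nat))
          (Rmin (Rabs (delta 0%nat - delta 2%nat))
                (Rabs (delta 1%nat - delta 2%nat))).

(* [Rpower] has the expected value for a positive base; this quantity is used
   only where the gradient is nonzero. *)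
Definition grad_pow (alpha : R) (F : R * R -> Rbar) (p : R * R) : R :=
  Rpower (norm (grad F p)) (1 + alpha).

Definition shifted_hessian (alpha : R) (delta : nat -> R)
    (F : R * R -> Rbar) (p : R * R) (j : nat) : mat2 :=
  plus (hessian F p) (scal (delta j * grad_pow alpha F p) mat_id).

Definition admissible_index (alpha : R) (delta : nat -> R)
    (F : R * R -> Rbar) (p : R * R) (j : nat) : Prop :=
  (j <= 2)%nat /\
  forall l, eigenvalue (shifted_hessian alpha delta F p j) l ->
    kappa delta * grad_pow alpha F p <= Rabs l.

Definition selected_index (alpha : R) (delta : nat -> R)
    (F : R * R -> Rbar) (p : R * R) (j : nat) : Prop :=
  admissible_index alpha delta F p j /\
  forall i, admissible_index alpha delta F p i -> (j <= i)%nat.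

(* [mat_app A v = d] stands for [v = A^-1 d]; it is used with [A] invertible. *)
Definition search_direction (A : mat2) (d w : R * R) : Prop :=
  exists v vp vm : R * R,
    mat_app A v = d /\
    orth_proj (positive_space A) v vp /\
    orth_proj (negative_space A) v vm /\
    w = minus vp vm.

(* If [F] is [+oo] at the new point and finite at [p], the right-hand side is
   [-oo] and the condition fails. *)
Definition armijo (F : R * R -> Rbar) (p w : R * R) (b : R) : Prop :=
  Rbar_le (Finite (/ 2 * b * dot w (grad F p)))
          (Rbar_minus (F p) (F (minus p (scal b w)))).

Definition line_search (beta : R) (F : R * R -> Rbar) (p w : R * R) (b : R)
    : Prop :=
  (exists i : nat, b = beta ^ i) /\
  armijo F p w b /\
  forall i : nat, armijo F p w (beta ^ i) -> beta ^ i <= b.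

Definition nqn_step (alpha : R) (delta : nat -> R) (beta : R)
    (F : R * R -> Rbar) (p p' : R * R) : Prop :=
  (grad F p = zero /\ p' = p) \/
  (grad F p <> zero /\
   exists (j : nat) (w : R * R) (b : R),
     selected_index alpha delta F p j /\
     search_direction (shifted_hessian alpha delta F p j) (grad F p) w /\
     line_search beta F p w b /\
     p' = minus p (scal b w)).

(* Main.v *)
Require Import Defs.
From Stdlib Require Import Reals Lra Lia Psatz Wf_nat ClassicalEpsilon.
From Coquelicot Require Import Coquelicot.
Open Scope R_scope.

(** Write [f = |g|^2].  Near a point that is not a pole, [g] is holomorphic, and
everything the method uses has a closed form there:

- [grad f = 2 g conj(g')], of norm [2 |g g'|];
- the eigenvalues of the Hessian of [f] are [2 (|g'|^2 + |g g''|)] and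
  [2 (|g'|^2 - |g g''|)].

The critical points of [f] are therefore the zeros of [g g'].

The values [f (z_n)] are nonincreasing and nonnegative, so a cluster point of
the sequence is not a pole.  It is not a noncritical point either: there the
eigenvalues of [A_k] are bounded and bounded away from [0], Armijo's condition
holds for all short steps, and every visit to a small neighbourhood lowers [f]
by a fixed amount ([step_near_noncritical_point]).  Hence all cluster points are
critical.

Let [p] be a cluster point, and suppose that [g] is not constant near [p].
Write [g w = g p + (w - p)^N h w] with [N >= 1] and [h p <> 0].  Two cases occur.

- If [g p = 0], then [|g'|^2] and [|g g''|] are of order [|w - p|^(2 N - 2)] in
  the ratio [N : N - 1], and their difference keeps that order.
- If [g p <> 0], then [N >= 2] because [p] is critical, and [|g g''|],
  of order [|w - p|^(N - 2)], dominates [|g'|^2].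

Either way [|g g'| <= K |w - p| ||g'|^2 - |g g''||]
([hessian_gap_near_critical_point]).  So the gradient is smaller than the least
absolute eigenvalue of the Hessian by a factor [O(|w - p|)].  The shift
[delta_j |grad f|^(1 + alpha)] is of smaller order than the gradient, hence
negligible, and the step is [O(|w - p|)] ([step_near_critical_point]).
Moreover [p] is an isolated critical point.  A sequence that came back to [p]
forever without converging would cross a small annulus around [p] infinitely
often, with steps too short to jump over it; a cluster point in that annulus
would be a second critical point near [p].  If [g] is constant near [p], the
sequence reaches a point where the gradient vanishes and stops there.

The local form of [g] comes from Cauchy's integral formula, and [g] is only known
to be complex differentiable at each point, with no continuity of [g'].
Goursat's bisection argument is carried out directly on a homotopy [Phi] from the
unit square to the plane ([homotopy_cauchy]); the homotopy that moves a small
circle around [z] to a large circle around [0] then gives the formula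
([cauchy_formula]).  Expanding the kernel [1 / (e - z)] in powers of [z], one term
at a time, gives the order of vanishing, and differentiating under the integral
gives two derivatives ([holomorphic_local_form]). *)

(** * Complex derivatives and derivatives of plane curves *)

(** Stated on discs of [Cmod], so that estimates can be composed without going
through the product topology that the plane carries. *)
Definition has_cderiv (k : C -> C) (z l : C) : Prop :=
  forall eps, 0 < eps -> exists d, 0 < d /\ forall w,
    Cmod (w - z) < d -> Cmod (k w - k z - l * (w - z)) <= eps * Cmod (w - z).

Definition path_deriv (c : R -> C) (s : R) (l : C) : Prop :=
  forall eps, 0 < eps -> exists d, 0 < d /\ forall t,
    Rabs (t - s) < d ->
    Cmod (c t - c s - RtoC (t - s) * l) <= eps * Rabs (t - s).

Lemma Cmod_le_eq (a b : C) (x : R) : Cmod b <= x -> a = b -> Cmod a <= x.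
Proof. now intros H ->. Qed.

Lemma Cmod_lt_eq (a b : C) (x : R) : Cmod b < x -> a = b -> Cmod a < x.
Proof. now intros H ->. Qed.

Lemma ball_of_Cmod (z w : C) (d : R) :
  Cmod (w - z) < d -> @ball C_UniformSpace z d w.
Proof. intros H; apply C_NormedModule_mixin_compat1; exact H. Qed.

Lemma locally_C_iff (z : C) (P : C -> Prop) :
  @locally C_UniformSpace z P <->
  exists d, 0 < d /\ forall w, Cmod (w - z) < d -> P w.
Proof.
split.
- intros [d Hd]. exists d; split; [apply cond_pos|].
  intros w Hw; apply Hd, ball_of_Cmod, Hw.
- intros (d & Hd & H).
  assert (s2 : 0 < sqrt 2) by (apply sqrt_lt_R0; lra).
  assert (Hd' : 0 < d / sqrt 2) by (apply Rdiv_lt_0_compat; lra).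
  exists (mkposreal _ Hd'); intros w Hw; apply H.
  apply C_NormedModule_mixin_compat2 in Hw; simpl in Hw.
  replace (sqrt 2 * (d / sqrt 2)) with d in Hw by (field; lra).
  exact Hw.
Qed.

Lemma ex_derive_has_cderiv (k : C -> C) (z : C) :
  @ex_derive C_AbsRing C_NormedModule k z -> exists l, has_cderiv k z l.
Proof.
intros [l [_ Hl]]; exists l; intros eps He.
specialize (Hl z (fun P H => H) (mkposreal eps He)).
change (@locally (AbsRing_UniformSpace C_AbsRing) z (fun x : C =>
  Cmod (minus (minus (k x) (k z)) (scal (minus x z) l))
  <= eps * Cmod (minus x z))) in Hl.
destruct Hl as [d Hd]; exists d; split; [apply cond_pos|].
intros w Hw; specialize (Hd w Hw).
replace (k w - k z - l * (w - z))%C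
  with (minus (minus (k w) (k z)) (scal (minus w z) l)); [exact Hd|].
change (k w - k z - (w - z) * l = k w - k z - l * (w - z))%C; ring.
Qed.

Lemma path_deriv_is_derive (c : R -> C) (s : R) (l : C) :
  path_deriv c s l -> @is_derive R_AbsRing C_R_NormedModule c s l.
Proof.
intros H; split; [apply is_linear_scal_l|].
intros x Hx.
assert (x = s) as ->.
{ symmetry; apply (is_filter_lim_locally_unique (V:=R_NormedModule)); exact Hx. }
intros [eps He]; simpl.
destruct (H eps He) as (d & Hd & H').
exists (mkposreal d Hd); intros t Ht; specialize (H' t Ht).
rewrite <- Cmod_norm.
change (norm (minus t s)) with (Rabs (t - s)).
eapply Rle_trans; [right|exact H']; f_equal.
apply injective_projections; simpl; unfold minus, plus, opp, scal, mult; simpl;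
  unfold mult; simpl; ring.
Qed.

Lemma Re_deriv (c : R -> C) (s : R) (l : C) :
  path_deriv c s l -> is_derive (fun t => Re (c t)) s (Re l).
Proof.
intros H; apply is_derive_Reals; intros eps He.
destruct (H (eps / 2) ltac:(lra)) as (d & Hd & H').
exists (mkposreal d Hd); intros h h0 Hh; simpl in Hh.
specialize (H' (s + h)).
replace (s + h - s) with h in H' by ring.
specialize (H' Hh).
assert (P : 0 < Rabs h) by now apply Rabs_pos_lt.
replace ((Re (c (s + h)) - Re (c s)) / h - Re l)
  with (Re (c (s + h)%R - c s - RtoC h * l)%C / h)
  by (unfold Re, RtoC; simpl; field; auto).
unfold Rdiv; rewrite Rabs_mult, Rabs_inv.
apply Rle_lt_trans with (eps / 2 * Rabs h * / Rabs h).
- apply Rmult_le_compat_r; [left; now apply Rinv_0_lt_compat|].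
  eapply Rle_trans; [apply re_le_Cmod|exact H'].
- rewrite Rmult_assoc, Rinv_r by lra; lra.
Qed.

Lemma path_deriv_mul (c : R -> C) (s : R) (l a : C) :
  path_deriv c s l -> path_deriv (fun t => a * c t)%C s (a * l)%C.
Proof.
intros H eps He.
assert (Ha := Cmod_ge_0 a).
destruct (H (eps / (1 + Cmod a))) as (d & Hd & H').
{ apply Rdiv_lt_0_compat; lra. }
exists d; split; [exact Hd|]; intros t Ht; specialize (H' t Ht).
replace (a * c t - a * c s - RtoC (t - s) * (a * l))%C
  with (a * (c t - c s - RtoC (t - s) * l))%C by ring.
rewrite Cmod_mult.
assert (Ht0 := Rabs_pos (t - s)).
apply Rle_trans with ((1 + Cmod a) * (eps / (1 + Cmod a) * Rabs (t - s))).
- apply Rmult_le_compat; try lra; apply Cmod_ge_0.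
- right; field; lra.
Qed.

Lemma Im_deriv (c : R -> C) (s : R) (l : C) :
  path_deriv c s l -> is_derive (fun t => Im (c t)) s (Im l).
Proof.
intros H; apply (path_deriv_mul c s l (- Ci)%C), Re_deriv in H.
replace (Im l) with (Re (- Ci * l)%C) by (unfold Re, Im; simpl; ring).
eapply is_derive_ext; [|exact H].
intros t; unfold Re, Im; simpl; ring.
Qed.

Lemma has_cderiv_lipschitz (k : C -> C) (z l : C) :
  has_cderiv k z l -> exists d, 0 < d /\ forall w, Cmod (w - z) < d ->
    Cmod (k w - k z) <= (1 + Cmod l) * Cmod (w - z).
Proof.
intros H; destruct (H 1 ltac:(lra)) as (d & Hd & H').
exists d; split; [exact Hd|]; intros w Hw; specialize (H' w Hw).
replace (k w - k z)%C with ((k w - k z - l * (w - z)) + l * (w - z))%C by ring.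
eapply Rle_trans; [apply Cmod_triangle|].
rewrite Cmod_mult; lra.
Qed.

Definition ccont (k : C -> C) (z : C) : Prop :=
  forall eps, 0 < eps -> exists d, 0 < d /\ forall w,
    Cmod (w - z) < d -> Cmod (k w - k z) < eps.

Lemma has_cderiv_cont (k : C -> C) (z l : C) : has_cderiv k z l -> ccont k z.
Proof.
intros H eps He; destruct (has_cderiv_lipschitz _ _ _ H) as (d & Hd & H').
assert (Hl := Cmod_ge_0 l).
assert (0 < eps / (1 + Cmod l)) by (apply Rdiv_lt_0_compat; lra).
exists (Rmin d (eps / (1 + Cmod l))); split; [apply Rmin_pos; lra|].
intros w Hw.
assert (W1 := Rlt_le_trans _ _ _ Hw (Rmin_l _ _)).
assert (W2 := Rlt_le_trans _ _ _ Hw (Rmin_r _ _)).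
eapply Rle_lt_trans; [apply H', W1|].
apply Rlt_le_trans with ((1 + Cmod l) * (eps / (1 + Cmod l))).
- apply Rmult_lt_compat_l; lra.
- right; field; lra.
Qed.

Lemma path_deriv_lipschitz (c : R -> C) (s : R) (l : C) :
  path_deriv c s l -> exists d, 0 < d /\ forall t, Rabs (t - s) < d ->
    Cmod (c t - c s) <= (1 + Cmod l) * Rabs (t - s).
Proof.
intros H; destruct (H 1 ltac:(lra)) as (d & Hd & H').
exists d; split; [exact Hd|]; intros w Hw; specialize (H' w Hw).
replace (c w - c s)%C with ((c w - c s - RtoC (w - s) * l) + RtoC (w - s) * l)%C by ring.
eapply Rle_trans; [apply Cmod_triangle|].
rewrite Cmod_mult, Cmod_R; lra.
Qed.

Lemma path_deriv_comp (k : C -> C) (c : R -> C) (s : R) (l l' : C) :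
  path_deriv c s l -> has_cderiv k (c s) l' ->
  path_deriv (fun t => k (c t)) s (l' * l)%C.
Proof.
intros Hc Hk eps He.
assert (Hl := Cmod_ge_0 l). assert (Hl' := Cmod_ge_0 l').
set (e1 := eps / 2 / (1 + Cmod l)).
set (e2 := eps / 2 / (1 + Cmod l')).
assert (E1 : 0 < e1) by (apply Rdiv_lt_0_compat; lra).
assert (E2 : 0 < e2) by (apply Rdiv_lt_0_compat; lra).
destruct (Hk e1 E1) as (d1 & D1 & H1).
destruct (Hc e2 E2) as (d2 & D2 & H2).
destruct (path_deriv_lipschitz _ _ _ Hc) as (d3 & D3 & H3).
assert (D4 : 0 < d1 / (1 + Cmod l)) by (apply Rdiv_lt_0_compat; lra).
exists (Rmin (Rmin d2 d3) (d1 / (1 + Cmod l))).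
split; [repeat apply Rmin_pos; lra|].
intros t Ht.
assert (T1 := Rlt_le_trans _ _ _ Ht (Rmin_l _ _)).
assert (T2 := Rlt_le_trans _ _ _ T1 (Rmin_l _ _)).
assert (T3 := Rlt_le_trans _ _ _ T1 (Rmin_r _ _)).
assert (T4 := Rlt_le_trans _ _ _ Ht (Rmin_r _ _)).
specialize (H2 t T2). specialize (H3 t T3).
assert (Hn : Cmod (c t - c s) < d1).
{ eapply Rle_lt_trans; [exact H3|].
  apply Rlt_le_trans with ((1 + Cmod l) * (d1 / (1 + Cmod l))).
  - apply Rmult_lt_compat_l; lra.
  - right; field; lra. }
specialize (H1 _ Hn).
replace (k (c t) - k (c s) - RtoC (t - s) * (l' * l))%C
  with ((k (c t) - k (c s) - l' * (c t - c s))
        + l' * (c t - c s - RtoC (t - s) * l))%C by ring.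
eapply Rle_trans; [apply Cmod_triangle|].
rewrite Cmod_mult.
assert (Ha := Rabs_pos (t - s)).
assert (A1 : e1 * Cmod (c t - c s) <= eps / 2 * Rabs (t - s)).
{ apply Rle_trans with (e1 * ((1 + Cmod l) * Rabs (t - s))).
  - apply Rmult_le_compat_l; lra.
  - right; unfold e1; field; lra. }
assert (A2 : Cmod l' * Cmod (c t - c s - RtoC (t - s) * l) <= eps / 2 * Rabs (t - s)).
{ apply Rle_trans with ((1 + Cmod l') * (e2 * Rabs (t - s))).
  - apply Rmult_le_compat; try lra; apply Cmod_ge_0.
  - right; unfold e2; field; lra. }
lra.
Qed.

Lemma has_cderiv_mult (f g : C -> C) (z a b : C) :
  has_cderiv f z a -> has_cderiv g z b ->
  has_cderiv (fun w => f w * g w)%C z (a * g z + f z * b)%C.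
Proof.
intros Hf Hg eps He.
set (K := 1 + Cmod (g z) + Cmod (f z) + Cmod a).
assert (P1 := Cmod_ge_0 (g z)). assert (P2 := Cmod_ge_0 (f z)).
assert (P3 := Cmod_ge_0 a).
assert (HK : 0 < K) by (unfold K; lra).
assert (E : 0 < eps / (3 * K)) by (apply Rdiv_lt_0_compat; lra).
destruct (Hf _ E) as (d1 & D1 & H1).
destruct (Hg _ E) as (d2 & D2 & H2).
destruct (has_cderiv_lipschitz _ _ _ Hf) as (d3 & D3 & H3).
assert (E' : 0 < Rmin (K) (eps / (3 * K))) by (apply Rmin_pos; lra).
destruct (has_cderiv_cont _ _ _ Hg _ E') as (d4 & D4 & H4).
exists (Rmin (Rmin d1 d2) (Rmin d3 d4)).
split; [repeat apply Rmin_pos; lra|].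
intros w Hw.
assert (T1 := Rlt_le_trans _ _ _ Hw (Rmin_l _ _)).
assert (T2 := Rlt_le_trans _ _ _ Hw (Rmin_r _ _)).
assert (W1 := Rlt_le_trans _ _ _ T1 (Rmin_l _ _)).
assert (W2 := Rlt_le_trans _ _ _ T1 (Rmin_r _ _)).
assert (W3 := Rlt_le_trans _ _ _ T2 (Rmin_l _ _)).
assert (W4 := Rlt_le_trans _ _ _ T2 (Rmin_r _ _)).
specialize (H1 w W1). specialize (H2 w W2). specialize (H3 w W3).
specialize (H4 w W4).
assert (H5 := Rlt_le_trans _ _ _ H4 (Rmin_r _ _)).
replace (f w * g w - f z * g z - (a * g z + f z * b) * (w - z))%C
 with ((f w - f z - a * (w - z)) * g z + f z * (g w - g z - b * (w - z))
       + (f w - f z) * (g w - g z))%C by ring.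
eapply Rle_trans; [apply Cmod_triangle|].
eapply Rle_trans; [apply Rplus_le_compat_r, Cmod_triangle|].
rewrite !Cmod_mult.
set (X := Cmod (w - z)) in *.
assert (HX : 0 <= X) by apply Cmod_ge_0.
set (e := eps / (3 * K)) in *.
assert (B0 : forall u v p, 0 <= u -> u <= e * X -> 0 <= v <= K -> p = u * v -> p <= eps / 3 * X).
{ intros u v p ? ? ? ->. apply Rle_trans with (e * X * K).
  - apply Rmult_le_compat; lra.
  - right; unfold e; field; lra. }
assert (B1 := B0 _ (Cmod (g z)) _ (Cmod_ge_0 _) H1 ltac:(unfold K; lra) eq_refl).
assert (B2 := B0 _ (Cmod (f z)) (Cmod (f z) * Cmod (g w - g z - b * (w - z))%C) (Cmod_ge_0 _) H2 ltac:(unfold K; lra) ltac:(ring)).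
assert (B3 : Cmod (f w - f z) * Cmod (g w - g z) <= eps / 3 * X).
{ apply Rle_trans with (K * X * e).
  - apply Rmult_le_compat; try apply Cmod_ge_0; try lra.
    eapply Rle_trans; [exact H3|]. apply Rmult_le_compat_r; unfold K; lra.
  - right; unfold e; field; lra. }
lra.
Qed.

Lemma has_cderiv_plus (f g : C -> C) (z a b : C) :
  has_cderiv f z a -> has_cderiv g z b ->
  has_cderiv (fun w => f w + g w)%C z (a + b)%C.
Proof.
intros Hf Hg eps He.
destruct (Hf (eps / 2) ltac:(lra)) as (d1 & D1 & H1).
destruct (Hg (eps / 2) ltac:(lra)) as (d2 & D2 & H2).
exists (Rmin d1 d2); split; [apply Rmin_pos; lra|]; intros w Hw.
specialize (H1 w (Rlt_le_trans _ _ _ Hw (Rmin_l _ _))).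
specialize (H2 w (Rlt_le_trans _ _ _ Hw (Rmin_r _ _))).
replace (f w + g w - (f z + g z) - (a + b) * (w - z))%C
  with ((f w - f z - a * (w - z)) + (g w - g z - b * (w - z)))%C by ring.
eapply Rle_trans; [apply Cmod_triangle|]; lra.
Qed.

Lemma has_cderiv_const (a z : C) : has_cderiv (fun _ => a) z 0%C.
Proof.
intros eps He; exists 1; split; [lra|]; intros w _.
replace (a - a - 0 * (w - z))%C with (RtoC 0) by ring.
rewrite Cmod_0; apply Rmult_le_pos; [lra|apply Cmod_ge_0].
Qed.

Lemma has_cderiv_id (z : C) : has_cderiv (fun w => w) z 1%C.
Proof.
intros eps He; exists 1; split; [lra|]; intros w _.
replace (w - z - 1 * (w - z))%C with (RtoC 0) by ring.
rewrite Cmod_0; apply Rmult_le_pos; [lra|apply Cmod_ge_0].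
Qed.

Lemma has_cderiv_ext_loc (f g : C -> C) (z l : C) :
  (exists d, 0 < d /\ forall w, Cmod (w - z) < d -> f w = g w) ->
  has_cderiv f z l -> has_cderiv g z l.
Proof.
intros (d & Hd & E) H eps He.
destruct (H eps He) as (d' & Hd' & H').
exists (Rmin d d'); split; [apply Rmin_pos; lra|]; intros w Hw.
rewrite <- !E; [apply H'|..].
- apply Rlt_le_trans with (1 := Hw), Rmin_r.
- replace (z - z)%C with (RtoC 0) by ring. rewrite Cmod_0; exact Hd.
- apply Rlt_le_trans with (1 := Hw), Rmin_l.
Qed.

Lemma has_cderiv_eq (f : C -> C) (z l l' : C) :
  l = l' -> has_cderiv f z l -> has_cderiv f z l'.
Proof. intros ->; auto. Qed.

(** The error term is exactly [(w - z)^2 / (w z^2)]. *)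
Lemma has_cderiv_inv (z : C) : z <> 0%C ->
  has_cderiv (fun w => / w)%C z (- / (z * z))%C.
Proof.
intros Hz eps He.
assert (Pz : 0 < Cmod z) by now apply Cmod_gt_0.
set (m := Cmod z) in *.
exists (Rmin (m / 2) (eps * (m * m * m) / 2)); split.
{ apply Rmin_pos; [lra|]. apply Rdiv_lt_0_compat; [|lra].
  repeat apply Rmult_lt_0_compat; lra. }
intros w Hw.
assert (W1 := Rlt_le_trans _ _ _ Hw (Rmin_l _ _)).
assert (W2 := Rlt_le_trans _ _ _ Hw (Rmin_r _ _)).
assert (Pw : m / 2 < Cmod w).
{ assert (T := Cmod_triangle w (z - w)).
  replace (w + (z - w))%C with z in T by ring.
  replace (z - w)%C with (- (w - z))%C in T by ring.
  rewrite Cmod_opp in T. fold m in T. lra. }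
assert (Hw0 : w <> 0%C) by (apply Cmod_gt_0; lra).
replace (/ w - / z - - / (z * z) * (w - z))%C
  with ((w - z) * (w - z) * / (w * z * z))%C by (field; auto).
rewrite !Cmod_mult, Cmod_inv by (repeat apply Cmult_neq_0; auto).
rewrite !Cmod_mult. fold m.
set (X := Cmod (w - z)) in *.
assert (HX : 0 <= X) by apply Cmod_ge_0.
replace (X * X * / (Cmod w * m * m)) with (X * / (Cmod w * m * m) * X) by ring.
apply Rmult_le_compat_r; [exact HX|].
apply Rmult_le_reg_r with (Cmod w * m * m); [repeat apply Rmult_lt_0_compat; lra|].
rewrite Rmult_assoc, Rinv_l by (repeat apply Rmult_integral_contrapositive_currified; lra).
apply Rle_trans with (eps * (m * m * m) / 2); [lra|].
replace (eps * (m * m * m) / 2) with (eps * (m / 2 * m * m)) by field.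
apply Rmult_le_compat_l; [lra|].
repeat (apply Rmult_le_compat_r; [lra|]). lra.
Qed.

Lemma has_cderiv_pow (f : C -> C) (z a : C) (n : nat) :
  has_cderiv f z a ->
  has_cderiv (fun w => Cpow (f w) (S n)) z (INR (S n) * Cpow (f z) n * a)%C.
Proof.
intros H; induction n as [|n IH].
- eapply has_cderiv_eq; [|eapply has_cderiv_ext_loc; [|exact H]].
  + simpl; ring.
  + exists 1; split; [lra|]; intros; simpl; ring.
- eapply has_cderiv_eq; [|exact (has_cderiv_mult _ _ _ _ _ H IH)].
  rewrite (S_INR (S n)), RtoC_plus; simpl Cpow; ring.
Qed.

Lemma has_cderiv_shift (f : C -> C) (z a l : C) :
  has_cderiv f (z + a)%C l -> has_cderiv (fun w => f (w + a)%C) z l.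
Proof.
intros H eps He; destruct (H eps He) as (d & Hd & H').
exists d; split; [exact Hd|]; intros w Hw.
replace (w - z)%C with (w + a - (z + a))%C in * by ring. auto.
Qed.

(** * Bisection of squares *)

(** Cousin's lemma in the plane.  If the property failed for the large square, it
would fail for one of its four quarters, and so on; near the common point of
the nested squares this contradicts the local hypothesis.  There the small
squares contain the point they are attached to, so a derivative at that single
point suffices to establish the property. *)
Lemma square_induction (P : R -> R -> R -> Prop) (x0 y0 h0 : R) :
  0 < h0 ->
  (forall x y h, 0 < h -> x0 <= x -> x + (h + h) <= x0 + h0 ->
     y0 <= y -> y + (h + h) <= y0 + h0 ->
     P x y h -> P (x + h) y h -> P x (y + h) h -> P (x + h) (y + h) h ->
     P x y (h + h)) ->
  (forall a b, x0 <= a <= x0 + h0 -> y0 <= b <= y0 + h0 ->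
     exists d, 0 < d /\ forall x y h, 0 < h < d ->
       x0 <= x -> x + h <= x0 + h0 -> y0 <= y -> y + h <= y0 + h0 ->
       x <= a <= x + h -> y <= b <= y + h -> P x y h) ->
  P x0 y0 h0.
Proof.
intros Hh0 split_ local.
destruct (excluded_middle_informative (P x0 y0 h0)) as [Y|N]; [exact Y|exfalso].
set (h := fun n => h0 / 2 ^ n).
assert (p2 : forall n, 0 < 2 ^ n) by (intros; apply pow_lt; lra).
assert (hpos : forall n, 0 < h n) by (intros; apply Rdiv_lt_0_compat; auto).
assert (h2 : forall n, h n = h (S n) + h (S n)).
{ intros n; unfold h; simpl; field. specialize (p2 n); lra. }
pose (good := fun n (p : R * R) => x0 <= fst p /\ fst p + h n <= x0 + h0 /\
  y0 <= snd p /\ snd p + h n <= y0 + h0 /\ ~ P (fst p) (snd p) (h n)).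
assert (step : forall n p, good n p -> exists q, good (S n) q /\
   fst p <= fst q <= fst p + h (S n) /\ snd p <= snd q <= snd p + h (S n)).
{ intros n [x y] (A1 & A2 & A3 & A4 & A5); simpl in *.
  rewrite h2 in A2, A4, A5.
  assert (H := hpos (S n)).
  apply Classical_Prop.NNPP; intros F; apply A5.
  apply split_; try lra; apply Classical_Prop.NNPP; intros G; apply F.
  - exists (x, y); unfold good; simpl; repeat split; auto; lra.
  - exists (x + h (S n), y); unfold good; simpl; repeat split; auto; lra.
  - exists (x, y + h (S n)); unfold good; simpl; repeat split; auto; lra.
  - exists (x + h (S n), y + h (S n)); unfold good; simpl; repeat split; auto; lra. }
assert (base : good O (x0, y0)).
{ unfold good, h; simpl; repeat split; try lra. now replace (h0 / 1) with h0 by field. }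
pose (nxt := fun n (p : {p | good n p}) =>
  let e := constructive_indefinite_description _ (step n (proj1_sig p) (proj2_sig p)) in
  exist (good (S n)) (proj1_sig e) (proj1 (proj2_sig e))).
pose (sq := nat_rect (fun n => {p | good n p}) (exist _ _ base) nxt).
pose (X := fun n => fst (proj1_sig (sq n))). pose (Y := fun n => snd (proj1_sig (sq n))).
assert (G : forall n, good n (X n, Y n)).
{ intros n; unfold X, Y; rewrite <- surjective_pairing; exact (proj2_sig (sq n)). }
assert (St : forall n, X n <= X (S n) <= X n + h (S n) /\ Y n <= Y (S n) <= Y n + h (S n)).
{ intros n. unfold X, Y; simpl. unfold nxt.
  destruct (constructive_indefinite_description _ _) as [q Hq]; simpl; tauto. }
assert (lim : forall Z : nat -> R, (forall n, Z n <= Z (S n) <= Z n + h (S n)) ->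
   exists l, forall n, Z n <= l <= Z n + h n).
{ intros Z HZ.
  assert (dec : forall n m, Z n <= Z (n + m)%nat /\ Z (n + m)%nat + h (n + m)%nat <= Z n + h n).
  { intros n m; induction m as [|m IH].
    - rewrite Nat.add_0_r; lra.
    - rewrite Nat.add_succ_r. specialize (HZ (n + m)%nat). specialize (h2 (n + m)%nat). lra. }
  destruct (ex_finite_lim_seq_incr Z (Z O + h O)) as [l Hl].
  { intros n; apply HZ. }
  { intros n; specialize (dec O n); specialize (hpos n); simpl in dec; lra. }
  exists l; intros n; split.
  - apply (is_lim_seq_incr_compare Z); auto. intros; apply HZ.
  - apply (is_lim_seq_incr_n Z n) in Hl.
    apply (is_lim_seq_le (fun m => Z (m + n)%nat) (fun _ => Z n + h n) l (Z n + h n));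
      [|exact Hl|apply is_lim_seq_const].
    intros m; rewrite Nat.add_comm; specialize (dec n m); specialize (hpos (n + m)%nat); lra. }
destruct (lim X) as [a Ha]; [intros; apply St|].
destruct (lim Y) as [b Hb]; [intros; apply St|].
destruct (local a b) as (d & Hd & L).
{ generalize (G O) (Ha O); unfold good; simpl; intros; lra. }
{ generalize (G O) (Hb O); unfold good; simpl; intros; lra. }
assert (exists n, h n < d) as [n Hn].
{ destruct (pow_lt_1_zero (/ 2)) with (y := d / h0) as [n Hn].
  - rewrite Rabs_right; lra.
  - apply Rdiv_lt_0_compat; lra.
  - exists n; specialize (Hn n (Nat.le_refl n)).
    rewrite Rabs_right in Hn by (apply Rle_ge, pow_le; lra).
    unfold h, Rdiv. rewrite <- pow_inv.
    apply Rmult_lt_compat_l with (r := h0) in Hn; [|exact Hh0].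
    replace (h0 * (d / h0)) with d in Hn by (field; lra). exact Hn. }
destruct (G n) as (A1 & A2 & A3 & A4 & A5); simpl in *.
apply A5, L; auto; try apply Ha; try apply Hb.
Qed.

(** * Integrals of plane curves *)

Definition path_cont (c : R -> C) (s : R) : Prop :=
  forall eps, 0 < eps -> exists d, 0 < d /\ forall t,
    Rabs (t - s) < d -> Cmod (c t - c s) < eps.

Definition CInt (c : R -> C) (a b : R) : C := @RInt C_R_CompleteNormedModule c a b.

Lemma path_cont_continuous (c : R -> C) (s : R) :
  path_cont c s -> @continuous R_UniformSpace C_R_CompleteNormedModule c s.
Proof.
intros H P [eps HP].
destruct (H eps (cond_pos eps)) as (d & Hd & H').
exists (mkposreal d Hd); intros t Ht; apply HP.
apply ball_of_Cmod, H', Ht.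
Qed.

Lemma Cmult_close (u0 v0 : C) (eps : R) : 0 < eps -> exists e, 0 < e /\ forall u v,
  Cmod (u - u0) < e -> Cmod (v - v0) < e -> Cmod (u * v - u0 * v0) < eps.
Proof.
intros He.
set (K := 1 + Cmod u0 + Cmod v0).
assert (P1 := Cmod_ge_0 u0). assert (P2 := Cmod_ge_0 v0).
assert (HK : 1 <= K) by (unfold K; lra).
set (e := Rmin 1 (eps / (4 * K))).
assert (E1 : e <= 1) by apply Rmin_l.
assert (E2 : e <= eps / (4 * K)) by apply Rmin_r.
exists e; split; [apply Rmin_pos; [lra|apply Rdiv_lt_0_compat; lra]|].
intros u v H1 H2.
replace (u * v - u0 * v0)%C
  with ((u - u0) * v0 + u0 * (v - v0) + (u - u0) * (v - v0))%C by ring.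
eapply Rle_lt_trans; [apply Cmod_triangle|].
eapply Rle_lt_trans; [apply Rplus_le_compat_r, Cmod_triangle|].
rewrite !Cmod_mult.
assert (B : forall x y, 0 <= x <= e -> 0 <= y <= K -> x * y <= eps / 4).
{ intros x y ? ?; apply Rle_trans with (eps / (4 * K) * K).
  - apply Rmult_le_compat; lra.
  - right; field; lra. }
assert (Q1 := Cmod_ge_0 (u - u0)). assert (Q2 := Cmod_ge_0 (v - v0)).
assert (B1 := B (Cmod (u - u0)) (Cmod v0) ltac:(lra) ltac:(unfold K; lra)).
assert (B2 := B (Cmod (v - v0)) (Cmod u0) ltac:(lra) ltac:(unfold K; lra)).
assert (B3 := B (Cmod (u - u0)) (Cmod (v - v0)) ltac:(lra) ltac:(lra)).
rewrite (Rmult_comm (Cmod u0)). lra.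
Qed.

Lemma path_cont_mult (c d : R -> C) (s : R) :
  path_cont c s -> path_cont d s -> path_cont (fun t => c t * d t)%C s.
Proof.
intros Hc Hd eps He.
destruct (Cmult_close (c s) (d s) eps He) as (e & He0 & close).
destruct (Hc e He0) as (d1 & D1 & H1). destruct (Hd e He0) as (d2 & D2 & H2).
exists (Rmin d1 d2); split; [apply Rmin_pos; lra|]; intros t Ht.
apply close; [apply H1|apply H2]; apply Rlt_le_trans with (1 := Ht);
  [apply Rmin_l|apply Rmin_r].
Qed.

Lemma path_cont_plus (c d : R -> C) (s : R) :
  path_cont c s -> path_cont d s -> path_cont (fun t => c t + d t)%C s.
Proof.
intros Hc Hd eps He.
destruct (Hc (eps / 2) ltac:(lra)) as (d1 & D1 & H1).
destruct (Hd (eps / 2) ltac:(lra)) as (d2 & D2 & H2).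
exists (Rmin d1 d2); split; [apply Rmin_pos; lra|]; intros t Ht.
specialize (H1 t (Rlt_le_trans _ _ _ Ht (Rmin_l _ _))).
specialize (H2 t (Rlt_le_trans _ _ _ Ht (Rmin_r _ _))).
replace (c t + d t - (c s + d s))%C with ((c t - c s) + (d t - d s))%C by ring.
eapply Rle_lt_trans; [apply Cmod_triangle|]; lra.
Qed.

Lemma path_cont_opp (c : R -> C) (s : R) :
  path_cont c s -> path_cont (fun t => - c t)%C s.
Proof.
intros H eps He; destruct (H eps He) as (d & Hd & H'); exists d; split; [exact Hd|].
intros t Ht; specialize (H' t Ht); rewrite <- Cmod_opp in H'.
apply (Cmod_lt_eq _ _ _ H'); ring.
Qed.

Lemma path_cont_minus (c d : R -> C) (s : R) :
  path_cont c s -> path_cont d s -> path_cont (fun t => c t - d t)%C s.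
Proof. intros Hc Hd; apply path_cont_plus; [exact Hc|now apply path_cont_opp]. Qed.

Lemma path_cont_const (a : C) (s : R) : path_cont (fun _ => a) s.
Proof.
intros eps He; exists 1; split; [lra|]; intros.
replace (a - a)%C with (RtoC 0) by ring; rewrite Cmod_0; exact He.
Qed.

Lemma path_cont_comp (k : C -> C) (c : R -> C) (s : R) :
  path_cont c s -> ccont k (c s) -> path_cont (fun t => k (c t)) s.
Proof.
intros Hc Hk eps He.
destruct (Hk eps He) as (d1 & D1 & H1).
destruct (Hc d1 D1) as (d2 & D2 & H2).
exists d2; split; auto.
Qed.

Lemma path_deriv_cont (c : R -> C) (s : R) (l : C) :
  path_deriv c s l -> path_cont c s.
Proof.
intros H eps He; destruct (path_deriv_lipschitz _ _ _ H) as (d & Hd & H').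
assert (Hl := Cmod_ge_0 l).
assert (0 < eps / (1 + Cmod l)) by (apply Rdiv_lt_0_compat; lra).
exists (Rmin d (eps / (1 + Cmod l))); split; [apply Rmin_pos; lra|].
intros w Hw.
assert (W1 := Rlt_le_trans _ _ _ Hw (Rmin_l _ _)).
assert (W2 := Rlt_le_trans _ _ _ Hw (Rmin_r _ _)).
eapply Rle_lt_trans; [apply H', W1|].
apply Rlt_le_trans with ((1 + Cmod l) * (eps / (1 + Cmod l))).
- apply Rmult_lt_compat_l; lra.
- right; field; lra.
Qed.

Definition path_cont_on (c : R -> C) (a b : R) : Prop :=
  forall t, a <= t <= b -> path_cont c t.

Lemma path_cont_on_ex_RInt (c : R -> C) (a b : R) :
  a <= b -> path_cont_on c a b -> @ex_RInt C_R_CompleteNormedModule c a b.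
Proof.
intros Hab H; apply ex_RInt_continuous; intros t.
rewrite Rmin_left, Rmax_right by exact Hab; intros Ht.
apply path_cont_continuous, H, Ht.
Qed.

Lemma Cmod_CInt_le (c : R -> C) (a b M : R) :
  a <= b -> path_cont_on c a b -> (forall t, a <= t <= b -> Cmod (c t) <= M) ->
  Cmod (CInt c a b) <= (b - a) * M.
Proof.
intros Hab Hc HM; rewrite Cmod_norm.
apply (norm_RInt_le_const (V := C_R_NormedModule) c a b).
- exact Hab.
- intros t Ht; change (norm (c t)) with (@norm R_AbsRing C_R_NormedModule (c t)).
  rewrite <- Cmod_norm; auto.
- apply (RInt_correct (V := C_R_CompleteNormedModule)), path_cont_on_ex_RInt; auto.
Qed.

Lemma CInt_minus (c d : R -> C) (a b : R) :
  a <= b -> path_cont_on c a b -> path_cont_on d a b ->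
  CInt (fun t => c t - d t)%C a b = (CInt c a b - CInt d a b)%C.
Proof.
intros Hab Hc Hd.
apply (RInt_minus (V := C_R_CompleteNormedModule) c d); apply path_cont_on_ex_RInt; auto.
Qed.

Lemma CInt_mul (k : C) (c : R -> C) (a b : R) :
  a <= b -> path_cont_on c a b ->
  CInt (fun t => k * c t)%C a b = (k * CInt c a b)%C.
Proof.
intros Hab Hc.
assert (H := RInt_correct (V := C_R_CompleteNormedModule) _ _ _
  (path_cont_on_ex_RInt _ _ _ Hab Hc)).
set (I := CInt c a b) in *.
apply (is_RInt_unique (V := C_R_CompleteNormedModule)).
assert (H1 := is_RInt_fct_extend_fst (U := R_NormedModule) (V := R_NormedModule) _ _ _ _ H).
assert (H2 := is_RInt_fct_extend_snd (U := R_NormedModule) (V := R_NormedModule) _ _ _ _ H).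
apply (is_RInt_fct_extend_pair (U := R_NormedModule) (V := R_NormedModule)); simpl.
- exact (is_RInt_minus (V := R_NormedModule) _ _ _ _ _ _
    (is_RInt_scal (V := R_NormedModule) _ _ _ (fst k) _ H1)
    (is_RInt_scal (V := R_NormedModule) _ _ _ (snd k) _ H2)).
- exact (is_RInt_plus (V := R_NormedModule) _ _ _ _ _ _
    (is_RInt_scal (V := R_NormedModule) _ _ _ (fst k) _ H2)
    (is_RInt_scal (V := R_NormedModule) _ _ _ (snd k) _ H1)).
Qed.

Lemma CInt_deriv (c c' : R -> C) (a b : R) :
  a <= b -> (forall t, a <= t <= b -> path_deriv c t (c' t)) ->
  path_cont_on c' a b -> CInt c' a b = (c b - c a)%C.
Proof.
intros Hab Hc Hc'.
apply (is_RInt_unique (V := C_R_CompleteNormedModule)).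
apply (is_RInt_derive (V := C_R_CompleteNormedModule)); intros t;
  rewrite Rmin_left, Rmax_right by exact Hab; intros Ht.
- apply path_deriv_is_derive; auto.
- apply path_cont_continuous; auto.
Qed.

Lemma CInt_ext (c d : R -> C) (a b : R) :
  a <= b -> (forall t, a <= t <= b -> c t = d t) -> CInt c a b = CInt d a b.
Proof.
intros Hab H; apply (RInt_ext (V := C_R_CompleteNormedModule)); intros t.
rewrite Rmin_left, Rmax_right by exact Hab; intros; apply H; lra.
Qed.

Lemma CInt_Chasles (c : R -> C) (a b d : R) :
  a <= b <= d -> path_cont_on c a d ->
  CInt c a d = (CInt c a b + CInt c b d)%C.
Proof.
intros Hab Hc; symmetry.
apply (RInt_Chasles (V := C_R_CompleteNormedModule)); apply path_cont_on_ex_RInt; try lra;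
  intros t Ht; apply Hc; lra.
Qed.

(** * Cauchy's theorem for homotopies *)

(** The affine part of [k] at [w0] has the antiderivative [F], so along a curve it
integrates to a difference of end values; only the remainder, at most [m], is
left.  Around a closed contour the end values cancel. *)
Lemma edge_estimate (k : C -> C) (c c' : R -> C) (w0 l : C) (a b m L : R) :
  a <= b -> 0 <= m ->
  (forall t, a <= t <= b -> path_deriv c t (c' t)) ->
  path_cont_on c' a b -> path_cont_on (fun t => k (c t)) a b ->
  (forall t, a <= t <= b -> Cmod (c' t) <= L) ->
  (forall t, a <= t <= b -> Cmod (k (c t) - k w0 - l * (c t - w0)) <= m) ->
  let F := fun w => (k w0 * w + l * (w - w0) * (w - w0) / 2)%C in
  Cmod (CInt (fun t => k (c t) * c' t)%C a b - (F (c b) - F (c a))) <= (b - a) * (m * L).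
Proof.
intros Hab Hm Hc Hc' Hk HL Hr F.
assert (HF : forall w, has_cderiv F w (k w0 + l * (w - w0))%C).
{ intros w eps He.
  assert (Hl := Cmod_ge_0 l).
  exists (eps / (1 + Cmod l)); split; [apply Rdiv_lt_0_compat; lra|]; intros v Hv.
  replace (F v - F w - (k w0 + l * (w - w0)) * (v - w))%C
    with (l * (v - w) / 2 * (v - w))%C by (unfold F; field).
  rewrite Cmod_mult; apply Rmult_le_compat_r; [apply Cmod_ge_0|].
  rewrite Cmod_div by (intros E; apply (f_equal fst) in E; simpl in E; lra). rewrite Cmod_mult, Cmod_R.
  rewrite (Rabs_right 2) by lra.
  assert (T := Cmod_ge_0 (v - w)).
  assert (Cmod l * Cmod (v - w) <= (1 + Cmod l) * (eps / (1 + Cmod l))).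
  { apply Rmult_le_compat; lra. }
  replace ((1 + Cmod l) * (eps / (1 + Cmod l))) with eps in H by (field; lra).
  lra. }
assert (Fc : path_cont_on (fun t => (k w0 + l * (c t - w0)) * c' t)%C a b).
{ intros t Ht. apply path_cont_mult; [|apply Hc', Ht].
  apply path_cont_plus; [apply path_cont_const|].
  apply path_cont_mult; [apply path_cont_const|].
  apply path_cont_plus; [|apply path_cont_const].
  eapply path_deriv_cont, Hc, Ht. }
assert (Kc : path_cont_on (fun t => k (c t) * c' t)%C a b).
{ intros t Ht; apply path_cont_mult; auto. }
rewrite <- (CInt_deriv (fun t => F (c t)) (fun t => (k w0 + l * (c t - w0)) * c' t)%C a b);
  auto; [|intros t Ht; apply (path_deriv_comp F); auto].
rewrite <- CInt_minus; auto.
apply Cmod_CInt_le; [exact Hab| |].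
- intros t Ht; apply path_cont_minus; [apply Kc, Ht|apply Fc, Ht].
- intros t Ht.
  replace (k (c t) * c' t - (k w0 + l * (c t - w0)) * c' t)%C
    with ((k (c t) - k w0 - l * (c t - w0)) * c' t)%C by ring.
  rewrite Cmod_mult; apply Rmult_le_compat; auto; apply Cmod_ge_0.
Qed.

(** The mean value inequality, with [a] and [b] in either order. *)
Lemma path_lipschitz (c c' : R -> C) (a b L : R) :
  (forall t, Rmin a b <= t <= Rmax a b -> path_deriv c t (c' t)) ->
  path_cont_on c' (Rmin a b) (Rmax a b) ->
  (forall t, Rmin a b <= t <= Rmax a b -> Cmod (c' t) <= L) ->
  Cmod (c b - c a) <= L * Rabs (b - a).
Proof.
assert (main : forall a b, a <= b ->
  (forall t, a <= t <= b -> path_deriv c t (c' t)) ->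
  path_cont_on c' a b ->
  (forall t, a <= t <= b -> Cmod (c' t) <= L) ->
  Cmod (c b - c a) <= L * (b - a)).
{ intros u v Huv H1 H2 H3; rewrite <- (CInt_deriv c c') by auto.
  rewrite Rmult_comm; apply Cmod_CInt_le; auto. }
intros H1 H2 H3.
destruct (Rle_dec a b) as [Hab|Hab].
- rewrite Rmin_left, Rmax_right in * by exact Hab.
  rewrite Rabs_right by lra; auto.
- rewrite Rmin_right, Rmax_left in * by lra.
  rewrite Rabs_left1 by lra.
  replace (c b - c a)%C with (- (c a - c b))%C by ring; rewrite Cmod_opp.
  replace (- (b - a)) with (a - b) by ring; apply main; auto; lra.
Qed.

(** Cauchy's theorem for the form [k dw] pulled back by [Phi]: its integral around
the unit square is zero.  Goursat's argument works in the parameter domain.  On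
a square of side [h] containing [(a, b)], the affine part of [k] at [Phi a b]
contributes nothing, and the remainder is at most
[e |Phi - Phi a b| <= 2 e L h] along edges whose images have length at most
[L h].  So the integral around the square is [O(e h^2)], small against its area, and bisection
makes it smaller than any multiple of the area of the unit square. *)
Theorem homotopy_cauchy (k : C -> C) (Phi Phi1 Phi2 : R -> R -> C) (L : R) :
  (forall s t, 0 <= s <= 1 -> 0 <= t <= 1 ->
     path_deriv (fun s => Phi s t) s (Phi1 s t) /\
     path_deriv (fun t => Phi s t) t (Phi2 s t) /\
     path_cont (fun s => Phi1 s t) s /\ path_cont (fun t => Phi2 s t) t /\
     Cmod (Phi1 s t) <= L /\ Cmod (Phi2 s t) <= L /\
     exists l, has_cderiv k (Phi s t) l) ->
  (CInt (fun s => k (Phi s 0) * Phi1 s 0)%C 0 1 +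
   CInt (fun t => k (Phi 1 t) * Phi2 1 t)%C 0 1 =
   CInt (fun s => k (Phi s 1) * Phi1 s 1)%C 0 1 +
   CInt (fun t => k (Phi 0 t) * Phi2 0 t)%C 0 1)%C.
Proof.
intros hyp.
assert (L0 : 0 <= L).
{ destruct (hyp 0 0) as (_ & _ & _ & _ & H & _); try lra.
  eapply Rle_trans; [apply Cmod_ge_0|exact H]. }
set (Hz := fun y a b => CInt (fun s => k (Phi s y) * Phi1 s y)%C a b).
set (Ve := fun x a b => CInt (fun t => k (Phi x t) * Phi2 x t)%C a b).
set (J := fun x y h => (Hz y x (x + h)%R + Ve (x + h)%R y (y + h)%R
                        - Hz (y + h)%R x (x + h)%R - Ve x y (y + h)%R)%C).
assert (Hk : forall y a b, 0 <= y <= 1 -> 0 <= a -> b <= 1 ->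
  path_cont_on (fun s => k (Phi s y)) a b).
{ intros y a b Hy Ha Hb t Ht.
  destruct (hyp t y) as (D & _ & _ & _ & _ & _ & (l & Dk)); try lra.
  apply (path_cont_comp k (fun s => Phi s y)).
  - eapply path_deriv_cont, D.
  - eapply has_cderiv_cont, Dk. }
assert (Vk : forall x a b, 0 <= x <= 1 -> 0 <= a -> b <= 1 ->
  path_cont_on (fun t => k (Phi x t)) a b).
{ intros y a b Hy Ha Hb t Ht.
  destruct (hyp y t) as (_ & D & _ & _ & _ & _ & (l & Dk)); try lra.
  apply (path_cont_comp k).
  - eapply path_deriv_cont, D.
  - eapply has_cderiv_cont, Dk. }
assert (Hc : forall y a b, 0 <= y <= 1 -> 0 <= a -> b <= 1 ->
  path_cont_on (fun s => k (Phi s y) * Phi1 s y)%C a b).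
{ intros y a b Hy Ha Hb t Ht; apply path_cont_mult; [now apply (Hk y a b)|].
  apply (hyp t y); lra. }
assert (Vc : forall x a b, 0 <= x <= 1 -> 0 <= a -> b <= 1 ->
  path_cont_on (fun t => k (Phi x t) * Phi2 x t)%C a b).
{ intros y a b Hy Ha Hb t Ht; apply path_cont_mult; [now apply (Vk y a b)|].
  apply (hyp y t); lra. }
assert (small : forall eps, 0 < eps -> Cmod (J 0 0 1) <= eps * 1 * 1).
{ intros eps He.
  apply (square_induction (fun x y h => Cmod (J x y h) <= eps * h * h)); [lra| |].
  - intros x y h Hh X1 X2 Y1 Y2 B1 B2 B3 B4.
    replace (J x y (h + h)) with (J x y h + J (x + h)%R y h + J x (y + h)%R h
                                  + J (x + h)%R (y + h)%R h)%C.
    { eapply Rle_trans; [apply Cmod_triangle|].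
      eapply Rle_trans; [apply Rplus_le_compat_r, Cmod_triangle|].
      eapply Rle_trans; [apply Rplus_le_compat_r, Rplus_le_compat_r, Cmod_triangle|].
      nra. }
    assert (HC : forall z, 0 <= z <= 1 ->
      Hz z x (x + (h + h))%R = (Hz z x (x + h)%R + Hz z (x + h)%R (x + h + h)%R)%C).
    { intros z Hz'. replace (x + (h + h)) with (x + h + h) by ring.
      apply CInt_Chasles; [lra|]. apply Hc; lra. }
    assert (VC : forall z, 0 <= z <= 1 ->
      Ve z y (y + (h + h))%R = (Ve z y (y + h)%R + Ve z (y + h)%R (y + h + h)%R)%C).
    { intros z Hz'. replace (y + (h + h)) with (y + h + h) by ring.
      apply CInt_Chasles; [lra|]. apply Vc; lra. }
    unfold J; rewrite !HC, !VC by lra.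
    replace (x + (h + h)) with (x + h + h) by ring.
    replace (y + (h + h)) with (y + h + h) by ring. ring.
  - intros a b Ha Hb.
    destruct (hyp a b) as (_ & _ & _ & _ & _ & _ & (l & Dk)); try lra.
    (* Four edges with error [2 e L^2 h^2] each make [8 e L^2 h^2]; the summand
       [1] covers [L = 0]. *)
    set (e := eps / (8 * (L * L) + 1)).
    assert (E : 0 < e) by (apply Rdiv_lt_0_compat; nra).
    destruct (Dk e E) as (d & Hd & D).
    exists (d / (2 * L + 1)); split; [apply Rdiv_lt_0_compat; lra|].
    intros x y h Hh X1 X2 Y1 Y2 Hx Hy.
    assert (small : 2 * L * h < d).
    { apply Rle_lt_trans with ((2 * L + 1) * h); [nra|].
      apply Rlt_le_trans with ((2 * L + 1) * (d / (2 * L + 1))).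
      - apply Rmult_lt_compat_l; lra.
      - right; field; lra. }
    assert (near : forall s t, x <= s <= x + h -> y <= t <= y + h ->
      Cmod (Phi s t - Phi a b) <= 2 * L * h).
    { intros s t Hs Ht.
      replace (Phi s t - Phi a b)%C
        with ((Phi s t - Phi a t) + (Phi a t - Phi a b))%C by ring.
      eapply Rle_trans; [apply Cmod_triangle|].
      assert (N1 : Cmod (Phi s t - Phi a t) <= L * Rabs (s - a)).
      { apply (path_lipschitz (fun s => Phi s t) (fun s => Phi1 s t));
        [intros u Hu|intros u Hu|intros u Hu];
        (assert (0 <= u <= 1) by (revert Hu; unfold Rmin, Rmax;
            destruct (Rle_dec a s); lra)); apply (hyp u t); lra. }
      assert (N2 : Cmod (Phi a t - Phi a b) <= L * Rabs (t - b)).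
      { apply (path_lipschitz (Phi a) (Phi2 a));
        [intros u Hu|intros u Hu|intros u Hu];
        (assert (0 <= u <= 1) by (revert Hu; unfold Rmin, Rmax;
            destruct (Rle_dec b t); lra)); apply (hyp a u); lra. }
      assert (M1 : Rabs (s - a) <= h) by (apply Rabs_le; lra).
      assert (M2 : Rabs (t - b) <= h) by (apply Rabs_le; lra).
      apply (Rmult_le_compat_l L) in M1; [|exact L0].
      apply (Rmult_le_compat_l L) in M2; [|exact L0]. lra. }
    assert (near' : forall s t, x <= s <= x + h -> y <= t <= y + h ->
      Cmod (k (Phi s t) - k (Phi a b) - l * (Phi s t - Phi a b)) <= e * (2 * L * h)).
    { intros s t Hs Ht; specialize (near s t Hs Ht).
      eapply Rle_trans; [apply D; lra|]. apply Rmult_le_compat_l; lra. }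
    assert (m0 : 0 <= e * (2 * L * h)) by (apply Rmult_le_pos; [lra|nra]).
    set (F := fun w => (k (Phi a b) * w + l * (w - Phi a b) * (w - Phi a b) / 2)%C).
    assert (HE : forall z, y <= z <= y + h ->
      Cmod (Hz z x (x + h)%R - (F (Phi (x + h)%R z) - F (Phi x z))) <= h * (e * (2 * L * h) * L)).
    { intros z Hz'. replace h with (x + h - x) at 3 by ring.
      apply (edge_estimate k (fun s => Phi s z)); try lra.
      - intros t Ht; apply (hyp t z); lra.
      - intros t Ht; apply (hyp t z); lra.
      - apply Hk; lra.
      - intros t Ht; apply (hyp t z); lra.
      - intros t Ht; apply near'; lra. }
    assert (VE : forall z, x <= z <= x + h ->
      Cmod (Ve z y (y + h)%R - (F (Phi z (y + h)%R) - F (Phi z y))) <= h * (e * (2 * L * h) * L)).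
    { intros z Hz'. replace h with (y + h - y) at 3 by ring.
      apply (edge_estimate k (fun s => Phi z s)); try lra.
      - intros t Ht; apply (hyp z t); lra.
      - intros t Ht; apply (hyp z t); lra.
      - apply Vk; lra.
      - intros t Ht; apply (hyp z t); lra.
      - intros t Ht; apply near'; lra. }
    assert (E1 := HE y ltac:(lra)). assert (E2 := HE (y + h) ltac:(lra)).
    assert (E3 := VE x ltac:(lra)). assert (E4 := VE (x + h) ltac:(lra)).
    rewrite <- Cmod_opp in E2, E3.
    replace (J x y h) with
      ((Hz y x (x + h)%R - (F (Phi (x + h)%R y) - F (Phi x y)))
       + (- (Hz (y + h)%R x (x + h)%R - (F (Phi (x + h)%R (y + h)%R) - F (Phi x (y + h)%R))))
       + (- (Ve x y (y + h)%R - (F (Phi x (y + h)%R) - F (Phi x y))))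
       + (Ve (x + h)%R y (y + h)%R - (F (Phi (x + h)%R (y + h)%R) - F (Phi (x + h)%R y))))%C
      by (unfold J; ring).
    eapply Rle_trans; [apply Cmod_triangle|].
    eapply Rle_trans; [apply Rplus_le_compat_r, Cmod_triangle|].
    eapply Rle_trans; [apply Rplus_le_compat_r, Rplus_le_compat_r, Cmod_triangle|].
    apply Rle_trans with (4 * (h * (e * (2 * L * h) * L))); [lra|].
    replace (4 * (h * (e * (2 * L * h) * L))) with (e * (8 * (L * L)) * (h * h)) by ring.
    replace (eps * h * h) with (eps * (h * h)) by ring.
    apply Rmult_le_compat_r; [nra|].
    apply Rle_trans with (e * (8 * (L * L) + 1)); [nra|].
    right; unfold e; field; nra. }
assert (J0 : J 0 0 1 = 0%C).
{ apply Cmod_eq_0; apply Rle_antisym; [|apply Cmod_ge_0].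
  apply Rnot_lt_le; intros N. specialize (small (Cmod (J 0 0 1) / 2)). lra. }
unfold J in J0; rewrite !Rplus_0_l in J0.
fold (Hz 0 0 1) (Hz 1 0 1) (Ve 0 0 1) (Ve 1 0 1).
replace (Hz 0 0 1 + Ve 1 0 1)%C
  with ((Hz 0 0 1 + Ve 1 0 1 - Hz 1 0 1 - Ve 0 0 1) + (Hz 1 0 1 + Ve 0 0 1))%C by ring.
rewrite J0; ring.
Qed.

(** * Cauchy's integral formula *)

(** The parameter runs over the unit interval, to match [homotopy_cauchy]. *)
Definition circle (r t : R) : C :=
  (r * cos (2 * PI * t), r * sin (2 * PI * t)).

Lemma Cmod_circle (r t : R) : 0 <= r -> Cmod (circle r t) = r.
Proof.
intros Hr; unfold Cmod, circle; simpl.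
replace (_ + _) with (r * r * ((cos (2 * PI * t))² + (sin (2 * PI * t))²))
  by (unfold Rsqr; ring).
rewrite Rplus_comm, sin2_cos2, Rmult_1_r; apply sqrt_square, Hr.
Qed.

Lemma circle_periodic (r : R) : circle r 1 = circle r 0.
Proof.
unfold circle; rewrite Rmult_1_r, Rmult_0_r, cos_2PI, sin_2PI, cos_0, sin_0; reflexivity.
Qed.

Lemma is_derive_expansion (f : R -> R) (s l : R) :
  is_derive f s l -> forall eps, 0 < eps -> exists d, 0 < d /\ forall t,
  Rabs (t - s) < d -> Rabs (f t - f s - (t - s) * l) <= eps * Rabs (t - s).
Proof.
intros [_ H] eps He.
destruct (H s (fun P HP => HP) (mkposreal eps He)) as [d Hd].
exists d; split; [apply cond_pos|]; intros t Ht; exact (Hd t Ht).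
Qed.

Lemma Cmod_le_Re_Im (z : C) : Cmod z <= Rabs (Re z) + Rabs (Im z).
Proof.
destruct z as [x y]; unfold Re, Im; simpl.
replace (x, y) with (RtoC x + RtoC y * Ci)%C
  by (apply injective_projections; simpl; ring).
eapply Rle_trans; [apply Cmod_triangle|].
rewrite Cmod_mult, Cmod_Ci, !Cmod_R; lra.
Qed.

Lemma path_deriv_pair (f g : R -> R) (s a b : R) :
  is_derive f s a -> is_derive g s b -> path_deriv (fun t => (f t, g t)) s (a, b).
Proof.
intros Hf Hg eps He.
destruct (is_derive_expansion _ _ _ Hf (eps / 2) ltac:(lra)) as (d1 & D1 & H1).
destruct (is_derive_expansion _ _ _ Hg (eps / 2) ltac:(lra)) as (d2 & D2 & H2).
exists (Rmin d1 d2); split; [apply Rmin_pos; lra|]; intros t Ht.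
specialize (H1 t (Rlt_le_trans _ _ _ Ht (Rmin_l _ _))).
specialize (H2 t (Rlt_le_trans _ _ _ Ht (Rmin_r _ _))).
eapply Rle_trans; [apply Cmod_le_Re_Im|].
replace (Re _) with (f t - f s - (t - s) * a) by (unfold Re, RtoC; simpl; ring).
replace (Im _) with (g t - g s - (t - s) * b) by (unfold Im, RtoC; simpl; ring).
lra.
Qed.

Lemma circle_deriv (r t : R) :
  path_deriv (circle r) t (RtoC (2 * PI) * Ci * circle r t)%C.
Proof.
replace (RtoC (2 * PI) * Ci * circle r t)%C
  with (- (2 * PI * (r * sin (2 * PI * t))), 2 * PI * (r * cos (2 * PI * t)))
  by (apply injective_projections; simpl; ring).
apply path_deriv_pair; auto_derive; auto; ring.
Qed.

Lemma circle_cont (r t : R) : path_cont (circle r) t.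
Proof. eapply path_deriv_cont, circle_deriv. Qed.

Lemma path_deriv_affine (a b : C) (c : R -> C) (s : R) (l : C) :
  path_deriv c s l -> path_deriv (fun t => a + b * c t)%C s (b * l)%C.
Proof.
intros H; apply (path_deriv_mul _ _ _ b) in H.
intros eps He; destruct (H eps He) as (d & Hd & H'); exists d; split; [exact Hd|].
intros t Ht; specialize (H' t Ht).
apply (Cmod_le_eq _ _ _ H'); ring.
Qed.

Lemma path_deriv_id (s : R) : path_deriv RtoC s 1%C.
Proof.
intros eps He; exists 1; split; [lra|]; intros t _.
replace (RtoC t - RtoC s - RtoC (t - s) * 1)%C with (RtoC 0)
  by (rewrite RtoC_minus; ring).
rewrite Cmod_0; apply Rmult_le_pos; [lra|apply Rabs_pos].
Qed.

Lemma Cmod_triangle_rev (a b : C) : Cmod a - Cmod b <= Cmod (a - b).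
Proof.
assert (T := Cmod_triangle (a - b) b).
replace (a - b + b)%C with a in T by ring. lra.
Qed.

Lemma Cmod_Rmult (x : R) (z : C) : 0 <= x -> Cmod (RtoC x * z) = x * Cmod z.
Proof. intros; rewrite Cmod_mult, Cmod_R, Rabs_right; lra. Qed.

Lemma two_pi_i_neq_0 : (RtoC (2 * PI) * Ci)%C <> 0%C.
Proof.
intros H; apply (f_equal snd) in H; simpl in H.
assert (P := PI_RGT_0); lra.
Qed.

Lemma Cplus_Cmult_reg_l (w t a b : C) :
  t <> 0%C -> (w + t * a = w + t * b)%C -> a = b.
Proof.
intros Ht H.
replace a with ((w + t * a - w) / t)%C by (field; exact Ht).
rewrite H; field; exact Ht.
Qed.

(** The circle of radius [eps r] around [z] is moved to the circle of radius [r]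
around [0]; its centre goes straight from [z] to [0] while its radius grows
linearly.  It never meets [z] and stays in the disc, so the integrals of
[g w / (w - z)] over the two circles agree.  The small circle gives a mean value
of [g] near [z], which tends to [g z] with [eps]. *)
Theorem cauchy_formula (g : C -> C) (r : R) (z : C) :
  (forall w, Cmod w <= r -> exists l, has_cderiv g w l) -> Cmod z < r ->
  g z = CInt (fun t => g (circle r t) * circle r t / (circle r t - z))%C 0 1.
Proof.
intros Hg Hz.
assert (z0 := Cmod_ge_0 z).
assert (Hr : 0 < r) by lra.
set (e := circle r).
assert (Ne : forall t, Cmod (e t) = r) by (intros; apply Cmod_circle; lra).
assert (Ne0 : forall t, e t <> 0%C) by (intros; apply Cmod_gt_0; rewrite Ne; lra).
set (I := CInt _ 0 1).
assert (Gc : forall eps, 0 < eps -> eps * r <= r - Cmod z -> forall t,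
  path_cont (fun t => g (z + RtoC eps * e t)%C) t).
{ intros eps He He' t.
  destruct (Hg (z + RtoC eps * e t)%C) as [l Hl].
  { eapply Rle_trans; [apply Cmod_triangle|].
    rewrite Cmod_Rmult, Ne by lra; lra. }
  apply (path_cont_comp g); [|eapply has_cderiv_cont, Hl].
  eapply path_deriv_cont, path_deriv_affine, circle_deriv. }
assert (Ic : path_cont_on (fun t => g (e t) * e t / (e t - z))%C 0 1).
{ intros t _.
  assert (D : (e t - z)%C <> 0%C).
  { apply Cmod_gt_0; assert (T := Cmod_triangle_rev (e t) z); rewrite Ne in T; lra. }
  destruct (Hg (e t)) as [l Hl]; [rewrite Ne; lra|].
  unfold Cdiv; repeat apply path_cont_mult.
  - apply (path_cont_comp g); [apply circle_cont|eapply has_cderiv_cont, Hl].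
  - apply circle_cont.
  - apply (path_cont_comp Cinv (fun t => e t - z)%C).
    + apply path_cont_plus; [apply circle_cont|apply path_cont_const].
    + eapply has_cderiv_cont, has_cderiv_inv, D. }
(* The sides [t = 0] and [t = 1] of the homotopy coincide, and cancel. *)
assert (key : forall eps, 0 < eps < 1 -> eps * r <= r - Cmod z ->
  I = CInt (fun t => g (z + RtoC eps * e t)%C) 0 1).
{ intros eps He He'.
  set (k := fun w => (g w / (w - z))%C).
  set (rho := fun s => eps + (1 - eps) * s).
  set (Phi := fun s t => (RtoC (1 - s) * z + RtoC (rho s) * e t)%C).
  set (Phi1 := fun (s : R) t => (- z + RtoC (1 - eps) * e t)%C).
  set (Phi2 := fun s t => (RtoC (rho s) * (RtoC (2 * PI) * Ci * e t))%C).
  assert (PI0 := PI_RGT_0).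
  assert (H := homotopy_cauchy k Phi Phi1 Phi2 (2 * r + 2 * PI * r)).
  match type of H with ?A -> _ => assert (HA : A) end.
  { intros s t Hs Ht.
    assert (R0 : 0 <= rho s) by (unfold rho; nra).
    assert (R1 : rho s <= 1) by (unfold rho; nra).
    refine (conj _ (conj _ (conj _ (conj _ (conj _ (conj _ _)))))).
    - assert (P := path_deriv_affine (z + RtoC eps * e t) (Phi1 s t) RtoC s 1 (path_deriv_id s)).
      unfold Phi; intros x Hx; destruct (P x Hx) as (d & Hd & P'); exists d; split; [exact Hd|].
      intros u Hu; specialize (P' u Hu).
      apply (Cmod_le_eq _ _ _ P').
      unfold Phi1, rho; rewrite !RtoC_minus, !RtoC_plus, !RtoC_mult, !RtoC_minus; ring.
    - apply path_deriv_affine, circle_deriv.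
    - exact (path_cont_const (Phi1 s t) s).
    - unfold Phi2; repeat (apply path_cont_mult; [apply path_cont_const|]); apply circle_cont.
    - unfold Phi1; eapply Rle_trans; [apply Cmod_triangle|].
      rewrite Cmod_opp, Cmod_Rmult, Ne by lra. nra.
    - unfold Phi2; rewrite Cmod_Rmult, !Cmod_mult, Cmod_Ci, Cmod_R, Ne by lra.
      rewrite Rabs_right by lra.
      assert (0 < 2 * PI * r) by (apply Rmult_lt_0_compat; lra).
      assert (rho s * (2 * PI * r) <= 1 * (2 * PI * r)) by (apply Rmult_le_compat_r; lra).
      lra.
    - destruct (Hg (Phi s t)) as [l Hl].
      { unfold Phi; eapply Rle_trans; [apply Cmod_triangle|].
        rewrite !Cmod_Rmult, Ne by lra.
        assert (0 <= (1 - s) * (r - Cmod z - eps * r)) by (apply Rmult_le_pos; lra).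
        unfold rho; lra. }
      assert (D : (Phi s t - z)%C <> 0%C).
      { replace (Phi s t - z)%C with (RtoC (rho s) * e t - RtoC s * z)%C
          by (unfold Phi; rewrite RtoC_minus; ring).
        apply Cmod_gt_0; eapply Rlt_le_trans; [|apply Cmod_triangle_rev].
        rewrite !Cmod_Rmult, Ne by lra.
        assert (0 <= s * (r - Cmod z - eps * r)) by (apply Rmult_le_pos; lra).
        assert (0 < eps * r) by (apply Rmult_lt_0_compat; lra).
        unfold rho; lra. }
      eexists; unfold k, Cdiv; apply has_cderiv_mult; [exact Hl|].
      apply (has_cderiv_shift Cinv), has_cderiv_inv, D. }
  specialize (H HA).
  rewrite (CInt_ext (fun s => k (Phi s 1) * Phi1 s 1)%C (fun s => k (Phi s 0) * Phi1 s 0)%C 0 1) in H;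
    [|lra|intros t _; unfold Phi, Phi1, e; rewrite circle_periodic; reflexivity].
  set (W := CInt (fun s => k (Phi s 0) * Phi1 s 0)%C 0 1) in H.
  rewrite (CInt_ext (fun t => k (Phi 1 t) * Phi2 1 t)%C
    (fun t => RtoC (2 * PI) * Ci * (g (e t) * e t / (e t - z)))%C 0 1) in H; [|lra|].
  2: { intros t _; unfold k, Phi, Phi2, rho.
       replace (1 - 1) with 0 by ring. replace (eps + (1 - eps) * 1) with 1 by ring.
       replace (RtoC 0 * z + RtoC 1 * e t)%C with (e t) by ring.
       unfold Cdiv; ring. }
  rewrite (CInt_ext (fun t => k (Phi 0 t) * Phi2 0 t)%C
    (fun t => RtoC (2 * PI) * Ci * g (z + RtoC eps * e t))%C 0 1) in H; [|lra|].
  2: { intros t _; unfold k, Phi, Phi2, rho.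
       replace (1 - 0) with 1 by ring. replace (eps + (1 - eps) * 0) with eps by ring.
       replace (RtoC 1 * z + RtoC eps * e t)%C with (z + RtoC eps * e t)%C by ring.
       field.
       replace (z + RtoC eps * e t - z)%C with (RtoC eps * e t)%C by ring.
       apply Cmult_neq_0; [|apply Ne0].
       intros E; apply (f_equal fst) in E; simpl in E; lra. }
  rewrite !CInt_mul in H by (first [lra | exact Ic | intros t _; apply Gc; lra]).
  fold I in H.
  set (I2 := CInt (fun t => g (z + RtoC eps * e t)%C) 0 1) in *.
  exact (Cplus_Cmult_reg_l W _ I I2 two_pi_i_neq_0 H). }
assert (close : forall eta, 0 < eta -> Cmod (g z - I) <= eta).
{ intros eta Heta.
  destruct (Hg z) as [l Hl]; [lra|].
  destruct (has_cderiv_cont _ _ _ Hl eta Heta) as (d & Hd & C1).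
  set (eps := Rmin (1 / 2) (Rmin (d / 2 / r) ((r - Cmod z) / r))).
  assert (E0 : 0 < eps).
  { repeat apply Rmin_pos; try lra; repeat apply Rdiv_lt_0_compat; lra. }
  assert (E1 : eps <= 1 / 2) by apply Rmin_l.
  assert (E2 : eps * r <= d / 2).
  { apply Rle_trans with (d / 2 / r * r); [|right; field; lra].
    apply Rmult_le_compat_r; [lra|].
    eapply Rle_trans; [apply Rmin_r|apply Rmin_l]. }
  assert (E3 : eps * r <= r - Cmod z).
  { apply Rle_trans with ((r - Cmod z) / r * r); [|right; field; lra].
    apply Rmult_le_compat_r; [lra|].
    eapply Rle_trans; [apply Rmin_r|apply Rmin_r]. }
  rewrite (key eps) by lra.
  assert (Cst : CInt (fun _ => g z) 0 1 = g z).
  { rewrite (CInt_deriv (fun t => 0 + g z * RtoC t)%C (fun _ => g z)); [ring|lra| |].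
    - intros t _. assert (P := path_deriv_affine 0 (g z) RtoC t 1 (path_deriv_id t)).
      rewrite Cmult_1_r in P; exact P.
    - intros t _; apply path_cont_const. }
  rewrite <- Cst at 1.
  rewrite <- CInt_minus; [|lra|intros t _; apply path_cont_const|intros t _; apply Gc; lra].
  replace eta with ((1 - 0) * eta) by ring.
  apply Cmod_CInt_le; [lra| |].
  - intros t _; apply path_cont_minus; [apply path_cont_const|now apply Gc].
  - intros t _. left.
    replace (g z - g (z + RtoC eps * e t))%C with (- (g (z + RtoC eps * e t) - g z))%C by ring.
    rewrite Cmod_opp; apply C1.
    replace (z + RtoC eps * e t - z)%C with (RtoC eps * e t)%C by ring.
    rewrite Cmod_Rmult, Ne by lra. lra. }
assert (Z : (g z - I)%C = 0%C).
{ apply Cmod_eq_0; apply Rle_antisym; [|apply Cmod_ge_0].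
  apply Rnot_lt_le; intros N. specialize (close (Cmod (g z - I) / 2)). lra. }
replace (g z) with (g z - I + I)%C by ring. rewrite Z; ring.
Qed.

(** * Local structure of holomorphic functions *)

(** A bound on the second derivative replaces its continuity: it suffices for the
Hessian and for the remainders of order two. *)
Definition twice_cderiv (h h1 h2 : C -> C) (z : C) (rho M : R) : Prop :=
  forall w, Cmod (w - z) < rho ->
    has_cderiv h w (h1 w) /\ has_cderiv h1 w (h2 w) /\ Cmod (h2 w) <= M.

(** The quadratic remainder is uniform in [t], so it survives the integration. *)
Lemma CInt_param_cderiv (N N' : R -> C -> C) (z : C) (d K : R) :
  0 < d ->
  (forall w, Cmod (w - z) < d -> path_cont_on (fun t => N t w) 0 1) ->
  path_cont_on (fun t => N' t z) 0 1 ->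
  (forall w t, Cmod (w - z) < d -> 0 <= t <= 1 ->
     Cmod (N t w - N t z - N' t z * (w - z)) <= K * Cmod (w - z) * Cmod (w - z)) ->
  has_cderiv (fun w => CInt (fun t => N t w) 0 1) z (CInt (fun t => N' t z) 0 1).
Proof.
intros Hd HN HN' HK eps He.
assert (Hz : Cmod (z - z) < d).
{ replace (z - z)%C with (RtoC 0) by ring; rewrite Cmod_0; exact Hd. }
assert (K0 := Rle_abs K). assert (K1 := Rabs_pos K).
assert (P : 0 < eps / (1 + Rabs K)) by (apply Rdiv_lt_0_compat; lra).
exists (Rmin d (eps / (1 + Rabs K))); split; [apply Rmin_pos; lra|].
intros w Hw.
assert (W1 := Rlt_le_trans _ _ _ Hw (Rmin_l _ _)).
assert (W2 := Rlt_le_trans _ _ _ Hw (Rmin_r _ _)).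
assert (Hw' := HN w W1). assert (Hz' := HN z Hz).
assert (HM : path_cont_on (fun t => (w - z) * N' t z)%C 0 1).
{ intros t Ht; apply path_cont_mult; [apply path_cont_const|now apply HN']. }
assert (HD : path_cont_on (fun t => N t w - N t z)%C 0 1).
{ intros t Ht; apply path_cont_minus; [now apply Hw'|now apply Hz']. }
rewrite (Cmult_comm (CInt _ _ _)), <- CInt_mul, <- !CInt_minus by (assumption || lra).
replace (eps * Cmod (w - z)) with ((1 - 0) * (eps * Cmod (w - z))) by ring.
apply Cmod_CInt_le; [lra| |].
- intros t Ht; apply path_cont_minus; [now apply HD|now apply HM].
- intros t Ht; specialize (HK w t W1 Ht).
  rewrite (Cmult_comm (w - z)); eapply Rle_trans; [exact HK|].
  assert (T := Cmod_ge_0 (w - z)).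
  apply Rmult_le_compat_r; [exact T|].
  apply Rle_trans with ((1 + Rabs K) * (eps / (1 + Rabs K))); [|right; field; lra].
  apply Rle_trans with (Rabs K * Cmod (w - z)); [apply Rmult_le_compat_r; lra|].
  apply Rmult_le_compat; lra.
Qed.

Section CauchyIntegral.

Variables (r M : R) (phi : R -> C).
Hypothesis (r_pos : 0 < r) (phi_cont : path_cont_on phi 0 1).
Hypothesis (phi_le : forall t, 0 <= t <= 1 -> Cmod (phi t) <= M).

Let q (z : C) (t : R) : C := (/ (circle r t - z))%C.

Lemma circle_minus_neq_0 (z : C) (t : R) : Cmod z < r -> (circle r t - z)%C <> 0%C.
Proof.
intros Hz; apply Cmod_gt_0.
assert (T := Cmod_triangle_rev (circle r t) z).
rewrite Cmod_circle in T; lra.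
Qed.

Lemma cauchy_kernel_le (z : C) (t : R) : Cmod z < r / 2 -> Cmod (q z t) <= 2 / r.
Proof.
intros Hz; unfold q; rewrite Cmod_inv by (apply circle_minus_neq_0; lra).
replace (2 / r) with (/ (r / 2)) by (field; lra).
apply Rinv_le_contravar; [lra|].
assert (T := Cmod_triangle_rev (circle r t) z).
rewrite Cmod_circle in T; lra.
Qed.

Lemma cauchy_kernel_cont (z : C) (t : R) : Cmod z < r -> path_cont (q z) t.
Proof.
intros Hz; apply (path_cont_comp Cinv (fun t => circle r t - z)%C).
- apply path_cont_plus; [apply circle_cont|apply path_cont_const].
- eapply has_cderiv_cont, has_cderiv_inv, circle_minus_neq_0, Hz.
Qed.

(** For [phi t = g (circle r t) * circle r t] this is [g]; the later
coefficients of the expansion at [0] come from dividing [phi] by [circle r]. *)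
Definition cauchy_integral (z : C) : C :=
  CInt (fun t => phi t / (circle r t - z))%C 0 1.

Lemma cauchy_integral_le (z : C) : Cmod z < r / 2 ->
  Cmod (cauchy_integral z) <= M * (2 / r).
Proof.
intros Hz. replace (M * (2 / r)) with ((1 - 0) * (M * (2 / r))) by ring.
apply Cmod_CInt_le; [lra| |].
- intros t Ht; apply path_cont_mult; [now apply phi_cont|apply cauchy_kernel_cont; lra].
- intros t Ht; unfold Cdiv; rewrite Cmod_mult.
  apply Rmult_le_compat; try apply Cmod_ge_0; [now apply phi_le|now apply cauchy_kernel_le].
Qed.

(** With [a] and [b] the values of the kernel at [w] and [z], [a - b = (w - z) a b];
this turns the Taylor remainders of [a] and of [a^2] into multiples of
[(w - z)^2]. *)
Lemma cauchy_integral_twice_cderiv :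
  exists h1 h2 M', twice_cderiv cauchy_integral h1 h2 0%C (r / 2) M'.
Proof.
assert (M0 : 0 <= M).
{ eapply Rle_trans; [apply Cmod_ge_0|apply (phi_le 0); lra]. }
set (Q := 2 / r). assert (Q0 : 0 < Q) by (apply Rdiv_lt_0_compat; lra).
exists (fun z => CInt (fun t => phi t * (q z t * q z t))%C 0 1).
exists (fun z => CInt (fun t => phi t * (2 * (q z t * q z t * q z t)))%C 0 1).
exists (M * (2 * (Q * Q * Q))).
intros z Hz.
replace (z - 0)%C with z in Hz by ring.
assert (near : forall w, Cmod (w - z) < r / 2 - Cmod z -> Cmod w < r / 2).
{ intros w Hw. assert (T := Cmod_triangle_rev w z). lra. }
assert (diff : forall w t, Cmod w < r / 2 -> (q w t - q z t = (w - z) * q w t * q z t)%C).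
{ intros w t Hw; unfold q; field; split; apply circle_minus_neq_0; lra. }
assert (z0 := Cmod_ge_0 z).
split; [|split].
- apply (CInt_param_cderiv (fun t w => phi t / (circle r t - w))%C
    (fun t z => phi t * (q z t * q z t))%C z (r / 2 - Cmod z) (M * (Q * Q * Q))); [lra|..].
  + intros w Hw t Ht; specialize (near w Hw).
    apply path_cont_mult; [now apply phi_cont|apply cauchy_kernel_cont; lra].
  + intros t Ht. repeat first [apply phi_cont, Ht | apply cauchy_kernel_cont; lra
      | apply path_cont_const | apply path_cont_mult].
  + intros w t Hw Ht. specialize (near w Hw).
    change (phi t / (circle r t - w))%C with (phi t * q w t)%C.
    change (phi t / (circle r t - z))%C with (phi t * q z t)%C.
    replace (phi t * q w t - phi t * q z t - phi t * (q z t * q z t) * (w - z))%C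
      with (phi t * ((q w t - q z t) * q z t * (w - z)))%C.
    2: { transitivity (phi t * ((q w t - q z t) - (w - z) * q z t * q z t))%C; [|ring].
         rewrite (diff w t near).
         replace ((w - z) * q w t * q z t - (w - z) * q z t * q z t)%C
           with ((q w t - q z t) * q z t * (w - z))%C by ring.
         rewrite (diff w t near); ring. }
    rewrite (diff w t near), !Cmod_mult.
    assert (A1 := cauchy_kernel_le w t near). assert (A2 := cauchy_kernel_le z t Hz). fold Q in A1, A2.
    assert (P1 := Cmod_ge_0 (q w t)). assert (P2 := Cmod_ge_0 (q z t)).
    assert (P3 := Cmod_ge_0 (w - z)). assert (P4 := phi_le t Ht).
    replace (Cmod (phi t) * (Cmod (w - z) * Cmod (q w t) * Cmod (q z t) * Cmod (q z t) * Cmod (w - z)))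
      with (Cmod (phi t) * (Cmod (q w t) * Cmod (q z t) * Cmod (q z t)) * Cmod (w - z) * Cmod (w - z)) by ring.
    repeat (apply Rmult_le_compat_r; [exact P3|]).
    repeat (apply Rmult_le_compat; try apply Cmod_ge_0; try assumption);
      repeat (apply Rmult_le_pos; try assumption).
- apply (CInt_param_cderiv (fun t w => phi t * (q w t * q w t))%C
    (fun t z => phi t * (2 * (q z t * q z t * q z t)))%C z (r / 2 - Cmod z)
    (M * (3 * (Q * Q * Q * Q)))); [lra|..].
  + intros w Hw t Ht; specialize (near w Hw).
    repeat first [apply phi_cont, Ht | apply cauchy_kernel_cont; lra
      | apply path_cont_const | apply path_cont_mult].
  + intros t Ht. repeat first [apply phi_cont, Ht | apply cauchy_kernel_cont; lra
      | apply path_cont_const | apply path_cont_mult].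
  + intros w t Hw Ht. specialize (near w Hw).
    assert (E : (phi t * (q w t * q w t) - phi t * (q z t * q z t)
      - phi t * (2 * (q z t * q z t * q z t)) * (w - z)
      = phi t * (q w t * q z t * q z t * (q w t + 2 * q z t)) * (w - z) * (w - z))%C).
    { transitivity (phi t * ((q w t - q z t) * (q w t + q z t)
        - 2 * (q z t * q z t * q z t) * (w - z)))%C; [ring|].
      rewrite (diff w t near).
      transitivity (phi t * (w - z) * q z t * ((q w t - q z t) * (q w t + 2 * q z t)))%C; [ring|].
      rewrite (diff w t near); ring. }
    rewrite E, !Cmod_mult.
    assert (A1 := cauchy_kernel_le w t near). assert (A2 := cauchy_kernel_le z t Hz). fold Q in A1, A2.
    assert (P1 := Cmod_ge_0 (q w t)). assert (P2 := Cmod_ge_0 (q z t)).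
    assert (P3 := Cmod_ge_0 (w - z)). assert (P4 := phi_le t Ht).
    assert (A3 : Cmod (q w t + 2 * q z t) <= 3 * Q).
    { eapply Rle_trans; [apply Cmod_triangle|].
      rewrite Cmod_mult, Cmod_R, Rabs_right by lra. lra. }
    repeat (apply Rmult_le_compat_r; [exact P3|]).
    apply Rmult_le_compat; try assumption; [apply Cmod_ge_0| |].
    * repeat (apply Rmult_le_pos; try assumption); apply Cmod_ge_0.
    * replace (3 * (Q * Q * Q * Q)) with (Q * Q * Q * (3 * Q)) by ring.
      repeat (apply Rmult_le_compat; try apply Cmod_ge_0; try assumption);
      repeat (apply Rmult_le_pos; try assumption).
- replace (M * (2 * (Q * Q * Q))) with ((1 - 0) * (M * (2 * (Q * Q * Q)))) by ring.
  apply Cmod_CInt_le; [lra| |].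
  + intros t Ht. repeat first [apply phi_cont, Ht | apply cauchy_kernel_cont; lra
      | apply path_cont_const | apply path_cont_mult].
  + intros t Ht. rewrite !Cmod_mult, Cmod_R, Rabs_right by lra.
    assert (A2 := cauchy_kernel_le z t Hz). fold Q in A2.
    assert (P2 := Cmod_ge_0 (q z t)).
    assert (P4 := phi_le t Ht).
    apply Rmult_le_compat; try assumption; [apply Cmod_ge_0| |].
    * repeat (apply Rmult_le_pos; try assumption); lra.
    * apply Rmult_le_compat_l; [lra|].
      repeat (apply Rmult_le_compat; try apply Cmod_ge_0; try assumption);
      repeat (apply Rmult_le_pos; try assumption).
Qed.

(** Comes from [1 / (e - z) = 1 / e + z / (e (e - z))].  The remaining integral is again
of Cauchy type, so the expansion can be iterated. *)
Lemma cauchy_integral_expand (z : C) : Cmod z < r ->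
  (cauchy_integral z = cauchy_integral 0
     + z * CInt (fun t => phi t * / circle r t / (circle r t - z)) 0 1)%C.
Proof.
intros Hz.
assert (N0 : forall t, circle r t <> 0%C).
{ intros t; apply Cmod_gt_0; rewrite Cmod_circle; lra. }
assert (C0 : Cmod 0 < r) by (rewrite Cmod_0; lra).
rewrite <- CInt_mul; [|lra|].
2: { intros t Ht; unfold Cdiv; repeat apply path_cont_mult.
     - now apply phi_cont.
     - apply (path_cont_comp Cinv); [apply circle_cont|eapply has_cderiv_cont, has_cderiv_inv, N0].
     - apply cauchy_kernel_cont, Hz. }
rewrite (CInt_ext _ (fun t => phi t / (circle r t - z) - phi t / (circle r t - 0))%C); [|lra|].
2: { intros t _. assert (Nz := circle_minus_neq_0 z t Hz).
     assert (N1 := circle_minus_neq_0 0 t C0). field; auto. }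
rewrite CInt_minus; [|lra|..].
- unfold cauchy_integral; ring.
- intros t Ht; apply path_cont_mult; [now apply phi_cont|apply cauchy_kernel_cont, Hz].
- intros t Ht; apply path_cont_mult; [now apply phi_cont|apply cauchy_kernel_cont, C0].
Qed.

End CauchyIntegral.

Lemma path_cont_on_bounded (c : R -> C) (a b : R) : a <= b ->
  path_cont_on c a b -> exists M, forall t, a <= t <= b -> Cmod (c t) <= M.
Proof.
intros Hab Hc.
destruct (continuity_ab_maj (fun t => Cmod (c t)) a b Hab) as (m & Hm & _).
{ intros t Ht eps He. destruct (Hc t Ht eps He) as (d & Hd & H).
  exists d; split; [exact Hd|]; intros s [_ Hs]; simpl in *; unfold R_dist in *.
  specialize (H s Hs). apply Rle_lt_trans with (2 := H).
  assert (T1 := Cmod_triangle_rev (c s) (c t)).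
  assert (T2 := Cmod_triangle_rev (c t) (c s)).
  replace (c t - c s)%C with (- (c s - c t))%C in T2 by ring; rewrite Cmod_opp in T2.
  apply Rabs_le; lra. }
exists (Cmod (c m)); exact Hm.
Qed.

(** Iterating [cauchy_integral_expand] gives [g w = g 0 + w^(m+1) R_(m+1)(w)] for as
long as the coefficients [R_1(0), ..., R_m(0)] vanish.  If one is nonzero, the
first such gives the order.  If none is, [|R_m| <= C / r^m] forces [g w = g 0] on
the disc of radius [r / 2]. *)
Theorem holomorphic_local_form (g : C -> C) (r : R) : 0 < r ->
  (forall w, Cmod w <= r -> exists l, has_cderiv g w l) ->
  (exists g1 g2 M, twice_cderiv g g1 g2 0%C (r / 2) M) /\
  ((forall w, Cmod w < r / 2 -> g w = g 0%C) \/
   exists n h h1 h2 M, twice_cderiv h h1 h2 0%C (r / 2) M /\ h 0%C <> 0%C /\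
     forall w, Cmod w < r / 2 -> (g w = g 0 + Cpow w (S n) * h w)%C).
Proof.
intros Hr Hg.
set (e := circle r).
assert (N0 : forall t, e t <> 0%C).
{ intros t; apply Cmod_gt_0; unfold e; rewrite Cmod_circle; lra. }
set (phi := fun n t => (g (e t) * e t * Cpow (/ e t) n)%C).
assert (ec : forall t, path_cont (fun t => / e t)%C t).
{ intros t; apply (path_cont_comp Cinv); [apply circle_cont|].
  eapply has_cderiv_cont, has_cderiv_inv, N0. }
assert (phic : forall n, path_cont_on (phi n) 0 1).
{ intros n t Ht; induction n as [|n IH].
  - unfold phi; simpl. apply path_cont_mult; [|apply path_cont_const].
    apply path_cont_mult; [|apply circle_cont].
    destruct (Hg (e t)) as [l Hl]; [unfold e; rewrite Cmod_circle; lra|].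
    apply (path_cont_comp g); [apply circle_cont|eapply has_cderiv_cont, Hl].
  - assert (E : path_cont (fun t => phi n t * / e t)%C t) by (apply path_cont_mult; auto).
    intros eps He; destruct (E eps He) as (d & Hd & E'); exists d; split; [exact Hd|].
    intros s Hs; apply (Cmod_lt_eq _ _ _ (E' s Hs)); unfold phi; simpl; ring. }
destruct (path_cont_on_bounded (phi O) 0 1) as [M HM]; [lra|apply phic|].
assert (HMn : forall n t, 0 <= t <= 1 -> Cmod (phi n t) <= M * / r ^ n).
{ intros n t Ht; induction n as [|n IH].
  - simpl; rewrite Rinv_1, Rmult_1_r; auto.
  - replace (phi (S n) t) with (phi n t * / e t)%C by (unfold phi; simpl; ring).
    rewrite Cmod_mult, Cmod_inv by apply N0.
    replace (Cmod (e t)) with r by (unfold e; rewrite Cmod_circle; lra).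
    assert (0 < r ^ n) by (apply pow_lt; lra).
    replace (M * / r ^ S n) with (M * / r ^ n * / r) by (simpl; field; lra).
    apply Rmult_le_compat_r; [left; apply Rinv_0_lt_compat; lra|exact IH]. }
set (Rn := fun n => cauchy_integral r (phi n)).
assert (R0 : forall w, Cmod w < r -> g w = Rn O w).
{ intros w Hw; rewrite (cauchy_formula g r w Hg Hw); apply CInt_ext; [lra|].
  intros t _; unfold phi; simpl; unfold Cdiv; rewrite Cmult_1_r; reflexivity. }
assert (RS : forall n w, Cmod w < r -> (Rn n w = Rn n 0%C + w * Rn (S n) w)%C).
{ intros n w Hw; unfold Rn; rewrite (cauchy_integral_expand r (phi n)); auto.
  f_equal; f_equal; apply CInt_ext; [lra|]; intros t _.
  unfold phi; simpl; unfold e, Cdiv; ring. }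
assert (RD : forall n, exists h1 h2 M', twice_cderiv (Rn n) h1 h2 0%C (r / 2) M').
{ intros n; exact (cauchy_integral_twice_cderiv r (M * / r ^ n) (phi n) Hr (phic n) (HMn n)). }
assert (C0 : Cmod 0 < r) by (rewrite Cmod_0; lra).
split.
- destruct (RD O) as (h1 & h2 & M' & H); exists h1, h2, M'.
  intros w Hw; destruct (H w Hw) as (H1 & H2); split; [|exact H2].
  eapply has_cderiv_ext_loc; [|exact H1].
  exists (r / 2); split; [lra|]; intros v Hv; symmetry; apply R0.
  replace (w - 0)%C with w in Hw by ring.
  assert (T := Cmod_triangle_rev v w). lra.
- destruct (excluded_middle_informative (exists n, Rn (S n) 0%C <> 0%C)) as [Y|N].
  + destruct (dec_inh_nat_subset_has_unique_least_element
      (fun n => Rn (S n) 0%C <> 0%C)) as (n & (Hn & Hmin) & _); auto.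
    { intros n; destruct (excluded_middle_informative (Rn (S n) 0%C <> 0%C)); tauto. }
    right; destruct (RD (S n)) as (h1 & h2 & M' & H).
    exists n, (Rn (S n)), h1, h2, M'; split; [exact H|split; [exact Hn|]].
    assert (G : forall m, (m <= n)%nat -> forall w, Cmod w < r ->
      g w = (g 0%C + Cpow w (S m) * Rn (S m) w)%C).
    { induction m as [|m IH]; intros Hm w Hw.
      - rewrite (R0 w Hw), (R0 0%C C0), (RS O w Hw); simpl; ring.
      - rewrite (IH ltac:(lia) w Hw), (RS (S m) w Hw).
        replace (Rn (S m) 0%C) with (RtoC 0); [simpl; ring|].
        destruct (excluded_middle_informative (Rn (S m) 0%C <> 0%C)) as [A|A].
        + specialize (Hmin m A); lia.
        + symmetry; apply Classical_Prop.NNPP, A. }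
    intros w Hw; apply G; [lia|lra].
  + left; intros w Hw.
    assert (G : forall m, g w = (g 0%C + Cpow w (S m) * Rn (S m) w)%C).
    { induction m as [|m IH].
      - rewrite (R0 w ltac:(lra)), (R0 0%C C0), (RS O w ltac:(lra)); simpl; ring.
      - rewrite IH at 1; rewrite (RS (S m) w ltac:(lra)).
        replace (Rn (S m) 0%C) with (RtoC 0); [simpl; ring|].
        symmetry; apply Classical_Prop.NNPP; intros A; apply N; exists m; exact A. }
    assert (B : forall m, Cmod (g w - g 0%C) <= M * (2 / r) * (/ 2) ^ S m).
    { intros m; rewrite (G m) at 1.
      replace (g 0%C + Cpow w (S m) * Rn (S m) w - g 0%C)%C
        with (Cpow w (S m) * Rn (S m) w)%C by ring.
      rewrite Cmod_mult, Cmod_pow.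
      assert (L := cauchy_integral_le r _ (phi (S m)) Hr (phic (S m)) (HMn (S m)) w Hw).
      fold (Rn (S m)) in L.
      assert (P : 0 < r ^ S m) by (apply pow_lt; lra).
      apply Rle_trans with ((r / 2) ^ S m * (M * / r ^ S m * (2 / r))).
      - apply Rmult_le_compat; try apply Cmod_ge_0; [apply pow_le, Cmod_ge_0| |exact L].
        apply pow_incr; split; [apply Cmod_ge_0|lra].
      - right; unfold Rdiv at 1; rewrite Rpow_mult_distr; field; split; lra. }
    assert (Z : Cmod (g w - g 0%C) <= 0).
    { apply (is_lim_seq_le (fun _ => Cmod (g w - g 0%C))
        (fun m => M * (2 / r) * (/ 2) ^ S m) (Cmod (g w - g 0%C)) 0 B).
      - apply is_lim_seq_const.
      - evar_last. apply (is_lim_seq_scal_l _ (M * (2 / r)) 0).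
        apply (is_lim_seq_incr_1 (fun m => (/ 2) ^ m)), is_lim_seq_geom.
        rewrite Rabs_right; lra.
        simpl; f_equal; ring. }
    assert (Z' : (g w - g 0%C)%C = 0%C).
    { apply Cmod_eq_0, Rle_antisym; [exact Z|apply Cmod_ge_0]. }
    replace (g w) with (g w - g 0%C + g 0%C)%C by ring; rewrite Z'; ring.
Qed.

(** * The Hessian near a critical point *)

Lemma has_cderiv_unique (f : C -> C) (z a b : C) :
  has_cderiv f z a -> has_cderiv f z b -> a = b.
Proof.
intros Ha Hb.
assert (Z : Cmod (a - b) <= 0).
{ apply Rnot_lt_le; intros N.
  destruct (Ha (Cmod (a - b) / 4) ltac:(lra)) as (d1 & D1 & H1).
  destruct (Hb (Cmod (a - b) / 4) ltac:(lra)) as (d2 & D2 & H2).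
  set (d := Rmin d1 d2 / 2).
  assert (Dm : 0 < Rmin d1 d2) by (apply Rmin_pos; lra).
  assert (M1 := Rmin_l d1 d2). assert (M2 := Rmin_r d1 d2).
  set (w := (z + RtoC d)%C).
  assert (W : Cmod (w - z) = d).
  { replace (w - z)%C with (RtoC d) by (unfold w; ring).
    rewrite Cmod_R, Rabs_right; unfold d; lra. }
  specialize (H1 w). specialize (H2 w). rewrite W in H1, H2.
  specialize (H1 ltac:(unfold d; lra)). specialize (H2 ltac:(unfold d; lra)).
  assert (E : Cmod ((a - b) * (w - z)) <= Cmod (a - b) / 4 * d + Cmod (a - b) / 4 * d).
  { replace ((a - b) * (w - z))%C with
      ((f w - f z - b * (w - z)) + - (f w - f z - a * (w - z)))%C by ring.
    eapply Rle_trans; [apply Cmod_triangle|]; rewrite Cmod_opp; lra. }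
  rewrite Cmod_mult, W in E.
  assert (0 < d) by (unfold d; lra). nra. }
replace a with ((a - b) + b)%C by ring.
replace (a - b)%C with (RtoC 0); [ring|].
symmetry; apply Cmod_eq_0, Rle_antisym; [exact Z|apply Cmod_ge_0].
Qed.

Lemma ccont_plus (f g : C -> C) (z : C) :
  ccont f z -> ccont g z -> ccont (fun w => f w + g w)%C z.
Proof.
intros Hf Hg eps He.
destruct (Hf (eps / 2) ltac:(lra)) as (d1 & D1 & H1).
destruct (Hg (eps / 2) ltac:(lra)) as (d2 & D2 & H2).
exists (Rmin d1 d2); split; [apply Rmin_pos; lra|]; intros w Hw.
specialize (H1 w (Rlt_le_trans _ _ _ Hw (Rmin_l _ _))).
specialize (H2 w (Rlt_le_trans _ _ _ Hw (Rmin_r _ _))).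
replace (f w + g w - (f z + g z))%C with ((f w - f z) + (g w - g z))%C by ring.
eapply Rle_lt_trans; [apply Cmod_triangle|]; lra.
Qed.

Lemma ccont_id_mult_bounded (f : C -> C) (rho M : R) :
  0 < rho -> (forall w, Cmod w < rho -> Cmod (f w) <= M) ->
  ccont (fun w => w * f w)%C 0%C.
Proof.
intros Hr HM eps He.
assert (M0 : 0 <= M).
{ eapply Rle_trans; [apply Cmod_ge_0|apply (HM 0%C); rewrite Cmod_0; exact Hr]. }
assert (P : 0 < eps / (1 + M)) by (apply Rdiv_lt_0_compat; lra).
exists (Rmin rho (eps / (1 + M))); split; [apply Rmin_pos; lra|]; intros w Hw.
replace (w - 0)%C with w in Hw by ring.
assert (W1 := Rlt_le_trans _ _ _ Hw (Rmin_l _ _)).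
assert (W2 := Rlt_le_trans _ _ _ Hw (Rmin_r _ _)).
replace (w * f w - 0 * f 0%C)%C with (w * f w)%C by ring.
rewrite Cmod_mult. specialize (HM w W1).
assert (T := Cmod_ge_0 w). assert (T' := Cmod_ge_0 (f w)).
apply Rle_lt_trans with (Cmod w * (1 + M)); [apply Rmult_le_compat_l; lra|].
apply Rlt_le_trans with (eps / (1 + M) * (1 + M)); [|right; field; lra].
apply Rmult_lt_compat_r; lra.
Qed.

Lemma Cmod_ccont_continuous (f : C -> C) (z : C) : ccont f z ->
  @continuous C_UniformSpace R_UniformSpace (fun w => Cmod (f w)) z.
Proof.
intros H P [eps HP]; apply locally_C_iff.
destruct (H eps (cond_pos eps)) as (d & Hd & H').
exists d; split; [exact Hd|]; intros w Hw; apply HP.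
apply Rle_lt_trans with (2 := H' w Hw).
assert (T1 := Cmod_triangle_rev (f w) (f z)).
assert (T2 := Cmod_triangle_rev (f z) (f w)).
replace (f z - f w)%C with (- (f w - f z))%C in T2 by ring; rewrite Cmod_opp in T2.
apply Rabs_le. unfold minus, plus, opp; simpl. lra.
Qed.

Lemma continuous_positive (f : C -> R) (z : C) :
  @continuous C_UniformSpace R_UniformSpace f z -> 0 < f z ->
  exists d, 0 < d /\ forall w, Cmod (w - z) < d -> f z / 2 < f w < 2 * f z.
Proof.
intros H Hp.
assert (E : 0 < f z / 2) by lra.
specialize (H (ball (f z) (mkposreal _ E)) (locally_ball _ _)).
apply locally_C_iff in H; destruct H as (d & Hd & H).
exists d; split; [exact Hd|]; intros w Hw; specialize (H w Hw).
apply Rabs_lt_between' in H; simpl in H; lra.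
Qed.

(** The derivative is multiplied by [w] to avoid the exponent [n - 1], which
truncates at [n = 0]. *)
Lemma monomial_mul_cderiv (P : C -> C) (w p : C) (n : nat) :
  has_cderiv P w p -> exists d, has_cderiv (fun w => Cpow w n * P w)%C w d /\
    (w * d = Cpow w n * (INR n * P w + w * p))%C.
Proof.
intros H; destruct n as [|n].
- exists p; split; [|simpl; ring].
  eapply has_cderiv_ext_loc; [|exact H].
  exists 1; split; [lra|]; intros; simpl; ring.
- eexists; split.
  + apply has_cderiv_mult; [apply has_cderiv_pow, has_cderiv_id|exact H].
  + cbv beta; rewrite Cpow_S; ring.
Qed.

(** Put [N = n + 1].  Then [g' = w^n P] and [w g'' = w^n q], where [P] and [q] are
continuous at [0] with values [N h(0)] and [n N h(0)].  If [g 0 = 0], the gap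
[|g'|^2 - |g g''|] is [|w|^(2 n)] times [|P|^2 - |q h|], whose value at [0] is
[(N^2 - n N) |h(0)|^2 = N |h(0)|^2].  If [g 0 <> 0], criticality forces [n >= 1],
and [|w|] times the opposite gap is [|w|^n] times a quantity with the value
[n N |h(0) g(0)|] at [0]. *)
Lemma hessian_gap_near_critical_point (g g1 g2 h h1 h2 : C -> C) (n : nat) (rho M M' : R) :
  0 < rho -> twice_cderiv g g1 g2 0%C rho M -> twice_cderiv h h1 h2 0%C rho M' ->
  h 0%C <> 0%C -> (forall w, Cmod w < rho -> g w = g 0 + Cpow w (S n) * h w)%C ->
  (g 0 * g1 0 = 0)%C ->
  exists K d, 0 < K /\ 0 < d <= rho /\ forall w, Cmod w < d ->
    Cmod (g w * g1 w) <=
      K * Cmod w * Rabs (Cmod (g1 w) ^ 2 - Cmod (g w * g2 w)) /\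
    (w <> 0%C -> (g w * g1 w)%C <> 0%C).
Proof.
intros Hr Hg Hh h0 Hgh crit.
assert (ctr : forall w, (w - 0)%C = w) by (intros; ring).
set (N := INR (S n)).
set (P := fun w => (N * h w + w * h1 w)%C).
set (P1 := fun w => (0 * h w + N * h1 w + (1 * h1 w + w * h2 w))%C).
set (q := fun w => (INR n * P w + w * P1 w)%C).
assert (DP : forall w, Cmod w < rho -> has_cderiv P w (P1 w)).
{ intros w Hw; destruct (Hh w) as (A & B & _); [rewrite ctr; exact Hw|].
  apply has_cderiv_plus; apply has_cderiv_mult; auto.
  - apply has_cderiv_const.
  - apply has_cderiv_id. }
assert (G1 : forall w, Cmod w < rho -> g1 w = (Cpow w n * P w)%C).
{ intros w Hw; destruct (Hg w) as (A & _); [rewrite ctr; exact Hw|].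
  destruct (Hh w) as (B & _); [rewrite ctr; exact Hw|].
  apply (has_cderiv_unique g w); [exact A|].
  assert (D : has_cderiv (fun w => g 0%C + Cpow w (S n) * h w)%C w
    (0 + (INR (S n) * Cpow w n * 1 * h w + Cpow w (S n) * h1 w))%C).
  { apply has_cderiv_plus; [apply has_cderiv_const|].
    apply has_cderiv_mult; [apply has_cderiv_pow, has_cderiv_id|exact B]. }
  eapply has_cderiv_eq; [|eapply has_cderiv_ext_loc; [|exact D]].
  - unfold P, N; simpl Cpow; ring.
  - exists (rho - Cmod w); split; [lra|]; intros v Hv; symmetry; apply Hgh.
    assert (T := Cmod_triangle_rev v w); lra. }
assert (G2 : forall w, Cmod w < rho -> (w * g2 w = Cpow w n * q w)%C).
{ intros w Hw; destruct (Hg w) as (_ & A & _); [rewrite ctr; exact Hw|].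
  destruct (monomial_mul_cderiv P w (P1 w) n (DP w Hw)) as (d & Hd & E).
  unfold q; rewrite <- E; f_equal; apply (has_cderiv_unique g1 w); [exact A|].
  eapply has_cderiv_ext_loc; [|exact Hd].
  exists (rho - Cmod w); split; [lra|]; intros v Hv; symmetry; apply G1.
  assert (T := Cmod_triangle_rev v w); lra. }
assert (C0 : Cmod (0 - 0) < rho) by (rewrite ctr, Cmod_0; exact Hr).
assert (C0' : Cmod 0 < rho) by (rewrite Cmod_0; exact Hr).
assert (ch : ccont h 0%C) by (eapply has_cderiv_cont, (Hh 0%C C0)).
assert (ch1 : ccont h1 0%C) by (eapply has_cderiv_cont, (Hh 0%C C0)).
assert (cg : ccont g 0%C) by (eapply has_cderiv_cont, (Hg 0%C C0)).
assert (cP : ccont P 0%C) by (eapply has_cderiv_cont, DP, C0').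
assert (cq : ccont q 0%C).
{ apply ccont_plus.
  - apply (has_cderiv_cont (fun w => INR n * P w)%C) with (0 * P 0 + INR n * P1 0)%C.
    apply has_cderiv_mult; [apply has_cderiv_const|now apply DP].
  - destruct (ch1 1 ltac:(lra)) as (d & Hd & B).
    set (b := Cmod (h1 0%C) + 1).
    apply (ccont_id_mult_bounded P1 (Rmin rho d) (N * b + (b + rho * M'))).
    { apply Rmin_pos; lra. }
    intros w Hw.
    assert (W1 := Rlt_le_trans _ _ _ Hw (Rmin_l _ _)).
    assert (W2 := Rlt_le_trans _ _ _ Hw (Rmin_r _ _)).
    specialize (B w). rewrite ctr in B. specialize (B W2).
    assert (T := Cmod_triangle_rev (h1 w) (h1 0%C)).
    assert (N0 : 0 <= N) by apply pos_INR.
    destruct (Hh w) as (_ & _ & L); [rewrite ctr; exact W1|].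
    replace (P1 w) with (N * h1 w + (h1 w + w * h2 w))%C by (unfold P1; ring).
    eapply Rle_trans; [apply Cmod_triangle|].
    rewrite Cmod_Rmult by exact N0.
    apply Rplus_le_compat.
    + apply Rmult_le_compat_l; [exact N0|unfold b; lra].
    + eapply Rle_trans; [apply Cmod_triangle|]. rewrite Cmod_mult.
      apply Rplus_le_compat; [unfold b; lra|].
      apply Rmult_le_compat; try apply Cmod_ge_0; lra. }
assert (cid : ccont (fun w => w) 0%C) by (eapply has_cderiv_cont, has_cderiv_id).
assert (P0 : P 0%C = (N * h 0%C)%C) by (unfold P; ring).
assert (q0 : q 0%C = (INR n * (N * h 0%C))%C) by (unfold q; rewrite P0; ring).
assert (Hpos : 0 < Cmod (h 0%C)) by now apply Cmod_gt_0.
assert (Npos : 0 < N) by (apply lt_0_INR; lia).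
assert (n0 : 0 <= INR n) by apply pos_INR.
assert (Nn : N = INR n + 1) by apply S_INR.
assert (MP0 : Cmod (P 0%C) = N * Cmod (h 0%C)) by (rewrite P0, Cmod_Rmult; lra).
assert (Mq0 : Cmod (q 0%C) = INR n * (N * Cmod (h 0%C)))
  by (rewrite q0, !Cmod_Rmult; lra).
apply Cmod_ccont_continuous in ch, cg, cP, cq, cid.
destruct (continuous_positive _ _ cP) as (dP & DP0 & BP); [rewrite MP0; nra|].
destruct (continuous_positive _ _ ch ltac:(lra)) as (dh & Dh0 & Bh).
destruct (excluded_middle_informative (g 0%C = 0%C)) as [Z|NZ].
- set (B := fun w => Cmod (P w) * Cmod (P w) - Cmod (q w) * Cmod (h w)).
  assert (cB : @continuous C_UniformSpace R_UniformSpace B (RtoC 0)).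
  { apply @continuous_minus; apply @continuous_mult; assumption. }
  assert (B0 : 0 < B 0%C).
  { unfold B; rewrite MP0, Mq0, Nn. nra. }
  destruct (continuous_positive _ _ cB B0) as (dB & DB & BB).
  exists (2 * Cmod (h 0%C) * (2 * Cmod (P 0%C)) / (B 0%C / 2)), (Rmin (Rmin rho dB) (Rmin dP dh)).
  split; [|split].
  + apply Rdiv_lt_0_compat; [rewrite MP0|lra]. nra.
  + split; [repeat apply Rmin_pos; lra|]. eapply Rle_trans; apply Rmin_l.
  + intros w Hw.
    assert (W1 := Rlt_le_trans _ _ _ Hw (Rmin_l _ _)).
    assert (W2 := Rlt_le_trans _ _ _ Hw (Rmin_r _ _)).
    assert (W3 := Rlt_le_trans _ _ _ W1 (Rmin_l _ _)).
    specialize (BB w). specialize (BP w). specialize (Bh w). rewrite ctr in BB, BP, Bh.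
    specialize (BB (Rlt_le_trans _ _ _ W1 (Rmin_r _ _))).
    specialize (BP (Rlt_le_trans _ _ _ W2 (Rmin_l _ _))).
    specialize (Bh (Rlt_le_trans _ _ _ W2 (Rmin_r _ _))).
    assert (Eg : g w = (Cpow w (S n) * h w)%C) by (rewrite Hgh, Z by exact W3; ring).
    split.
    * assert (E2 : Cmod (g w * g2 w) = Cmod w ^ n * Cmod w ^ n * (Cmod (q w) * Cmod (h w))).
      { replace (g w * g2 w)%C with (Cpow w n * h w * (w * g2 w))%C by (rewrite Eg; simpl; ring).
        rewrite (G2 w W3), !Cmod_mult, Cmod_pow; ring. }
      rewrite E2, (G1 w W3), Eg, !Cmod_mult, !Cmod_pow.
      replace ((Cmod w ^ n * Cmod (P w)) ^ 2 - Cmod w ^ n * Cmod w ^ n * (Cmod (q w) * Cmod (h w)))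
        with (Cmod w ^ n * Cmod w ^ n * B w) by (unfold B; ring).
      assert (pw : 0 <= Cmod w ^ n * Cmod w ^ n)
        by (apply Rmult_le_pos; apply pow_le, Cmod_ge_0).
      rewrite Rabs_mult, (Rabs_right (_ * _)), (Rabs_right (B w)) by lra.
      replace (Cmod w ^ S n * Cmod (h w) * (Cmod w ^ n * Cmod (P w)))
        with (Cmod w * (Cmod w ^ n * Cmod w ^ n) * (Cmod (h w) * Cmod (P w))) by (simpl; ring).
      set (K := 2 * Cmod (h 0%C) * (2 * Cmod (P 0%C)) / (B 0%C / 2)).
      replace (K * Cmod w * (Cmod w ^ n * Cmod w ^ n * B w))
        with (Cmod w * (Cmod w ^ n * Cmod w ^ n) * (K * B w)) by ring.
      apply Rmult_le_compat_l; [apply Rmult_le_pos; [apply Cmod_ge_0|exact pw]|].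
      assert (K0 : 0 <= K).
      { unfold K; apply Rmult_le_pos; [|left; apply Rinv_0_lt_compat; lra].
        rewrite MP0. nra. }
      apply Rle_trans with (K * (B 0%C / 2)); [|apply Rmult_le_compat_l; lra].
      replace (K * (B 0%C / 2)) with (2 * Cmod (h 0%C) * (2 * Cmod (P 0%C)))
        by (unfold K; field; lra).
      apply Rmult_le_compat; try apply Cmod_ge_0; lra.
    * intros Hw0. rewrite Eg, (G1 w W3).
      assert (Hw1 : 0 < Cmod w) by now apply Cmod_gt_0.
      apply Cmod_gt_0; rewrite !Cmod_mult, !Cmod_pow.
      assert (0 < Cmod (P w)) by (rewrite MP0 in BP; nra).
      repeat apply Rmult_lt_0_compat; try apply pow_lt; lra.
- destruct n as [|m].
  { exfalso. assert (E : g1 0%C = 0%C).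
    { apply Classical_Prop.NNPP; intros N1; exact (Cmult_neq_0 _ _ NZ N1 crit). }
    rewrite (G1 _ C0') in E; simpl in E. rewrite Cmult_1_l in E.
    rewrite E, Cmod_0 in MP0. nra. }
  set (n := S m) in *.
  set (B := fun w => Cmod (q w) * Cmod (g w)
                     - Cmod w * (Cmod w ^ n * (Cmod (P w) * Cmod (P w)))).
  assert (cB : @continuous C_UniformSpace R_UniformSpace B (RtoC 0)).
  { apply @continuous_minus; [apply @continuous_mult; assumption|].
    apply @continuous_mult; [exact cid|]. apply @continuous_mult; [|now apply @continuous_mult].
    generalize n; intros k; induction k as [|k IH]; simpl; [apply continuous_const|].
    apply @continuous_mult; assumption. }
  assert (Gpos : 0 < Cmod (g 0%C)) by now apply Cmod_gt_0.
  assert (n1 : 1 <= INR n) by (unfold n; rewrite S_INR; assert (T := pos_INR m); lra).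
  assert (B0 : 0 < B 0%C).
  { unfold B; rewrite Mq0, Cmod_0, Rmult_0_l, Rminus_0_r.
    repeat apply Rmult_lt_0_compat; lra. }
  destruct (continuous_positive _ _ cB B0) as (dB & DB & BB).
  destruct (continuous_positive _ _ cg Gpos) as (dg & Dg0 & Bg).
  exists (2 * Cmod (g 0%C) * (2 * Cmod (P 0%C)) / (B 0%C / 2)), (Rmin (Rmin rho dB) (Rmin dP dg)).
  split; [|split].
  + apply Rdiv_lt_0_compat; [rewrite MP0|lra]. repeat apply Rmult_lt_0_compat; lra.
  + split; [repeat apply Rmin_pos; lra|]. eapply Rle_trans; apply Rmin_l.
  + intros w Hw.
    assert (W1 := Rlt_le_trans _ _ _ Hw (Rmin_l _ _)).
    assert (W2 := Rlt_le_trans _ _ _ Hw (Rmin_r _ _)).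
    assert (W3 := Rlt_le_trans _ _ _ W1 (Rmin_l _ _)).
    specialize (BB w). specialize (BP w). specialize (Bg w). rewrite ctr in BB, BP, Bg.
    specialize (BB (Rlt_le_trans _ _ _ W1 (Rmin_r _ _))).
    specialize (BP (Rlt_le_trans _ _ _ W2 (Rmin_l _ _))).
    specialize (Bg (Rlt_le_trans _ _ _ W2 (Rmin_r _ _))).
    split.
    * set (K := 2 * Cmod (g 0%C) * (2 * Cmod (P 0%C)) / (B 0%C / 2)).
      assert (K0 : 0 <= K).
      { unfold K; apply Rmult_le_pos; [|left; apply Rinv_0_lt_compat; lra].
        rewrite MP0. repeat apply Rmult_le_pos; lra. }
      replace (K * Cmod w * Rabs (Cmod (g1 w) ^ 2 - Cmod (g w * g2 w)))
        with (K * Rabs (Cmod w ^ n * B w)).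
      2: { rewrite Rmult_assoc; f_equal.
           transitivity (Rabs (Cmod w) * Rabs (Cmod (g1 w) ^ 2 - Cmod (g w * g2 w)));
             [|rewrite (Rabs_right (Cmod w)); [reflexivity|apply Rle_ge, Cmod_ge_0]].
           rewrite <- Rabs_mult, <- Rabs_Ropp; f_equal.
           replace (Cmod w * (Cmod (g1 w) ^ 2 - Cmod (g w * g2 w)))
             with (Cmod w * Cmod (g1 w) ^ 2 - Cmod (w * g2 w) * Cmod (g w))
             by (rewrite !Cmod_mult; ring).
           rewrite (G2 w W3), (G1 w W3), !Cmod_mult, Cmod_pow; unfold B; ring. }
      rewrite (G1 w W3), !Cmod_mult, Cmod_pow.
      assert (pw : 0 <= Cmod w ^ n) by (apply pow_le, Cmod_ge_0).
      rewrite Rabs_mult, !Rabs_right by lra.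
      replace (Cmod (g w) * (Cmod w ^ n * Cmod (P w)))
        with (Cmod w ^ n * (Cmod (g w) * Cmod (P w))) by ring.
      replace (K * (Cmod w ^ n * B w)) with (Cmod w ^ n * (K * B w)) by ring.
      apply Rmult_le_compat_l; [exact pw|].
      apply Rle_trans with (K * (B 0%C / 2)); [|apply Rmult_le_compat_l; lra].
      replace (K * (B 0%C / 2)) with (2 * Cmod (g 0%C) * (2 * Cmod (P 0%C)))
        by (unfold K; field; lra).
      apply Rmult_le_compat; try apply Cmod_ge_0; lra.
    * intros Hw0. rewrite (G1 w W3).
      assert (Hw1 : 0 < Cmod w) by now apply Cmod_gt_0.
      apply Cmod_gt_0; rewrite !Cmod_mult, !Cmod_pow.
      assert (0 < Cmod (P w)) by (rewrite MP0 in BP; nra).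
      repeat apply Rmult_lt_0_compat; try apply pow_lt; lra.
Qed.

Theorem holomorphic_at_structure (g : C -> C) (p : C) : holomorphic_at g p ->
  exists g1 g2 rho M, 0 < rho /\ twice_cderiv g g1 g2 p rho M /\
  ((forall w, Cmod (w - p) < rho -> g w = g p) \/
   ((g p * g1 p = 0)%C -> exists K, 0 < K /\ forall w, Cmod (w - p) < rho ->
      Cmod (g w * g1 w) <=
        K * Cmod (w - p) * Rabs (Cmod (g1 w) ^ 2 - Cmod (g w * g2 w)) /\
      (w <> p -> (g w * g1 w)%C <> 0%C))).
Proof.
intros H; apply locally_C_iff in H; destruct H as (d & Hd & H).
set (G := fun w => g (w + p)%C).
assert (GD : forall w, Cmod w <= d / 2 -> exists l, has_cderiv G w l).
{ intros w Hw; destruct (ex_derive_has_cderiv g (w + p)%C) as [l Hl].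
  - apply H; replace (w + p - p)%C with w by ring; lra.
  - exists l; apply (has_cderiv_shift g), Hl. }
assert (Hd4 : 0 < d / 2 / 2) by lra.
destruct (holomorphic_local_form G (d / 2) ltac:(lra) GD) as
  [(G1 & G2 & M & TG) [const|(n & h & h1 & h2 & M' & Th & h0 & E)]].
all: assert (shift : forall rho, rho <= d / 2 / 2 -> twice_cderiv g
  (fun w => G1 (w - p)%C) (fun w => G2 (w - p)%C) p rho M).
1,3: intros rho Hrho w Hw; destruct (TG (w - p)%C) as (A1 & A2 & A3);
  [replace (w - p - 0)%C with (w - p)%C by ring; lra|];
  split; [|split; [apply (has_cderiv_shift G1), A2|exact A3]];
  apply (has_cderiv_shift G) in A1;
  eapply has_cderiv_ext_loc; [|exact A1];
  exists 1; split; [lra|]; intros v _; unfold G; f_equal; ring.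
- exists (fun w => G1 (w - p)%C), (fun w => G2 (w - p)%C), (d / 2 / 2), M.
  split; [lra|]; split; [apply shift; lra|left].
  intros w Hw; specialize (const (w - p)%C Hw); unfold G in const.
  replace (w - p + p)%C with w in const by ring.
  rewrite const; f_equal; ring.
- destruct (excluded_middle_informative (g p * G1 0 = 0)%C) as [crit|N].
  + destruct (hessian_gap_near_critical_point G G1 G2 h h1 h2 n (d / 2 / 2) M M')
      as (K & e & HK & He & gap); auto.
    { unfold G; replace (0 + p)%C with p by ring; exact crit. }
    exists (fun w => G1 (w - p)%C), (fun w => G2 (w - p)%C), e, M.
    split; [lra|]; split; [apply shift; lra|right].
    intros _; exists K; split; [exact HK|]; intros w Hw.
    destruct (gap (w - p)%C Hw) as [B1 B2]; unfold G in B1, B2.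
    replace (w - p + p)%C with w in B1, B2 by ring.
    split; [exact B1|]; intros Hwp; apply B2; intros Z; apply Hwp.
    replace w with (w - p + p)%C by ring; rewrite Z; ring.
  + exists (fun w => G1 (w - p)%C), (fun w => G2 (w - p)%C), (d / 2 / 2), M.
    split; [lra|]; split; [apply shift; lra|right].
    replace (p - p)%C with (RtoC 0) by ring; contradiction.
Qed.

(** * The squared modulus and its derivatives *)

Lemma ccont_not_pole (g : C -> C) (p : C) : ccont g p -> ~ is_pole g p.
Proof.
intros Hc [_ Hp].
assert (A : @locally' C_UniformSpace p (fun w => Cmod (g p) + 1 < Cmod (g w))).
{ apply (Hp (fun x => Cmod (g p) + 1 < x)); exists (Cmod (g p) + 1); auto. }
apply locally_C_iff in A; destruct A as (d & Hd & A).
destruct (Hc 1 ltac:(lra)) as (d' & Hd' & B).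
assert (Dm : 0 < Rmin d d') by (apply Rmin_pos; lra).
assert (M1 := Rmin_l d d'). assert (M2 := Rmin_r d d').
set (w := (p + RtoC (Rmin d d' / 2))%C).
assert (W : Cmod (w - p) = Rmin d d' / 2).
{ replace (w - p)%C with (RtoC (Rmin d d' / 2)) by (unfold w; ring).
  rewrite Cmod_R, Rabs_right; lra. }
specialize (A w ltac:(lra)). specialize (B w ltac:(lra)).
assert (T := Cmod_triangle_rev (g w) (g p)).
assert (Hw : w <> p).
{ intros E; rewrite E in W. replace (p - p)%C with (RtoC 0) in W by ring.
  rewrite Cmod_0 in W; lra. }
specialize (A Hw); lra.
Qed.

Lemma sq_modulus_finite (g : C -> C) (p : C) : ~ is_pole g p ->
  sq_modulus g p = Finite (Re (g p) ^ 2 + Im (g p) ^ 2).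
Proof.
intros H; unfold sq_modulus; destruct (excluded_middle_informative _); tauto.
Qed.

Lemma twice_cderiv_not_pole (g g1 g2 : C -> C) (p q : C) (rho M : R) :
  twice_cderiv g g1 g2 p rho M -> Cmod (q - p) < rho -> ~ is_pole g q.
Proof.
intros H Hq; apply ccont_not_pole; eapply has_cderiv_cont, (H q Hq).
Qed.

Lemma horizontal_deriv (p : C) (s : R) : path_deriv (fun x => (x, snd p)) s 1%C.
Proof. apply path_deriv_pair; auto_derive; auto. Qed.

Lemma vertical_deriv (p : C) (s : R) : path_deriv (fun y => (fst p, y)) s Ci.
Proof. apply path_deriv_pair; auto_derive; auto. Qed.

Lemma sq_path_deriv (c : R -> C) (s : R) (l : C) : path_deriv c s l ->
  is_derive (fun t => Re (c t) ^ 2 + Im (c t) ^ 2) s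
    (2 * (Re (c s) * Re l + Im (c s) * Im l)).
Proof.
intros H; assert (A := Re_deriv _ _ _ H). assert (B := Im_deriv _ _ _ H).
evar_last.
- apply @is_derive_plus; apply is_derive_pow; eassumption.
- unfold plus; simpl; ring.
Qed.

Section Derivatives.

Variables (g g1 g2 : C -> C) (p : C) (rho M : R).
Hypothesis Tg : twice_cderiv g g1 g2 p rho M.

Definition sq_mod_dx (q : C) : R := 2 * (Re (g q) * Re (g1 q) + Im (g q) * Im (g1 q)).
Definition sq_mod_dy (q : C) : R := 2 * (Im (g q) * Re (g1 q) - Re (g q) * Im (g1 q)).

Let h (q : R * R) : R := real (sq_modulus g q).

Lemma sq_modulus_near (q : C) : Cmod (q - p) < rho ->
  h q = Re (g q) ^ 2 + Im (g q) ^ 2.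
Proof.
intros Hq; unfold h; rewrite sq_modulus_finite; [reflexivity|].
eapply twice_cderiv_not_pole; eauto.
Qed.

Lemma near_open (c : R -> C) (s : R) (l : C) : path_deriv c s l ->
  Cmod (c s - p) < rho -> locally s (fun t => Cmod (c t - p) < rho).
Proof.
intros Hc Hs; destruct (path_deriv_cont _ _ _ Hc (rho - Cmod (c s - p)) ltac:(lra))
  as (d & Hd & H).
exists (mkposreal d Hd); intros t Ht; specialize (H t Ht).
assert (T := Cmod_triangle (c t - c s) (c s - p)).
replace (c t - c s + (c s - p))%C with (c t - p)%C in T by ring. lra.
Qed.

Lemma partial1_near (f k : R * R -> R) (q : C) (l : R) : Cmod (q - p) < rho ->
  (forall r : C, Cmod (r - p) < rho -> f r = k r) ->
  is_derive (fun x => k (x, snd q)) (fst q) l -> partial1 f q = l.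
Proof.
intros Hq E D; unfold partial1; apply is_derive_unique.
eapply is_derive_ext_loc; [|exact D].
assert (L := near_open (fun x => (x, snd q)) (fst q) 1 (horizontal_deriv q (fst q))).
cbv beta in L; rewrite <- surjective_pairing in L; specialize (L Hq).
revert L; apply filter_imp; intros x Hx; symmetry; apply E, Hx.
Qed.

Lemma partial2_near (f k : R * R -> R) (q : C) (l : R) : Cmod (q - p) < rho ->
  (forall r : C, Cmod (r - p) < rho -> f r = k r) ->
  is_derive (fun y => k (fst q, y)) (snd q) l -> partial2 f q = l.
Proof.
intros Hq E D; unfold partial2; apply is_derive_unique.
eapply is_derive_ext_loc; [|exact D].
assert (L := near_open (fun y => (fst q, y)) (snd q) Ci (vertical_deriv q (snd q))).
cbv beta in L; rewrite <- surjective_pairing in L; specialize (L Hq).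
revert L; apply filter_imp; intros x Hx; symmetry; apply E, Hx.
Qed.

Lemma partial1_sq_modulus (q : C) : Cmod (q - p) < rho -> partial1 h q = sq_mod_dx q.
Proof.
intros Hq; apply (partial1_near h (fun r => Re (g r) ^ 2 + Im (g r) ^ 2)); auto.
{ exact sq_modulus_near. }
destruct (Tg q Hq) as (D & _).
rewrite (surjective_pairing q) in D.
assert (P := sq_path_deriv _ _ _ (path_deriv_comp g _ _ _ _ (horizontal_deriv q (fst q)) D)).
evar_last; [exact P|].
cbv beta; rewrite <- surjective_pairing; unfold sq_mod_dx, Re, Im; simpl; ring.
Qed.

Lemma partial2_sq_modulus (q : C) : Cmod (q - p) < rho -> partial2 h q = sq_mod_dy q.
Proof.
intros Hq; apply (partial2_near h (fun r => Re (g r) ^ 2 + Im (g r) ^ 2)); auto.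
{ exact sq_modulus_near. }
destruct (Tg q Hq) as (D & _).
rewrite (surjective_pairing q) in D.
assert (P := sq_path_deriv _ _ _ (path_deriv_comp g _ _ _ _ (vertical_deriv q (snd q)) D)).
evar_last; [exact P|].
cbv beta; rewrite <- surjective_pairing; unfold sq_mod_dy, Re, Im; simpl; ring.
Qed.

Lemma grad_sq_modulus (q : C) : Cmod (q - p) < rho ->
  grad (sq_modulus g) q = (sq_mod_dx q, sq_mod_dy q).
Proof.
intros Hq; unfold grad; f_equal; [now apply partial1_sq_modulus|now apply partial2_sq_modulus].
Qed.

(** Both second partial derivatives of each component are the cases [l = 1] and
[l = i]. *)
Lemma gradient_path_deriv (c : R -> C) (s : R) (l : C) : path_deriv c s l ->
  Cmod (c s - p) < rho ->
  is_derive (fun t => sq_mod_dx (c t)) s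
    (2 * (Re (g1 (c s) * l) * Re (g1 (c s)) + Re (g (c s)) * Re (g2 (c s) * l)
        + (Im (g1 (c s) * l) * Im (g1 (c s)) + Im (g (c s)) * Im (g2 (c s) * l)))) /\
  is_derive (fun t => sq_mod_dy (c t)) s
    (2 * (Im (g1 (c s) * l) * Re (g1 (c s)) + Im (g (c s)) * Re (g2 (c s) * l)
        - (Re (g1 (c s) * l) * Im (g1 (c s)) + Re (g (c s)) * Im (g2 (c s) * l)))).
Proof.
intros Hc Hs; destruct (Tg _ Hs) as (D1 & D2 & _).
assert (P1 := path_deriv_comp g _ _ _ _ Hc D1).
assert (P2 := path_deriv_comp g1 _ _ _ _ Hc D2).
assert (A1 := Re_deriv _ _ _ P1). assert (B1 := Im_deriv _ _ _ P1).
assert (A2 := Re_deriv _ _ _ P2). assert (B2 := Im_deriv _ _ _ P2).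
split.
- apply (is_derive_scal (fun t => Re (g (c t)) * Re (g1 (c t)) + Im (g (c t)) * Im (g1 (c t)))).
  apply @is_derive_plus; apply (is_derive_mult (K := R_AbsRing)); auto; intros; apply Rmult_comm.
- apply (is_derive_scal (fun t => Im (g (c t)) * Re (g1 (c t)) - Re (g (c t)) * Im (g1 (c t)))).
  apply @is_derive_minus; apply (is_derive_mult (K := R_AbsRing)); auto; intros; apply Rmult_comm.
Qed.

Lemma hessian_sq_modulus (q : C) : Cmod (q - p) < rho ->
  let D := Cmod (g1 q) ^ 2 in
  let X := Re (g q) * Re (g2 q) + Im (g q) * Im (g2 q) in
  let Y := Im (g q) * Re (g2 q) - Re (g q) * Im (g2 q) in
  hessian (sq_modulus g) q =
    ((2 * D + 2 * X, 2 * Y), (2 * Y, 2 * D - 2 * X)).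
Proof.
intros Hq D X Y.
assert (F1 := gradient_path_deriv _ _ _ (horizontal_deriv q (fst q))).
assert (F2 := gradient_path_deriv _ _ _ (vertical_deriv q (snd q))).
cbv beta in F1, F2; rewrite <- surjective_pairing in F1, F2.
destruct (F1 Hq) as [F11 F12]. destruct (F2 Hq) as [F21 F22].
unfold hessian; fold h.
rewrite (partial1_near (partial1 h) sq_mod_dx q _ Hq partial1_sq_modulus F11).
rewrite (partial1_near (partial2 h) sq_mod_dy q _ Hq partial2_sq_modulus F12).
rewrite (partial2_near (partial1 h) sq_mod_dx q _ Hq partial1_sq_modulus F21).
rewrite (partial2_near (partial2 h) sq_mod_dy q _ Hq partial2_sq_modulus F22).
unfold D, X, Y; rewrite Cmod2_alt.
f_equal; f_equal; unfold Re, Im; simpl; ring.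
Qed.

End Derivatives.

Lemma norm_pair (v : R * R) : norm v = Cmod v.
Proof. rewrite Cmod_norm; reflexivity. Qed.

Lemma Cmod_gradient (g g1 : C -> C) (q : C) :
  Cmod (sq_mod_dx g g1 q, sq_mod_dy g g1 q) = 2 * Cmod (g q * g1 q).
Proof.
replace (sq_mod_dx g g1 q, sq_mod_dy g g1 q) with (2 * (g q * Cconj (g1 q)))%C.
- rewrite !Cmod_mult, Cmod_conj, Cmod_R, Rabs_right; lra.
- unfold sq_mod_dx, sq_mod_dy, Re, Im, Cconj, RtoC.
  apply injective_projections; simpl; ring.
Qed.

(** * Spectral analysis of symmetric 2x2 matrices *)

(** Every symmetric matrix has this form; [m] is the mean of its eigenvalues and
[sqrt (a^2 + b^2)] half their difference. *)
Definition sym_mat (m a b : R) : mat2 := ((m + a, b), (b, m - a)).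

Lemma dot_comm (u v : R * R) : dot u v = dot v u.
Proof. unfold dot; ring. Qed.

Lemma dot_plus (u v e : R * R) : dot (plus u v) e = dot u e + dot v e.
Proof.
change ((fst u + fst v) * fst e + (snd u + snd v) * snd e = dot u e + dot v e).
unfold dot; ring.
Qed.

Lemma dot_scal (k : R) (u e : R * R) : dot (scal k u) e = k * dot u e.
Proof.
change (k * fst u * fst e + k * snd u * snd e = k * dot u e); unfold dot; ring.
Qed.

Lemma dot_minus (u v e : R * R) : dot (minus u v) e = dot u e - dot v e.
Proof.
change ((fst u + - fst v) * fst e + (snd u + - snd v) * snd e = dot u e - dot v e).
unfold dot; ring.
Qed.

Lemma sym_mat_dot (m a b : R) (u v : R * R) :
  dot (mat_app (sym_mat m a b) u) v = dot u (mat_app (sym_mat m a b) v).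
Proof. unfold dot, mat_app, sym_mat, dot; simpl; ring. Qed.

Lemma eigenvalue_sym_mat (m a b l : R) : eigenvalue (sym_mat m a b) l ->
  Rabs (l - m) = sqrt (a ^ 2 + b ^ 2).
Proof.
intros [[x y] [N E]].
assert (E1 := f_equal fst E). change ((m + a) * x + b * y = l * x) in E1.
assert (E2 := f_equal snd E). change (b * x + (m - a) * y = l * y) in E2.
assert (Z : (l - m) ^ 2 = a ^ 2 + b ^ 2).
{ apply Classical_Prop.NNPP; intros H; apply N.
  assert (Zx : ((l - m) ^ 2 - (a ^ 2 + b ^ 2)) * x = 0).
  { replace (((l - m) ^ 2 - (a ^ 2 + b ^ 2)) * x)
      with ((l - m + a) * (l * x - ((m + a) * x + b * y)) + b * (l * y - (b * x + (m - a) * y)))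
      by ring.
    rewrite <- E1, <- E2; ring. }
  assert (Zy : ((l - m) ^ 2 - (a ^ 2 + b ^ 2)) * y = 0).
  { replace (((l - m) ^ 2 - (a ^ 2 + b ^ 2)) * y)
      with (b * (l * x - ((m + a) * x + b * y)) + (l - m - a) * (l * y - (b * x + (m - a) * y)))
      by ring.
    rewrite <- E1, <- E2; ring. }
  apply Rmult_integral in Zx; apply Rmult_integral in Zy.
  apply injective_projections; simpl; unfold zero; simpl; lra. }
rewrite <- Z, <- sqrt_Rsqr_abs; f_equal; unfold Rsqr; ring.
Qed.

(** [(a + s, b)] with [s = sqrt (a^2 + b^2)] is an eigenvector for [m + s] unless it
vanishes, in which case the matrix is diagonal and [(0, 1)] serves.  A quarter
turn gives the other one. *)
Lemma sym_mat_eigenbasis (m a b : R) : exists c t l1 l2,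
  c ^ 2 + t ^ 2 = 1 /\ eigenvector (sym_mat m a b) l1 (c, t) /\
  eigenvector (sym_mat m a b) l2 (- t, c).
Proof.
set (s := sqrt (a ^ 2 + b ^ 2)).
assert (Hs : s * s = a ^ 2 + b ^ 2) by (apply sqrt_sqrt; nra).
assert (Q : exists x y, 0 < x ^ 2 + y ^ 2 /\ a * x + b * y = s * x /\ b * x - a * y = s * y).
{ destruct (Req_dec (a + s) 0) as [Z|N].
  - exists 0, 1. assert (b = 0) by (apply Rsqr_0_uniq; unfold Rsqr; replace s with (- a) in Hs; nra).
    repeat split; nra.
  - exists (a + s), b. repeat split; nra. }
destruct Q as (x & y & Q0 & Q1 & Q2).
set (n := sqrt (x ^ 2 + y ^ 2)).
assert (Hn : n * n = x ^ 2 + y ^ 2) by (apply sqrt_sqrt; lra).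
assert (n0 : 0 < n) by (apply sqrt_lt_R0; lra).
assert (unit_ : (x / n) ^ 2 + (y / n) ^ 2 = 1).
{ replace ((x / n) ^ 2 + (y / n) ^ 2) with ((x ^ 2 + y ^ 2) / (n * n)) by (field; lra).
  rewrite Hn; field; lra. }
exists (x / n), (y / n), (m + s), (m - s).
split; [exact unit_|].
assert (E1 : a * (x / n) + b * (y / n) = s * (x / n)).
{ replace (a * (x / n) + b * (y / n)) with ((a * x + b * y) / n) by (field; lra).
  rewrite Q1; field; lra. }
assert (E2 : b * (x / n) - a * (y / n) = s * (y / n)).
{ replace (b * (x / n) - a * (y / n)) with ((b * x - a * y) / n) by (field; lra).
  rewrite Q2; field; lra. }
revert unit_ E1 E2; generalize (x / n) (y / n); clear; intros c t U E1 E2.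
split; split.
- intros Z; assert (Z1 := f_equal fst Z); assert (Z2 := f_equal snd Z).
  change (c = 0) in Z1; change (t = 0) in Z2; nra.
- apply injective_projections.
  + change ((m + a) * c + b * t = (m + s) * c); lra.
  + change (b * c + (m - a) * t = (m + s) * t); lra.
- intros Z; assert (Z1 := f_equal fst Z); assert (Z2 := f_equal snd Z).
  change (- t = 0) in Z1; change (c = 0) in Z2; nra.
- apply injective_projections.
  + change ((m + a) * - t + b * c = (m - s) * - t); lra.
  + change (b * - t + (m - a) * c = (m - s) * c); lra.
Qed.

Lemma span_dot_eq_0 (S : R * R -> Prop) (e u : R * R) :
  (forall v, S v -> dot v e = 0) -> span S u -> dot u e = 0.
Proof.
intros HS Hu; induction Hu as [|a v w Hv Hw IH].
- change (0 * fst e + 0 * snd e = 0); ring.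
- rewrite dot_plus, dot_scal, IH, (HS v Hv); ring.
Qed.

Lemma span_incl (S : R * R -> Prop) (v : R * R) : S v -> span S v.
Proof.
intros H; replace v with (plus (scal 1 v) zero).
- apply span_add; [exact H|constructor].
- rewrite plus_zero_r; exact (scal_one v).
Qed.

Lemma eigenvectors_orthogonal (m a b l l' : R) (u v : R * R) :
  eigenvector (sym_mat m a b) l u -> eigenvector (sym_mat m a b) l' v -> l <> l' ->
  dot u v = 0.
Proof.
intros [_ Hu] [_ Hv] N.
assert (E := sym_mat_dot m a b u v).
rewrite Hu, Hv, (dot_comm u), !dot_scal, (dot_comm v) in E.
apply (Rmult_eq_reg_l (l - l')); lra.
Qed.

(** In an eigenvector [e], passing from [v] to [w] multiplies the coordinate by the
sign of [l], while the coordinate of [d] is [l] times that of [v].  Thus [w] is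
obtained from [d] by the inverse of the absolute value of the matrix. *)
Lemma search_direction_coordinate (m a b l : R) (d w e : R * R) :
  search_direction (sym_mat m a b) d w -> eigenvector (sym_mat m a b) l e ->
  l <> 0 -> Rabs l * dot w e = dot d e.
Proof.
intros (v & vp & vm & Hv & (Pp & Op) & (Pm & Om) & ->) He Hl.
assert (De : dot d e = l * dot v e).
{ rewrite <- Hv, sym_mat_dot; destruct He as [_ ->].
  now rewrite dot_comm, dot_scal, dot_comm. }
assert (Dw : dot (minus vp vm) e = dot vp e - dot vm e) by apply dot_minus.
assert (Dm : forall x, dot e (minus v x) = dot v e - dot x e)
  by (intros x; rewrite dot_comm; apply dot_minus).
rewrite De, Dw.
destruct (Rlt_dec 0 l) as [Pl|Nl].
- assert (A := Op e (span_incl _ _ (ex_intro _ l (conj Pl He)))).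
  assert (B : dot vm e = 0).
  { apply (span_dot_eq_0 _ _ _ ) with (2 := Pm); intros u (l' & L' & U).
    apply (eigenvectors_orthogonal m a b l' l); auto; lra. }
  rewrite Dm in A; rewrite B, Rabs_right by lra; f_equal; lra.
- assert (Pl : l < 0) by lra.
  assert (A := Om e (span_incl _ _ (ex_intro _ l (conj Pl He)))).
  assert (B : dot vp e = 0).
  { apply (span_dot_eq_0 _ _ _ ) with (2 := Pp); intros u (l' & L' & U).
    apply (eigenvectors_orthogonal m a b l' l); auto; lra. }
  rewrite Dm in A; rewrite B, Rabs_left by lra.
  replace (dot vm e) with (dot v e) by lra. ring.
Qed.

Lemma Cmod_sqr_dot (u : R * R) : Cmod u ^ 2 = dot u u.
Proof. rewrite Cmod2_alt; unfold dot, Re, Im; ring. Qed.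

(** Read off in an orthonormal eigenbasis from [search_direction_coordinate]. *)
Theorem search_direction_bounds (m a b mu L : R) (d w : R * R) :
  search_direction (sym_mat m a b) d w -> 0 < mu ->
  (forall l, eigenvalue (sym_mat m a b) l -> mu <= Rabs l <= L) ->
  mu * Cmod w <= Cmod d /\ Cmod d ^ 2 <= L * dot w d.
Proof.
intros Hw Hmu Hl.
destruct (sym_mat_eigenbasis m a b) as (c & t & l1 & l2 & U & V1 & V2).
assert (B1 := Hl l1 (ex_intro _ _ V1)). assert (B2 := Hl l2 (ex_intro _ _ V2)).
assert (nz : forall l, mu <= Rabs l -> l <> 0).
{ intros l H ->; rewrite Rabs_R0 in H; lra. }
assert (C1 := search_direction_coordinate _ _ _ _ _ _ _ Hw V1 (nz _ (proj1 B1))).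
assert (C2 := search_direction_coordinate _ _ _ _ _ _ _ Hw V2 (nz _ (proj1 B2))).
assert (Dec : forall u v, dot u v = dot u (c, t) * dot v (c, t) + dot u (- t, c) * dot v (- t, c)).
{ intros u v; unfold dot; simpl.
  transitivity ((c ^ 2 + t ^ 2) * (fst u * fst v + snd u * snd v)); [rewrite U; ring|ring]. }
set (x := dot w (c, t)) in *. set (y := dot w (- t, c)) in *.
split.
-
  apply Rsqr_incr_0; [|apply Rmult_le_pos; [lra|apply Cmod_ge_0]|apply Cmod_ge_0].
  rewrite !Rsqr_pow2, Rpow_mult_distr, !Cmod_sqr_dot, (Dec d d), (Dec w w).
  fold x y; rewrite <- C1, <- C2.
  assert (T1 : mu * mu <= Rabs l1 * Rabs l1) by (apply Rmult_le_compat; lra).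
  assert (T2 : mu * mu <= Rabs l2 * Rabs l2) by (apply Rmult_le_compat; lra).
  apply (Rmult_le_compat_r (x * x)) in T1; [|nra].
  apply (Rmult_le_compat_r (y * y)) in T2; [|nra]. lra.
- rewrite Cmod_sqr_dot, (Dec d d), (Dec w d); fold x y; rewrite <- C1, <- C2.
  assert (T1 : Rabs l1 * Rabs l1 <= L * Rabs l1) by (apply Rmult_le_compat_r; lra).
  assert (T2 : Rabs l2 * Rabs l2 <= L * Rabs l2) by (apply Rmult_le_compat_r; lra).
  apply (Rmult_le_compat_r (x * x)) in T1; [|nra].
  apply (Rmult_le_compat_r (y * y)) in T2; [|nra]. lra.
Qed.

(** * One step of the method *)

Lemma sqrt_hessian_entries (a b c d : R) :
  sqrt ((2 * (a * c + b * d)) ^ 2 + (2 * (b * c - a * d)) ^ 2) =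
  2 * Cmod ((a, b) * (c, d))%C.
Proof.
replace ((2 * (a * c + b * d)) ^ 2 + (2 * (b * c - a * d)) ^ 2)
  with ((2 * Cmod ((a, b) * (c, d))%C) * (2 * Cmod ((a, b) * (c, d))%C)).
- apply sqrt_square, Rmult_le_pos; [lra|apply Cmod_ge_0].
- replace (2 * Cmod ((a, b) * (c, d))%C * (2 * Cmod ((a, b) * (c, d))%C))
    with (4 * Cmod ((a, b) * (c, d))%C ^ 2) by ring.
  rewrite Cmod2_alt; unfold Re, Im; simpl; ring.
Qed.

Lemma kappa_pos (delta : nat -> R) : pairwise_distinct delta -> 0 < kappa delta.
Proof.
intros H; unfold kappa; apply Rmult_lt_0_compat; [lra|].
repeat apply Rmin_pos; apply Rabs_pos_lt; apply Rminus_eq_contra; apply H; lia.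
Qed.

(** A bound on [|delta j|] that is uniform in the selected index. *)
Definition delta_sum (delta : nat -> R) : R :=
  Rabs (delta 0%nat) + Rabs (delta 1%nat) + Rabs (delta 2%nat).

Lemma delta_le_sum (delta : nat -> R) (j : nat) :
  (j <= 2)%nat -> Rabs (delta j) <= delta_sum delta.
Proof.
intros Hj; unfold delta_sum.
assert (T0 := Rabs_pos (delta 0%nat)). assert (T1 := Rabs_pos (delta 1%nat)).
assert (T2 := Rabs_pos (delta 2%nat)).
destruct j as [|[|[|j]]]; try lra; lia.
Qed.

(** The real-valued form of [sq_modulus]; the two agree off the poles. *)
Definition sq_mod (g : C -> C) (q : C) : R := Re (g q) ^ 2 + Im (g q) ^ 2.

Lemma armijo_finite (g : C -> C) (q w : C) (b : R) : ~ is_pole g q ->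
  armijo (sq_modulus g) q w b <->
  (~ is_pole g (minus q (scal b w)) /\
   / 2 * b * dot w (grad (sq_modulus g) q) <= sq_mod g q - sq_mod g (minus q (scal b w))).
Proof.
intros Hq; unfold armijo; rewrite (sq_modulus_finite g q Hq).
unfold sq_modulus at 2; destruct (excluded_middle_informative _) as [Y|N]; simpl.
- split; [intros []|intros [N _]; contradiction].
- split; [intros H; split; [exact N|exact H]|intros [_ H]; exact H].
Qed.

Lemma dot_le (u v : C) : dot u v <= Cmod u * Cmod v.
Proof.
replace (dot u v) with (Re (u * Cconj v)%C) by (unfold dot, Re, Cconj; simpl; ring).
rewrite <- (Cmod_conj v), <- Cmod_mult.
eapply Rle_trans; [apply Rle_abs|apply re_le_Cmod].
Qed.

Lemma gradient_ccont (g g1 : C -> C) (p : C) : ccont g p -> ccont g1 p ->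
  ccont (fun q => (sq_mod_dx g g1 q, sq_mod_dy g g1 q)) p.
Proof.
intros Hg Hg1 eps He.
destruct (Cmult_close (g p) (Cconj (g1 p)) (eps / 2) ltac:(lra)) as (e & He0 & close).
destruct (Hg e He0) as (d1 & D1 & H1). destruct (Hg1 e He0) as (d2 & D2 & H2).
exists (Rmin d1 d2); split; [apply Rmin_pos; lra|]; intros q Hq.
specialize (H1 q (Rlt_le_trans _ _ _ Hq (Rmin_l _ _))).
specialize (H2 q (Rlt_le_trans _ _ _ Hq (Rmin_r _ _))).
assert (F : forall v, (sq_mod_dx g g1 v, sq_mod_dy g g1 v) = (2 * (g v * Cconj (g1 v)))%C).
{ intros v; unfold sq_mod_dx, sq_mod_dy, Re, Im, Cconj, RtoC.
  apply injective_projections; simpl; ring. }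
rewrite !F.
replace (2 * (g q * Cconj (g1 q)) - 2 * (g p * Cconj (g1 p)))%C
  with (2 * (g q * Cconj (g1 q) - g p * Cconj (g1 p)))%C by ring.
rewrite Cmod_Rmult by lra.
assert (T : Cmod (g q * Cconj (g1 q) - g p * Cconj (g1 p)) < eps / 2); [|lra].
apply close; [exact H1|].
rewrite <- Cminus_conj, Cmod_conj; exact H2.
Qed.

Section Step.

Variables (g g1 g2 : C -> C) (p : C) (rho M : R).
Hypothesis Tg : twice_cderiv g g1 g2 p rho M.
Variables (alpha beta : R) (delta : nat -> R).
Hypotheses (alpha_pos : 0 < alpha) (beta_range : 0 < beta < 1)
  (delta_distinct : pairwise_distinct delta).

(** The norm of the gradient, the factor of [delta j] in the shift, and the
two terms whose sum and difference are half the eigenvalues of the Hessian. *)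
Let gnorm (q : C) : R := 2 * Cmod (g q * g1 q).
Let gpow (q : C) : R := Rpower (gnorm q) (1 + alpha).
Let diag (q : C) : R := Cmod (g1 q) ^ 2.
Let off (q : C) : R := Cmod (g q * g2 q).

Lemma norm_grad (q : C) : Cmod (q - p) < rho -> norm (grad (sq_modulus g) q) = gnorm q.
Proof.
intros Hq; rewrite norm_pair, (grad_sq_modulus _ _ _ _ _ _ Tg q Hq).
apply Cmod_gradient.
Qed.

Lemma grad_eq_0_iff (q : C) : Cmod (q - p) < rho ->
  grad (sq_modulus g) q = zero <-> (g q * g1 q)%C = 0%C.
Proof.
intros Hq; assert (N := norm_grad q Hq); unfold gnorm in N; split; intros Z.
- rewrite norm_pair, Z in N; change (Cmod (RtoC 0) = 2 * Cmod (g q * g1 q)) in N.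
  rewrite Cmod_0 in N; apply Cmod_eq_0; lra.
- rewrite Z, Cmod_0, norm_pair in N.
  exact (Cmod_eq_0 (grad (sq_modulus g) q) ltac:(lra)).
Qed.

Lemma shifted_hessian_sq_modulus (q : C) (j : nat) : Cmod (q - p) < rho ->
  shifted_hessian alpha delta (sq_modulus g) q j =
  sym_mat (2 * diag q + delta j * gpow q)
    (2 * (Re (g q) * Re (g2 q) + Im (g q) * Im (g2 q)))
    (2 * (Im (g q) * Re (g2 q) - Re (g q) * Im (g2 q))).
Proof.
intros Hq; unfold shifted_hessian, grad_pow; rewrite norm_grad by exact Hq.
rewrite (hessian_sq_modulus _ _ _ _ _ _ Tg q Hq).
fold (gpow q) (diag q).
set (X := Re (g q) * Re (g2 q) + _). set (Y := Im (g q) * Re (g2 q) - _).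
unfold sym_mat; apply injective_projections; apply injective_projections.
- change (2 * diag q + 2 * X + delta j * gpow q * 1 = 2 * diag q + delta j * gpow q + 2 * X); ring.
- change (2 * Y + delta j * gpow q * 0 = 2 * Y); ring.
- change (2 * Y + delta j * gpow q * 0 = 2 * Y); ring.
- change (2 * diag q - 2 * X + delta j * gpow q * 1 = 2 * diag q + delta j * gpow q - 2 * X); ring.
Qed.

(** What a moving step provides.  A trial factor [b < 1] is a power [beta^(i+1)],
and maximality makes Armijo's condition fail at [b / beta = beta^i].  The length
of [w] is controlled both by the lower bound that the choice of [j] guarantees
and by the spectral gap of the unshifted Hessian. *)
Lemma step_bounds (q q' : R * R) : Cmod (q - p) < rho ->
  grad (sq_modulus g) q <> zero -> nqn_step alpha delta beta (sq_modulus g) q q' ->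
  exists (w : R * R) (b : R), q' = minus q (scal b w) /\ 0 < b <= 1 /\
    armijo (sq_modulus g) q w b /\
    (b = 1 \/ ~ armijo (sq_modulus g) q w (b / beta)) /\
    kappa delta * gpow q * Cmod w <= gnorm q /\
    (forall mu, 0 < mu -> mu <= 2 * Rabs (diag q - off q) - delta_sum delta * gpow q ->
       mu * Cmod w <= gnorm q) /\
    gnorm q ^ 2 <= (2 * diag q + 2 * off q + delta_sum delta * gpow q)
               * dot w (grad (sq_modulus g) q).
Proof.
intros Hq Hg [[Z _]|[_ (j & w & b & [[Hj Adm] _] & Dir & ([i Hb] & Arm & Max) & ->)]];
  [contradiction|].
assert (G0 : 0 < gpow q) by apply exp_pos.
rewrite (shifted_hessian_sq_modulus q j Hq) in Adm, Dir.
unfold grad_pow in Adm; rewrite norm_grad in Adm by exact Hq; fold (gpow q) in Adm.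
assert (K0 := kappa_pos delta delta_distinct).
assert (Dj := delta_le_sum delta j Hj).
assert (D0 : 0 <= diag q) by (unfold diag; nra).
assert (E0 : 0 <= off q) by apply Cmod_ge_0.
assert (Dg : Rabs (delta j * gpow q) <= delta_sum delta * gpow q).
{ rewrite Rabs_mult, (Rabs_right (gpow q)) by lra; apply Rmult_le_compat_r; lra. }
assert (Eig : forall l, eigenvalue (sym_mat (2 * diag q + delta j * gpow q)
    (2 * (Re (g q) * Re (g2 q) + Im (g q) * Im (g2 q)))
    (2 * (Im (g q) * Re (g2 q) - Re (g q) * Im (g2 q)))) l ->
    2 * Rabs (diag q - off q) - delta_sum delta * gpow q <= Rabs l /\
    Rabs l <= 2 * diag q + 2 * off q + delta_sum delta * gpow q).
{ intros l Hl; apply eigenvalue_sym_mat in Hl.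
  rewrite sqrt_hessian_entries in Hl; unfold Re, Im in Hl.
  rewrite <- !surjective_pairing in Hl; fold (off q) in Hl.
  revert Hl Dg; unfold Rabs; repeat destruct (Rcase_abs _); intros; split; lra. }
assert (NS : Cmod (grad (sq_modulus g) q) = gnorm q) by (rewrite <- norm_pair; apply norm_grad, Hq).
exists w, b; split; [reflexivity|]; split; [|split; [exact Arm|split]].
- rewrite Hb; split; [apply pow_lt; lra|].
  rewrite <- (pow1 i); apply pow_incr; lra.
- destruct i as [|i]; [left; rewrite Hb; reflexivity|right; intros A].
  replace (b / beta) with (beta ^ i) in A by (rewrite Hb; simpl; field; lra).
  specialize (Max i A); rewrite Hb in Max; simpl in Max.
  assert (0 < beta ^ i) by (apply pow_lt; lra). nra.
- assert (KG : 0 < kappa delta * gpow q) by now apply Rmult_lt_0_compat.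
  destruct (search_direction_bounds _ _ _ (kappa delta * gpow q) _ _ _ Dir KG
    (fun l Hl => conj (Adm l Hl) (proj2 (Eig l Hl)))) as [B1 B2].
  rewrite NS in B1, B2.
  split; [exact B1|split; [|exact B2]].
  intros mu Hmu Hle.
  destruct (search_direction_bounds _ _ _ mu _ _ _ Dir Hmu
    (fun l Hl => conj (Rle_trans _ _ _ Hle (proj1 (Eig l Hl))) (proj2 (Eig l Hl)))) as [B _].
  rewrite NS in B; exact B.
Qed.

Lemma grad_norm_pos (q : C) : Cmod (q - p) < rho -> grad (sq_modulus g) q <> zero -> 0 < gnorm q.
Proof.
intros Hq Hg; unfold gnorm; apply Rmult_lt_0_compat; [lra|apply Cmod_gt_0].
intros Z; apply Hg, grad_eq_0_iff; assumption.
Qed.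

Lemma step_decrease (q q' : R * R) : Cmod (q - p) < rho ->
  nqn_step alpha delta beta (sq_modulus g) q q' ->
  ~ is_pole g q' /\ sq_mod g q' <= sq_mod g q.
Proof.
intros Hq Hs.
assert (Np := twice_cderiv_not_pole _ _ _ _ _ _ _ Tg Hq).
destruct (excluded_middle_informative (grad (sq_modulus g) q = zero)) as [Z|NZ].
- destruct Hs as [[_ ->]|[N _]]; [|contradiction].
  split; [exact Np|lra].
- destruct (step_bounds q q' Hq NZ Hs) as (w & b & Eq & Hb & Arm & _ & _ & _ & B).
  apply armijo_finite in Arm; [|exact Np]; destruct Arm as [N A].
  assert (A' : / 2 * b * dot w (grad (sq_modulus g) q) <= sq_mod g q - sq_mod g q')
    by (rewrite Eq; exact A).
  split; [rewrite Eq; exact N|].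
  assert (S0 := grad_norm_pos q Hq NZ).
  assert (W : 0 <= dot w (grad (sq_modulus g) q)).
  { apply Rnot_lt_le; intros Neg.
    assert (L0 : 0 <= 2 * diag q + 2 * off q + delta_sum delta * gpow q).
    { assert (0 <= diag q) by (unfold diag; nra). assert (0 <= off q) by apply Cmod_ge_0.
      assert (0 < gpow q) by apply exp_pos.
      assert (0 <= delta_sum delta).
      { eapply Rle_trans; [apply Rabs_pos|apply (delta_le_sum delta 0); lia]. }
      assert (0 <= delta_sum delta * gpow q) by (apply Rmult_le_pos; lra). lra. }
    assert (0 < gnorm q ^ 2) by (apply pow_lt; exact S0). nra. }
  assert (0 <= / 2 * b * dot w (grad (sq_modulus g) q)) by (apply Rmult_le_pos; lra).
  lra.
Qed.

(** Put [T = ||g'|^2 - |g g''||], so the unshifted eigenvalues are at least [2 T] in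
absolute value and [|grad f| <= 2 K |q - p| T].  Where [|grad f| <= 1], the shift
is at most [delta_sum * |grad f|], hence at most [T] close to [p].  The eigenvalues
of the shifted matrix keep the bound [T], and [|w| <= |grad f| / T]. *)
Lemma step_near_critical_point (K : R) : 0 < rho -> 0 < K ->
  (forall q, Cmod (q - p) < rho ->
     Cmod (g q * g1 q) <= K * Cmod (q - p) * Rabs (Cmod (g1 q) ^ 2 - Cmod (g q * g2 q))) ->
  exists eta, 0 < eta /\ forall q q', Cmod (q - p) < eta ->
    nqn_step alpha delta beta (sq_modulus g) q q' ->
    Cmod (q' - q) <= 2 * K * Cmod (q - p).
Proof.
intros Hr HK gap.
assert (Cp : Cmod (p - p) < rho).
{ replace (p - p)%C with (RtoC 0) by ring; rewrite Cmod_0; exact Hr. }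
assert (crit : Cmod (g p * g1 p) = 0).
{ assert (H := gap p Cp). replace (p - p)%C with (RtoC 0) in H by ring.
  rewrite Cmod_0 in H. assert (T := Cmod_ge_0 (g p * g1 p)).
  rewrite Rmult_0_r, Rmult_0_l in H. lra. }
assert (dprod : has_cderiv (fun q => g q * g1 q)%C p (g1 p * g1 p + g p * g2 p)%C).
{ apply has_cderiv_mult; apply Tg, Cp. }
destruct (has_cderiv_cont _ _ _ dprod (/ 2) ltac:(lra)) as (d & Hd & small).
assert (D0 : 0 <= delta_sum delta).
{ eapply Rle_trans; [apply Rabs_pos|apply (delta_le_sum delta 0); lia]. }
set (c := 2 * K * delta_sum delta).
assert (c0 : 0 <= c) by (unfold c; apply Rmult_le_pos; lra).
exists (Rmin (Rmin rho d) (/ (1 + c))).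
split; [repeat apply Rmin_pos; try lra; apply Rinv_0_lt_compat; lra|].
intros q q' Hq Hs.
assert (Q1 := Rlt_le_trans _ _ _ Hq (Rmin_l _ _)).
assert (Q2 := Rlt_le_trans _ _ _ Hq (Rmin_r _ _)).
assert (Q3 := Rlt_le_trans _ _ _ Q1 (Rmin_l _ _)).
assert (Q4 := Rlt_le_trans _ _ _ Q1 (Rmin_r _ _)).
assert (r0 := Cmod_ge_0 (q - p)).
destruct (excluded_middle_informative (grad (sq_modulus g) q = zero)) as [Z|NZ].
{ destruct Hs as [[_ ->]|[N _]]; [|contradiction].
  replace (q - q)%C with (RtoC 0) by ring; rewrite Cmod_0.
  repeat apply Rmult_le_pos; lra. }
destruct (step_bounds q q' Q3 NZ Hs) as (w & b & -> & Hb & _ & _ & _ & B & _).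
assert (S0 := grad_norm_pos q Q3 NZ).
set (T := Rabs (diag q - off q)) in *.
assert (SK : gnorm q <= 2 * K * Cmod (q - p) * T).
{ unfold gnorm, T, diag, off; specialize (gap q Q3); lra. }
assert (S1 : gnorm q <= 1).
{ specialize (small q Q4). unfold gnorm.
  assert (R1 := Cmod_triangle_rev (g q * g1 q) (g p * g1 p)). lra. }
assert (GS : gpow q <= gnorm q).
{ unfold gpow; rewrite Rpower_plus, Rpower_1 by exact S0.
  assert (P : Rpower (gnorm q) alpha <= Rpower 1 alpha) by (apply Rle_Rpower_l; lra).
  replace (Rpower 1 alpha) with 1 in P
    by (unfold Rpower; rewrite ln_1, Rmult_0_r, exp_0; reflexivity).
  apply Rle_trans with (gnorm q * 1); [apply Rmult_le_compat_l; lra|lra]. }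
assert (T0 : 0 < T).
{ apply Rnot_le_lt; intros N; assert (T00 : T = 0) by (apply Rle_antisym; [exact N|apply Rabs_pos]).
  rewrite T00, Rmult_0_r in SK; lra. }
assert (DT : delta_sum delta * gpow q <= T).
{ apply Rle_trans with (delta_sum delta * (2 * K * Cmod (q - p) * T)).
  - apply Rmult_le_compat_l; lra.
  - replace (delta_sum delta * (2 * K * Cmod (q - p) * T)) with (c * Cmod (q - p) * T)
      by (unfold c; ring).
    apply Rle_trans with (1 * T); [|lra]; apply Rmult_le_compat_r; [lra|].
    apply Rle_trans with ((1 + c) * / (1 + c)); [|right; field; lra].
    apply Rmult_le_compat; lra. }
specialize (B T T0 ltac:(lra)).
apply (Cmod_le_eq _ (- (RtoC b * w))%C).
- rewrite Cmod_opp, Cmod_Rmult by lra.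
  apply Rle_trans with (1 * Cmod w); [apply Rmult_le_compat_r; [apply Cmod_ge_0|lra]|].
  rewrite Rmult_1_l; apply Rmult_le_reg_l with T; [exact T0|].
  eapply Rle_trans; [exact B|]; lra.
- apply injective_projections; [change (fst q + - (b * fst w) + - fst q = - (b * fst w - 0 * snd w))
  |change (snd q + - (b * snd w) + - snd q = - (b * snd w + 0 * fst w))]; ring.
Qed.

(** Lets the mean value theorem compare the actual decrease along the search line
with the predicted one. *)
Lemma sq_mod_line_deriv (q w : C) (s : R) :
  Cmod (q + - w * RtoC s - p) < rho ->
  is_derive (fun s => sq_mod g (q + - w * RtoC s)%C) s
    (- dot w (sq_mod_dx g g1 (q + - w * RtoC s)%C, sq_mod_dy g g1 (q + - w * RtoC s)%C)).
Proof.
intros Hs; destruct (Tg _ Hs) as (D1 & _).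
assert (P := sq_path_deriv _ _ _ (path_deriv_comp g _ _ _ _
  (path_deriv_affine q (- w) RtoC s 1 (path_deriv_id s)) D1)).
evar_last; [exact P|].
cbv beta; generalize (q + - w * RtoC s)%C; intros v.
unfold dot, sq_mod_dx, sq_mod_dy, Re, Im; simpl; ring.
Qed.

(** Near [p] the quantities [|grad f|], [|w|] and [<w, grad f>] lie between positive
constants, uniformly in the index [j].  By the mean value theorem and the
continuity of the gradient, Armijo's condition holds for all factors up to a
uniform [t0], so backtracking stops at a factor of at least
[min 1 (beta * t0)]. *)
Lemma step_near_noncritical_point : 0 < rho -> (g p * g1 p)%C <> 0%C ->
  exists eta c, 0 < eta /\ 0 < c /\ forall q q', Cmod (q - p) < eta ->
    nqn_step alpha delta beta (sq_modulus g) q q' -> sq_mod g q' <= sq_mod g q - c.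
Proof.
intros Hr Hp.
assert (ctr : (p - p)%C = 0%C) by ring.
assert (Cp : Cmod (p - p) < rho) by (rewrite ctr, Cmod_0; exact Hr).
assert (Pg : 0 < Cmod (g p * g1 p)) by now apply Cmod_gt_0.
destruct (Tg p Cp) as (Dg & Dg1 & _).
assert (cg := has_cderiv_cont _ _ _ Dg). assert (cg1 := has_cderiv_cont _ _ _ Dg1).
assert (cprod := has_cderiv_cont _ _ _ (has_cderiv_mult _ _ _ _ _ Dg Dg1)).
assert (NZ0 : 0 < Cmod (g p) /\ 0 < Cmod (g1 p)).
{ rewrite Cmod_mult in Pg; assert (T1 := Cmod_ge_0 (g p)); assert (T2 := Cmod_ge_0 (g1 p)).
  split; nra. }
destruct NZ0 as [Pgp Pg1p].
destruct (continuous_positive _ _ (Cmod_ccont_continuous _ _ cprod) Pg) as (d1 & D1 & B1).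
destruct (continuous_positive _ _ (Cmod_ccont_continuous _ _ cg) Pgp) as (d2 & D2 & B2).
destruct (continuous_positive _ _ (Cmod_ccont_continuous _ _ cg1) Pg1p) as (d3 & D3 & B3).
cbv beta in B1.
set (s0 := Cmod (g p * g1 p)) in *.
set (a := 2 * Cmod (g p)) in *. set (a1 := 2 * Cmod (g1 p)) in *.
set (Gmin := Rpower s0 (1 + alpha)). set (Gmax := Rpower (4 * s0) (1 + alpha)).
assert (Gmin0 : 0 < Gmin) by apply exp_pos. assert (Gmax0 : 0 < Gmax) by apply exp_pos.
assert (k0 := kappa_pos delta delta_distinct).
assert (kG : 0 < kappa delta * Gmin) by now apply Rmult_lt_0_compat.
assert (ds0 : 0 <= delta_sum delta).
{ eapply Rle_trans; [apply Rabs_pos|apply (delta_le_sum delta 0); lia]. }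
assert (M0 : 0 <= M).
{ eapply Rle_trans; [apply Cmod_ge_0|apply (proj2 (proj2 (Tg p Cp)))]. }
set (W := 4 * s0 / (kappa delta * Gmin)).
assert (W0 : 0 < W) by (apply Rdiv_lt_0_compat; lra).
set (L := 1 + 2 * a1 ^ 2 + 2 * (a * M) + delta_sum delta * Gmax).
assert (L0 : 0 < L).
{ assert (0 <= a1 ^ 2) by apply pow2_ge_0.
  assert (0 <= a * M) by (apply Rmult_le_pos; unfold a; lra).
  assert (0 <= delta_sum delta * Gmax) by (apply Rmult_le_pos; lra). unfold L; lra. }
set (c0 := s0 ^ 2 / L).
assert (c00 : 0 < c0) by (apply Rdiv_lt_0_compat; [apply pow_lt; exact Pg|exact L0]).
(* A change of [2 om] in the gradient alters [<w, grad f>] by at most [c0 / 2]. *)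
set (om := c0 / (4 * W)).
assert (om0 : 0 < om) by (apply Rdiv_lt_0_compat; lra).
set (Gam := fun q => (sq_mod_dx g g1 q, sq_mod_dy g g1 q) : C).
assert (cGam : ccont Gam p) by (apply gradient_ccont; assumption).
destruct (cGam om om0) as (d4 & D4 & B4).
set (eta := Rmin (Rmin rho d1) (Rmin (Rmin d2 d3) d4)).
assert (eta0 : 0 < eta) by (repeat apply Rmin_pos; lra).
assert (e1 : eta <= Rmin rho d1) by apply Rmin_l.
assert (e2 : eta <= Rmin (Rmin d2 d3) d4) by apply Rmin_r.
assert (e3 := Rmin_l rho d1). assert (e4 := Rmin_r rho d1).
assert (e5 := Rmin_l (Rmin d2 d3) d4). assert (e6 := Rmin_r (Rmin d2 d3) d4).
assert (e7 := Rmin_l d2 d3). assert (e8 := Rmin_r d2 d3).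
set (t0 := eta / 2 / W).
assert (t00 : 0 < t0) by (apply Rdiv_lt_0_compat; lra).
set (b0 := Rmin 1 (beta * t0)).
assert (b00 : 0 < b0) by (apply Rmin_pos; [lra|apply Rmult_lt_0_compat; lra]).
exists (eta / 2), (/ 2 * b0 * c0).
split; [lra|]; split; [apply Rmult_lt_0_compat; [lra|exact c00]|].
intros q q' Hq Hs.
assert (Hqr : Cmod (q - p) < rho) by lra.
specialize (B1 q ltac:(lra)). specialize (B2 q ltac:(lra)). specialize (B3 q ltac:(lra)).
cbv beta in B1, B2, B3.
assert (S1 : s0 < gnorm q < 4 * s0) by (unfold gnorm; lra).
assert (NZ : grad (sq_modulus g) q <> zero).
{ intros Z; apply grad_eq_0_iff in Z; [|exact Hqr]. rewrite Z, Cmod_0 in B1; lra. }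
assert (Np := twice_cderiv_not_pole _ _ _ _ _ _ _ Tg Hqr).
destruct (step_bounds q q' Hqr NZ Hs) as (w & b & Eq & Hb & Arm & Bb & Bw & _ & Bd).
apply armijo_finite in Arm; [|exact Np]; destruct Arm as [_ Arm].
assert (Arm' : / 2 * b * dot w (grad (sq_modulus g) q) <= sq_mod g q - sq_mod g q')
  by (rewrite Eq; exact Arm).
assert (Gq : Gmin <= gpow q <= Gmax) by (split; apply Rle_Rpower_l; lra).
assert (Ww : Cmod w <= W).
{ apply Rmult_le_reg_l with (kappa delta * Gmin); [exact kG|].
  apply Rle_trans with (kappa delta * gpow q * Cmod w).
  - apply Rmult_le_compat_r; [apply Cmod_ge_0|]. apply Rmult_le_compat_l; lra.
  - eapply Rle_trans; [exact Bw|].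
    replace (kappa delta * Gmin * W) with (4 * s0) by (unfold W; field; split; lra). lra. }
set (X := dot w (grad (sq_modulus g) q)) in *.
assert (Lq : 2 * diag q + 2 * off q + delta_sum delta * gpow q <= L).
{ assert (A1 : diag q <= a1 ^ 2) by (apply pow_incr; split; [apply Cmod_ge_0|lra]).
  assert (A2 : off q <= a * M).
  { unfold off; rewrite Cmod_mult; apply Rmult_le_compat; try apply Cmod_ge_0.
    - lra.
    - apply (proj2 (proj2 (Tg q Hqr))). }
  assert (A3 : delta_sum delta * gpow q <= delta_sum delta * Gmax)
    by (apply Rmult_le_compat_l; lra).
  unfold L; lra. }
assert (Lq0 : 0 <= 2 * diag q + 2 * off q + delta_sum delta * gpow q).
{ assert (0 <= diag q) by apply pow2_ge_0. assert (0 <= off q) by apply Cmod_ge_0.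
  assert (0 <= delta_sum delta * gpow q) by (apply Rmult_le_pos; lra). lra. }
assert (S2 : s0 ^ 2 <= gnorm q ^ 2) by (apply pow_incr; lra).
assert (s02 : 0 < s0 ^ 2) by (apply pow_lt; exact Pg).
assert (X0 : 0 <= X).
{ apply Rnot_lt_le; intros Neg. nra. }
assert (Xc : c0 <= X).
{ apply Rmult_le_reg_l with L; [exact L0|].
  replace (L * c0) with (s0 ^ 2) by (unfold c0; field; lra).
  apply Rle_trans with (1 := S2), Rle_trans with (1 := Bd), Rmult_le_compat_r; lra. }
assert (Gq' : grad (sq_modulus g) q = Gam q) by apply (grad_sq_modulus _ _ _ _ _ _ Tg q Hqr).
(* Along a short step the gradient moves by too little to cost more than half
   of the decrease predicted at [q]. *)
assert (short : forall t, 0 < t <= t0 -> armijo (sq_modulus g) q w t).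
{ intros t Ht.
  assert (tW : t * Cmod w <= eta / 2).
  { apply Rle_trans with (t0 * W); [apply Rmult_le_compat; try apply Cmod_ge_0; lra|].
    right; unfold t0; field; lra. }
  assert (near : forall s, 0 <= s <= t -> Cmod (q + - w * RtoC s - p) < eta).
  { intros s Hst.
    replace (q + - w * RtoC s - p)%C with ((q - p) + RtoC s * (- w))%C by ring.
    eapply Rle_lt_trans; [apply Cmod_triangle|]. rewrite Cmod_Rmult, Cmod_opp by lra.
    assert (s * Cmod w <= t * Cmod w) by (apply Rmult_le_compat_r; [apply Cmod_ge_0|lra]).
    lra. }
  assert (Et : minus q (scal t w) = (q + - w * RtoC t)%C).
  { apply injective_projections;
    [change (fst q + - (t * fst w) = fst q + (- fst w * t - - snd w * 0))
    |change (snd q + - (t * snd w) = snd q + (- fst w * 0 + - snd w * t))]; ring. }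
  apply armijo_finite; [exact Np|].
  assert (Nt := near t ltac:(lra)).
  split.
  - apply (twice_cderiv_not_pole g g1 g2 p _ rho M Tg).
    apply Rle_lt_trans with (Cmod (q + - w * RtoC t - p)); [|lra].
    right; f_equal; f_equal; exact Et.
  - fold X.
    assert (goal : / 2 * t * X <= sq_mod g q - sq_mod g (q + - w * RtoC t)%C);
      [|rewrite <- Et in goal; exact goal].
    destruct (MVT_cor2 (fun s => sq_mod g (q + - w * RtoC s)%C)
      (fun s => - dot w (Gam (q + - w * RtoC s)%C)) 0 t) as (xi & Hxi & Rxi); [lra| |].
    { intros s Hst; apply is_derive_Reals, sq_mod_line_deriv. specialize (near s Hst); lra. }
    replace (q + - w * RtoC 0)%C with (q : C) in Hxi by ring.
    assert (Y : / 2 * X <= dot w (Gam (q + - w * RtoC xi)%C)); [|nra].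
    set (v := (q + - w * RtoC xi)%C) in *.
    assert (V1 := B4 v ltac:(specialize (near xi); fold v in near; lra)).
    assert (V2 := B4 q ltac:(lra)).
    assert (V3 : Cmod (Gam q - Gam v) <= 2 * om).
    { replace (Gam q - Gam v)%C with ((Gam q - Gam p) + - (Gam v - Gam p))%C by ring.
      eapply Rle_trans; [apply Cmod_triangle|]; rewrite Cmod_opp; lra. }
    assert (V4 : dot w (Gam q - Gam v)%C <= c0 / 2).
    { eapply Rle_trans; [apply dot_le|].
      apply Rle_trans with (W * (2 * om)); [apply Rmult_le_compat; try apply Cmod_ge_0; lra|].
      right; unfold om; field; lra. }
    assert (V5 : X = dot w (Gam v) + dot w (Gam q - Gam v)%C).
    { unfold X; rewrite Gq'; unfold dot; simpl; ring. }
    lra. }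
assert (Hbb : b0 <= b).
{ destruct Bb as [->|Bb]; [apply Rmin_l|].
  eapply Rle_trans; [apply Rmin_r|].
  apply Rnot_lt_le; intros Lt; apply Bb, short; split.
  - apply Rdiv_lt_0_compat; lra.
  - apply Rmult_le_reg_l with beta; [lra|].
    replace (beta * (b / beta)) with b by (field; lra). lra. }
assert (/ 2 * b0 * c0 <= / 2 * b * X).
{ apply Rmult_le_compat; lra. }
lra.
Qed.

End Step.

(** * Cluster points of plane sequences *)

Definition cluster (z : nat -> C) (Q : nat -> Prop) (p : C) : Prop :=
  forall eps, 0 < eps -> forall N, exists n, (N <= n)%nat /\ Q n /\ Cmod (z n - p) < eps.

(** [square_induction] applied to the property that the square eventually contains
no term with index in [Q]. *)
Lemma bounded_cluster (z : nat -> C) (Q : nat -> Prop) (B : R) :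
  (forall N, exists n, (N <= n)%nat /\ Q n /\ Cmod (z n) <= B) -> exists p, cluster z Q p.
Proof.
intros HB; apply Classical_Prop.NNPP; intros none.
assert (B0 : 0 <= B).
{ destruct (HB O) as (n & _ & _ & H); eapply Rle_trans; [apply Cmod_ge_0|exact H]. }
assert (far : forall p, exists eps N, 0 < eps /\
  forall n, (N <= n)%nat -> Q n -> eps <= Cmod (z n - p)).
{ intros p; apply Classical_Prop.NNPP; intros H; apply none; exists p.
  intros eps He N; apply Classical_Prop.NNPP; intros H'; apply H.
  exists eps, N; split; [exact He|]; intros n Hn Qn; apply Rnot_lt_le; intros Lt.
  apply H'; exists n; auto. }
set (P := fun x y h => exists N, forall n, (N <= n)%nat -> Q n ->
  ~ (x <= Re (z n) <= x + h /\ y <= Im (z n) <= y + h)).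
assert (HP : P (- (B + 1)) (- (B + 1)) (2 * (B + 1))).
{ apply square_induction; [lra| |].
  - intros x y h Hh _ _ _ _ [N1 H1] [N2 H2] [N3 H3] [N4 H4].
    exists (N1 + N2 + N3 + N4)%nat; intros n Hn Qn [Hx Hy].
    specialize (H1 n ltac:(lia) Qn). specialize (H2 n ltac:(lia) Qn).
    specialize (H3 n ltac:(lia) Qn). specialize (H4 n ltac:(lia) Qn).
    destruct (Rle_dec (Re (z n)) (x + h)); destruct (Rle_dec (Im (z n)) (y + h)).
    + apply H1; lra.
    + apply H3; lra.
    + apply H2; lra.
    + apply H4; lra.
  - intros a b _ _. destruct (far (a, b)) as (eps & N & He & H).
    exists (eps / 2); split; [lra|]; intros x y h Hh _ _ _ _ Hx Hy.
    exists N; intros n Hn Qn [Hzx Hzy].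
    specialize (H n Hn Qn). assert (T := Cmod_le_Re_Im (z n - (a, b))).
    replace (Re (z n - (a, b))) with (Re (z n) - a) in T by (unfold Re; simpl; ring).
    replace (Im (z n - (a, b))) with (Im (z n) - b) in T by (unfold Im; simpl; ring).
    assert (Rabs (Re (z n) - a) <= h) by (apply Rabs_le; lra).
    assert (Rabs (Im (z n) - b) <= h) by (apply Rabs_le; lra).
    lra. }
destruct HP as [N H]; destruct (HB N) as (n & Hn & Qn & Hz).
apply (H n Hn Qn).
assert (T1 := re_le_Cmod (z n)). assert (T2 := Rmax_Cmod (z n)).
assert (T3 := Rmax_r (Rabs (fst (z n))) (Rabs (snd (z n)))).
assert (A1 : Rabs (Re (z n)) <= B) by lra.
assert (A2 : Rabs (Im (z n)) <= B) by (unfold Im; lra).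
apply Rabs_le_between in A1; apply Rabs_le_between in A2; lra.
Qed.

Lemma crossing (P : nat -> Prop) (m n : nat) : (m <= n)%nat -> P m -> ~ P n ->
  exists k, (m <= k)%nat /\ P k /\ ~ P (S k).
Proof.
intros Hmn Pm; induction Hmn as [|n Hmn IH]; intros Pn; [contradiction|].
destruct (excluded_middle_informative (P n)) as [Y|N]; [exists n; auto|now apply IH].
Qed.

Lemma decrease_not_frequent (f : nat -> R) (c : R) : 0 < c ->
  (forall n, 0 <= f n) -> (forall n, f (S n) <= f n) ->
  ~ (forall N, exists n, (N <= n)%nat /\ f (S n) <= f n - c).
Proof.
intros Hc f0 dec often.
assert (mono : forall m n, (m <= n)%nat -> f n <= f m).
{ intros m n H; induction H as [|n H IH]; [lra|]. specialize (dec n); lra. }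
assert (low : forall k, exists n, f n <= f O - INR k * c).
{ induction k as [|k [n IH]].
  - exists O; simpl; lra.
  - destruct (often n) as (m & Hm & Dm); exists (S m).
    assert (T := mono n m Hm). rewrite S_INR; lra. }
destruct (INR_archimed c (f O) Hc) as [k Hk].
destruct (low k) as [n Hn]; specialize (f0 n); lra.
Qed.

Lemma not_lim_bounded (z : nat -> C) :
  ~ is_lim_seq (fun n => fst (z n) ^ 2 + snd (z n) ^ 2) p_infty ->
  exists B, forall N, exists n, (N <= n)%nat /\ True /\ Cmod (z n) <= B.
Proof.
intros H; apply Classical_Prop.NNPP; intros H'; apply H.
apply is_lim_seq_spec; intros M.
apply Classical_Prop.NNPP; intros H2; apply H'.
exists (1 + Rabs M); intros N.
apply Classical_Prop.NNPP; intros H3; apply H2; exists N; intros n Hn.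
apply Rnot_le_lt; intros Le; apply H3; exists n; split; [exact Hn|split; [exact I|]].
apply Rnot_lt_le; intros Lt.
change (fst (z n) ^ 2 + snd (z n) ^ 2) with (Re (z n) ^ 2 + Im (z n) ^ 2) in Le.
rewrite <- Cmod2_alt in Le.
assert (A := Rle_abs M). assert (A' := Rabs_pos M). nra.
Qed.

Lemma filterlim_of_Cmod (z : nat -> R * R) (p : R * R) :
  (forall eps, 0 < eps -> exists N, forall n, (N <= n)%nat -> Cmod (z n - p) < eps) ->
  filterlim z eventually (locally p).
Proof.
intros H P [eps HP]; destruct (H eps (cond_pos eps)) as [N HN].
exists N; intros n Hn; apply HP. exact (ball_of_Cmod p (z n) eps (HN n Hn)).
Qed.

(** * Convergence *)

Theorem theorem3p3 (g : C -> C) (alpha : R) (delta : nat -> R) (beta : R)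
    (z : nat -> R * R)
    (g_mero : meromorphic g)
    (g_nonconst : ~ constant_off_poles g)
    (alpha_pos : 0 < alpha)
    (alpha_generic : forall n : nat, (2 <= n)%nat ->
       alpha <> (INR n - 3) / (INR n - 1))
    (delta_distinct : pairwise_distinct delta)
    (beta_range : 0 < beta < 1)
    (z0_not_pole : ~ is_pole g (z 0%nat))
    (z_nqn : forall k : nat,
       nqn_step alpha delta beta (sq_modulus g) (z k) (z (S k))) :
  is_lim_seq (fun n => fst (z n) ^ 2 + snd (z n) ^ 2) p_infty \/
  exists zs : R * R,
    filterlim z eventually (locally zs) /\
    ~ is_pole g zs /\
    grad (sq_modulus g) zs = zero.
Proof.
assert (hol : forall p, ~ is_pole g p -> holomorphic_at g p).
{ intros p Np; destruct (g_mero p); [assumption|contradiction]. }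
assert (centre : forall (p : C) rho, 0 < rho -> Cmod (p - p) < rho).
{ intros p rho Hr; replace (p - p)%C with (RtoC 0) by ring; rewrite Cmod_0; exact Hr. }
assert (np : forall n, ~ is_pole g (z n)).
{ induction n as [|n IH]; [exact z0_not_pole|].
  destruct (holomorphic_at_structure g (z n) (hol _ IH)) as (g1 & g2 & rho & M & Hr & Tg & _).
  apply (step_decrease g g1 g2 (z n) rho M Tg alpha beta delta beta_range delta_distinct
    (z n) (z (S n)) (centre _ _ Hr) (z_nqn n)). }
assert (dec : forall n, sq_mod g (z (S n)) <= sq_mod g (z n)).
{ intros n.
  destruct (holomorphic_at_structure g (z n) (hol _ (np n))) as (g1 & g2 & rho & M & Hr & Tg & _).
  apply (step_decrease g g1 g2 (z n) rho M Tg alpha beta delta beta_range delta_distinct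
    (z n) (z (S n)) (centre _ _ Hr) (z_nqn n)). }
assert (bound : forall n, sq_mod g (z n) <= sq_mod g (z O)).
{ induction n as [|n IH]; [lra|]. specialize (dec n); lra. }
set (all := fun _ : nat => True).
assert (cl_np : forall p, cluster z all p -> ~ is_pole g p).
{ intros p Hcl Pole; assert (Hp := proj2 Pole); set (T := 1 + sq_mod g (z O)).
  assert (A : @locally' C_UniformSpace p (fun w => T < Cmod (g w))).
  { apply (Hp (fun x => T < x)); exists T; auto. }
  apply locally_C_iff in A; destruct A as (d & Hd & A).
  destruct (Hcl d Hd O) as (n & _ & _ & Hn).
  assert (zp : z n <> p).
  { intros E; apply (np n); rewrite E; exact Pole. }
  specialize (A (z n) Hn zp). specialize (bound n). revert bound.
  unfold sq_mod at 1; rewrite <- Cmod2_alt.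
  assert (0 <= sq_mod g (z O)) by (unfold sq_mod; rewrite <- Cmod2_alt; apply pow2_ge_0).
  unfold T in A; nra. }
assert (cl_crit : forall p, cluster z all p -> grad (sq_modulus g) p = zero).
{ intros p Hcl.
  destruct (holomorphic_at_structure g p (hol _ (cl_np p Hcl))) as (g1 & g2 & rho & M & Hr & Tg & _).
  apply (grad_eq_0_iff g g1 g2 p rho M Tg p (centre _ _ Hr)).
  apply Classical_Prop.NNPP; intros N.
  destruct (step_near_noncritical_point g g1 g2 p rho M Tg alpha beta delta alpha_pos
    beta_range delta_distinct Hr N) as (eta & c & He & Hc & H).
  apply (decrease_not_frequent (fun n => sq_mod g (z n)) c Hc).
  - intros n; unfold sq_mod; rewrite <- Cmod2_alt; apply pow2_ge_0.
  - exact dec.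
  - intros m; destruct (Hcl eta He m) as (n & Hn & _ & Hz); exists n; split; [exact Hn|].
    exact (H _ _ Hz (z_nqn n)). }
destruct (excluded_middle_informative
  (is_lim_seq (fun n => fst (z n) ^ 2 + snd (z n) ^ 2) p_infty)) as [Y|N]; [left; exact Y|right].
destruct (not_lim_bounded z N) as [B HB].
destruct (bounded_cluster z all B HB) as [p Hcl].
destruct (excluded_middle_informative (exists n, grad (sq_modulus g) (z n) = zero))
  as [[n Hn]|moving].
{ exists (z n); split; [|split; [apply np|exact Hn]].
  assert (stay : forall m, (n <= m)%nat -> z m = z n).
  { intros m H; induction H as [|m H IH]; [reflexivity|].
    destruct (z_nqn m) as [[_ E]|[NZ _]]; [now rewrite E|].
    rewrite IH in NZ; contradiction. }
  apply filterlim_of_Cmod; intros eps He; exists n; intros m Hm.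
  rewrite (stay m Hm); apply centre, He. }
exists p; split; [|split; [apply cl_np, Hcl|apply cl_crit, Hcl]].
destruct (holomorphic_at_structure g p (hol _ (cl_np p Hcl)))
  as (g1 & g2 & rho & M & Hr & Tg & [const|gap]).
{ exfalso; destruct (Hcl rho Hr O) as (n & _ & _ & Hn); apply moving; exists n.
  apply (grad_eq_0_iff g g1 g2 p rho M Tg (z n) Hn).
  replace (g1 (z n)) with (RtoC 0); [ring|].
  apply (has_cderiv_unique g (z n)); [|apply (Tg (z n) Hn)].
  eapply has_cderiv_ext_loc; [|apply (has_cderiv_const (g p))].
  exists (rho - Cmod (z n - p)); split; [lra|]; intros w Hw; symmetry; apply const.
  replace (w - p)%C with ((w - z n) + (z n - p))%C by ring.
  eapply Rle_lt_trans; [apply Cmod_triangle|]; lra. }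
destruct gap as (K & HK & gap).
{ apply (grad_eq_0_iff g g1 g2 p rho M Tg p (centre _ _ Hr)), cl_crit, Hcl. }
destruct (step_near_critical_point g g1 g2 p rho M Tg alpha beta delta alpha_pos
  beta_range delta_distinct K Hr HK (fun q Hq => proj1 (gap q Hq))) as (eta & He & near).
(* From the disc of radius [eta1] a step stays within [rho / 2] of [p], where
   [p] is the only critical point. *)
set (eta1 := Rmin eta (rho / (2 * (1 + 2 * K)))).
assert (eta10 : 0 < eta1) by (apply Rmin_pos; [exact He|apply Rdiv_lt_0_compat; lra]).
assert (eta1r : (1 + 2 * K) * eta1 <= rho / 2).
{ apply Rle_trans with ((1 + 2 * K) * (rho / (2 * (1 + 2 * K)))).
  - apply Rmult_le_compat_l; [lra|apply Rmin_r].
  - right; field; lra. }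
assert (eta1e : eta1 <= eta) by apply Rmin_l.
apply filterlim_of_Cmod; intros eps Heps.
set (e := Rmin eps eta1).
assert (e0 : 0 < e) by (apply Rmin_pos; assumption).
assert (ee : e <= eps) by apply Rmin_l. assert (e1 : e <= eta1) by apply Rmin_r.
apply Classical_Prop.NNPP; intros osc.
(* The indices at which the sequence has just left the disc of radius [e]. *)
set (Q := fun n => e <= Cmod (z (S n) - p) <= rho / 2).
assert (often : forall m, exists n, (m <= n)%nat /\ Q n /\ Cmod (z (S n)) <= Cmod p + rho).
{ intros m; destruct (Hcl e e0 m) as (n1 & Hn1 & _ & In).
  assert (exists n2, (n1 <= n2)%nat /\ ~ Cmod (z n2 - p) < e) as (n2 & Hn2 & Out).
  { apply Classical_Prop.NNPP; intros H; apply osc; exists n1; intros n Hn.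
    apply Rlt_le_trans with (2 := ee), Rnot_le_lt; intros Le; apply H; exists n; split;
      [exact Hn|lra]. }
  destruct (crossing (fun n => Cmod (z n - p) < e) n1 n2 Hn2 In Out) as (n & Hn & I1 & O1).
  exists n; split; [lia|].
  assert (St : Cmod (z (S n) - p) <= rho / 2).
  { replace (z (S n) - p)%C with ((z (S n) - z n) + (z n - p))%C by ring.
    eapply Rle_trans; [apply Cmod_triangle|].
    assert (J := near (z n) (z (S n)) ltac:(lra) (z_nqn n)).
    apply Rle_trans with ((1 + 2 * K) * Cmod (z n - p)); [lra|].
    apply Rle_trans with (2 := eta1r), Rmult_le_compat_l; lra. }
  split; [split; lra|].
  assert (T := Cmod_triangle_rev (z (S n)) p). lra. }
destruct (bounded_cluster (fun n => z (S n)) Q (Cmod p + rho) often) as [p' Hcl'].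
assert (Hp' : cluster z all p').
{ intros x Hx m; destruct (Hcl' x Hx m) as (n & Hn & _ & Hz).
  exists (S n); split; [lia|split; [exact I|exact Hz]]. }
assert (range : e / 2 <= Cmod (p' - p) < rho).
{ assert (x0 : 0 < Rmin (e / 2) (rho / 2)) by (apply Rmin_pos; lra).
  destruct (Hcl' _ x0 O) as (n & _ & Qn & Hz); unfold Q in Qn.
  assert (M1 := Rmin_l (e / 2) (rho / 2)). assert (M2 := Rmin_r (e / 2) (rho / 2)).
  assert (T1 := Cmod_triangle (z (S n) - p') (p' - p)).
  replace (z (S n) - p' + (p' - p))%C with (z (S n) - p)%C in T1 by ring.
  assert (T2 := Cmod_triangle (- (z (S n) - p')) (z (S n) - p)).
  replace (- (z (S n) - p') + (z (S n) - p))%C with (p' - p)%C in T2 by ring.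
  rewrite Cmod_opp in T2. lra. }
apply (proj2 (gap p' (proj2 range))).
- intros E; rewrite E in range; replace (p - p)%C with (RtoC 0) in range by ring.
  rewrite Cmod_0 in range; lra.
- apply (grad_eq_0_iff g g1 g2 p rho M Tg p' (proj2 range)), cl_crit, Hp'.
Qed.
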